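(* Let $\mathbb F$ be a finite field of order $q^t$ for some prime $q$ and $t\in\mathbb N$. Let $A$ be a full rank $\ell\times k$ integer matrix such that $A$ satisfies the $q$-columns condition and $A$ is irredundant with respect to $\mathbb F^n$ for all sufficiently large $n\in\mathbb N$. Given any integer $r\ge2$, there exist constants $C,c>0$ such that $$\lim_{n\to\infty}\mathbb P\big[\mathbb F^n_p\text{ is }(A,r)\text{-Rado}\big]=\begin{cases}0 & \text{if } p\le c\,|\mathbb F|^{-n/m_{\mathbb F}(A)};\\ 1 & \text{if } p\ge C\,|\mathbb F|^{-n/m_{\mathbb F}(A)}.\end{cases}$$
   Context: The integer entries of $A$ are viewed as elements $a_{ij}\cdot1_{\mathbb F}$ of $\mathbb F$ (equivalently, integers act on $\mathbb F^n$ by repeated addition); all ranks are computed over $\mathbb F$ for this image matrix. Full rank means rank equal to the number of rows $\ell$. $\mathbb F^n_p$ is the random subset of $\mathbb F^n$ containing each element independently with probability $p$. A subset $S\subseteq\mathbb F^n$ is $(A,r)$-Rado if every $r$-colouring of $S$ yields a monochromatic $x\in S^k$ with pairwise distinct entries and $Ax=0$. $A$ is irredundant with respect to $\mathbb F^n$ if $Ax=0$ has a solution in $\mathbb F^n$ with pairwise distinct entries. The $q$-columns condition is the columns condition over $\mathbb Z_q$ with entries of $A$ read modulo $q$: there is a partition $C_0,\dots,C_m$ of the columns such that, with $s_i$ the sum of the columns in $C_i$, $s_0=0$ and each $s_i$ ($i\ge1$) is a $\mathbb Z_q$-linear combination of the columns in $C_0\cup\dots\cup C_{i-1}$. With $A_{\overline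 W}$ the columns indexed by $[k]\setminus W$ (rank $0$ if empty), $m_{\mathbb F}(A):=\max_{W\subseteq[k],|W|\ge2}\frac{|W|-1}{|W|-1+\mathrm{rank}_{\mathbb F}(A_{\overline W})-\mathrm{rank}_{\mathbb F}(A)}$. *)

(* Defs.v *)
From mathcomp Require Import all_boot all_order all_algebra.
From mathcomp Require Import reals.

Set Implicit Arguments.
Unset Strict Implicit.
Unset Printing Implicit Defensive.

Import GRing.Theory Num.Theory.
Local Open Scope ring_scope.

Definition columns_condition (K : comNzRingType) (l k : nat)
    (B : 'M[K]_(l, k)) : Prop :=
  exists (m : nat) (C : 'I_m.+1 -> {set 'I_k}),
    [/\ (forall i, C i != set0) /\
        (forall i j, i != j -> [disjoint C i & C j]),
        \bigcup_i C i = [set: 'I_k],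
        \sum_(j in C ord0) col j B = 0 &
        forall i, i != ord0 -> exists a : 'I_k -> K,
          \sum_(j in C i) col j B =
          \sum_(j in \bigcup_(i' < m.+1 | (i' < i)%N) C i') a j *: col j B].

Definition q_columns_condition (q l k : nat) (A : 'M[int]_(l, k)) : Prop :=
  columns_condition (map_mx intr A : 'M['F_q]_(l, k)).

Definition int_mx (F : finFieldType) (l k : nat) (A : 'M[int]_(l, k)) :
    'M[F]_(l, k) :=
  map_mx intr A.

Definition full_rank (F : finFieldType) (l k : nat) (A : 'M[int]_(l, k)) : bool :=
  \rank (int_mx F A) == l.

(* A vector x in (F^n)^k is the k x n matrix whose i-th row is x_i; then
   A x = 0 is the matrix equation below. *)
Definition distinct_solution (F : finFieldType) (l k n : nat)
    (A : 'M[int]_(l, k)) (x : 'M[F]_(k, n)) : bool :=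
  injectiveb (fun i : 'I_k => row i x) && (int_mx F A *m x == 0).

Definition irredundant (F : finFieldType) (l k : nat) (A : 'M[int]_(l, k))
    (n : nat) : bool :=
  [exists x : 'M[F]_(k, n), distinct_solution A x].

(* Colourings of S are given by colourings of all of F^n, of which only the
   values on S matter (for r > 0 every colouring of S extends). *)
Definition rado (F : finFieldType) (l k : nat) (A : 'M[int]_(l, k))
    (r n : nat) (S : {set 'rV[F]_n}) : bool :=
  [forall f : {ffun 'rV[F]_n -> 'I_r}, exists x : 'M[F]_(k, n),
    [&& distinct_solution A x,
        [forall i, row i x \in S] &
        [exists a : 'I_r, forall i, f (row i x) == a]]].

Definition cols_outside (F : finFieldType) (l k : nat) (A : 'M[int]_(l, k))
    (W : {set 'I_k}) : 'M[F]_(l, #|~: W|) :=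
  colsub (fun j : 'I_#|~: W| => enum_val j) (int_mx F A).

(* The default 0 of the maximum is immaterial: W = [set: 'I_k] contributes a
   positive term whenever the matrix satisfies the hypotheses of the theorem,
   which also make all the denominators positive. *)
Definition m_param (F : finFieldType) (R : realType) (l k : nat)
    (A : 'M[int]_(l, k)) : R :=
  \big[Num.max/0]_(W : {set 'I_k} | (2 <= #|W|)%N)
    ((#|W|%:R - 1) /
     (#|W|%:R - 1 + (\rank (cols_outside F A W))%:R - (\rank (int_mx F A))%:R)).

(* Law of the random subset of T containing each element independently with
   probability p. *)
Definition binomial_subset_pr (R : realType) (T : finType) (p : R)
    (E : pred {set T}) : R :=
  \sum_(S : {set T} | E S) \prod_(x : T) (if x \in S then p else 1 - p).

(* Main.v *)
Require Import Defs.
From mathcomp Require Import all_boot all_order all_algebra all_field.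
From mathcomp Require Import reals.
From mathcomp Require Import ring lra zify.

Set Implicit Arguments.
Unset Strict Implicit.
Unset Printing Implicit Defensive.

(* Let G be a matrix whose columns form a basis of ker A, so that the solutions of A x = 0 in F^n
   are the products G y, and write e(W) for the rank of the rows of G in W. Then m(A) is the
   maximum of (|W|-1)/(e(W)-1), and with N = |F|^n, at p0 = N^(-1/m) a vertex lies on average in
   O(1) projections of solutions onto a set W attaining the maximum.

   The 1-statement. The columns condition makes every row of G c start with a 1 for a suitable c,
   so iterating the Hales-Jewett theorem gives monochromatic solutions of full rank, and averaging
   over linear maps F^n0 -> F^n turns this into supersaturation: colour classes covering almost
   all of F^n contain a positive proportion of the solutions. Hypergraph containers then cover
   any colouring without monochromatic solution by few sparse sets, which miss a positive
   proportion of F^n; a union bound over the fingerprints finishes the proof.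

   The 0-statement. For a minimal W attaining the maximum, the hypergraph of projections of
   solutions onto W is strictly balanced. In a critical non-2-colourable subhypergraph every
   vertex v of an edge e is the only common vertex of e with another edge. Following such edges
   produces a long path, or a cycle together with one more edge that meets it in an unexpected
   way, and the expected number of such configurations tends to 0. The one other possibility, four
   triples on six points, is 2-colourable. *)

(** * The Hales-Jewett theorem *)

Section HalesJewett.

(** For the 0-statement two of the [r] colours suffice. The obstacle is that the first moment of
    single cycles does not vanish at p0, so finding a cycle is no contradiction: the structural
    argument must always produce one more edge, meeting the rest in at least two but not all of its
    vertices. By strict balance such an edge contributes a factor beta^n with beta < 1,
    exponentially small in n, and this absorbs the polynomially many shapes of length O(n) and the
    polynomially many ways of attaching edges. The smallness of c serves the paths only: a step
    costs at most 1/(2|F|), so n steps outweigh the |F|^n starting points. For the 1-statement the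
    fingerprints have size O(p0 N), while missing a fixed proportion of F^n has probability
    exp(-Omega(pN)), so a large C wins. Both parts use m > 1, which holds because A has at least one
    row: it makes p0 N grow exponentially and forces edges of at least three vertices. *)

Definition fill (I A : finType) (l : {ffun I -> option A}) (a : A) : {ffun I -> A} :=
  [ffun i => odflt a (l i)].

Definition mono_line (I A K : finType) (f : {ffun I -> A} -> K)
    (l : {ffun I -> option A}) : Prop :=
  (exists i, l i = None) /\ forall a b, f (fill l a) = f (fill l b).

Definition hales_jewett_for (A : finType) : Prop :=
  forall K : finType, exists I : finType,
    forall f : {ffun I -> A} -> K, exists l, mono_line f l.

Definition fjoin (I J : finType) (X : Type) (u : {ffun I -> X}) (v : {ffun J -> X}) :
    {ffun I + J -> X} :=
  [ffun s => match s with inl i => u i | inr j => v j end].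

(* The lines in [ls] are coloured, with distinct colours, except at their last
   points, which all coincide with [foc]. *)
Definition focused (I A K : finType) (f : {ffun I -> option A} -> K)
    (ls : seq ({ffun I -> option (option A)} * K)) (foc : {ffun I -> option A}) : Prop :=
  uniq (map snd ls) /\
  forall lc, lc \in ls ->
    [/\ exists i, lc.1 i = None, fill lc.1 None = foc &
        forall a, f (fill lc.1 (Some a)) = lc.2].

Lemma fill_join (I J A : finType) (u : {ffun I -> option A}) (v : {ffun J -> option A}) a :
  fill (fjoin u v) a = fjoin (fill u a) (fill v a).
Proof. by apply/ffunP => -[i|j]; rewrite !ffunE. Qed.

Lemma fill_const (I A : finType) (u : {ffun I -> A}) a :
  fill [ffun i => Some (u i)] a = u.
Proof. by apply/ffunP => i; rewrite !ffunE. Qed.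

(** Colour focusing. A word over [I'] is coloured by the whole colouring that it induces on the
    words over [I], so along the line [l'] obtained from [hA] the induced colouring [g] does not
    change while the letter stays in [A]. Moving along [l'] together with each focused line of [g]
    keeps the colours of these lines, and moving along [l'] alone at the focus adds one more. If the
    colour of the focus is already taken, the line of that colour is monochromatic up to its last
    point. The new letter is [None : option A]; in a line the wildcard is the outer [None]. *)
Lemma focusing (A K : finType) (a0 : A) (r : nat) : hales_jewett_for A ->
  exists I : finType, forall f : {ffun I -> option A} -> K,
    (exists ls foc, size ls = r /\ focused f ls foc) \/ exists l, mono_line f l.
Proof.
move=> hA; elim: r => [|r [I IH]].
  by exists unit => f; left; exists [::], [ffun=> None].
have [I' hI'] := hA {ffun {ffun I -> option A} -> K}.
exists (I + I')%type => f.
pose f' (v' : {ffun I' -> A}) : {ffun {ffun I -> option A} -> K} :=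
  [ffun v => f (fjoin v [ffun i => Some (v' i)])].
have [l' [[i' Hi'] l'mono]] := hI' f'.
pose u0 : {ffun I' -> option A} := [ffun i => Some (fill l' a0 i)].
pose g (v : {ffun I -> option A}) := f (fjoin v u0).
have lift_mono l : mono_line g l -> exists l, mono_line f l.
  move=> [[i Hi] Hl]; exists (fjoin l [ffun i => Some (u0 i)]); split.
    by exists (inl i); rewrite ffunE.
  by move=> a b; rewrite !fill_join !fill_const; exact: Hl.
have [[ls [foc [sz [un H]]]]|[l Hl]] := IH g; last by right; exact: (lift_mono l).
have [/mapP[lc lcin Hc]|nin] := boolP (g foc \in map snd ls).
  right; apply: (lift_mono lc.1); have [Hi Hf Hs] := H _ lcin; split=> //.
  have Hn a : g (fill lc.1 a) = lc.2 by case: a => [a|]; [exact: Hs|rewrite Hf].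
  by move=> a b; rewrite !Hn.
left.
pose L' : {ffun I' -> option (option A)} := [ffun i => omap Some (l' i)].
have L'S a : fill L' (Some a) = [ffun i => Some (fill l' a i)].
  by apply/ffunP => i; rewrite !ffunE; case: (l' i).
have gE v a : f (fjoin v (fill L' (Some a))) = g v.
  rewrite L'S /g /u0; have /ffunP/(_ v) := l'mono a a0.
  by rewrite !ffunE.
exists ((fjoin [ffun i => Some (foc i)] L', g foc)
        :: [seq (fjoin lc.1 L', lc.2) | lc <- ls]), (fjoin foc (fill L' None)).
split; first by rewrite /= size_map sz.
split; first by rewrite /= -map_comp -[map (snd \o _) ls]/(map snd ls) nin.
move=> lc; rewrite inE => /orP[/eqP -> /=|/mapP[lc0 lc0in -> /=]].
  split; first by exists (inr i'); rewrite !ffunE Hi'.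
    by rewrite fill_join fill_const.
  by move=> a; rewrite fill_join fill_const gE.
have [[i Hi] Hf Hs] := H _ lc0in; split; first by exists (inl i); rewrite !ffunE.
  by rewrite fill_join Hf.
by move=> a; rewrite fill_join gE.
Qed.

(** Only [#|K|] colours are available, so [#|K|.+1] focused lines of distinct colours cannot exist
    and [focusing] leaves a monochromatic line. *)
Lemma hales_jewett_option (A : finType) : hales_jewett_for A -> hales_jewett_for (option A).
Proof.
move=> hA K; have [a0 _|A0] := pickP (@predT A); last first.
  exists unit => f; exists [ffun=> None]; split; first by exists tt; rewrite ffunE.
  by move=> [a|] [b|] //; have := A0 _; rewrite /= => /(_ a) // || move=> /(_ b).
have [I hI] := @focusing A K a0 #|K|.+1 hA.
exists I => f; have [[ls [foc [sz [un _]]]]|//] := hI f.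
by have := max_card (mem (map snd ls)); rewrite (card_uniqP un) size_map sz ltnn.
Qed.

(** The induction adds one letter at a time; a general alphabet is an image of such a type, and
    lines project along the surjection. *)
Fixpoint iter_option (n : nat) : finType :=
  if n is n'.+1 then option (iter_option n') else void.

Lemma hales_jewett_iter_option n : hales_jewett_for (iter_option n).
Proof.
elim: n => [|n IH]; last exact: hales_jewett_option.
by move=> K; exists unit => f; exists [ffun=> None]; split; [exists tt; rewrite ffunE|case].
Qed.

Lemma iter_option_cover (B : eqType) (s : seq B) :
  exists n (h : iter_option n -> B), forall b, b \in s -> exists x, h x = b.
Proof.
elim: s => [|b s [n [h hs]]]; first by exists 0, (fun x : void => match x with end).
exists n.+1, (fun o : option (iter_option n) => if o is Some x then h x else b) => c.
rewrite inE => /orP[/eqP ->|/hs[x <-]]; first by exists None.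
by exists (Some x).
Qed.

Theorem hales_jewett (A : finType) : hales_jewett_for A.
Proof.
have [n [h hs]] := iter_option_cover (enum A).
move=> K; have [I hI] := @hales_jewett_iter_option n K.
exists I => f.
have [l [[i Hi] lmono]] := hI (fun u => f [ffun i => h (u i)]).
exists [ffun i => omap h (l i)]; split; first by exists i; rewrite ffunE Hi.
have fillE x : fill [ffun i => omap h (l i)] (h x) = [ffun i => h (fill l x i)].
  by apply/ffunP => j; rewrite !ffunE; case: (l j).
move=> a b; have [|x <-] := hs a; first by rewrite mem_enum.
by have [|y <-] := hs b; rewrite ?mem_enum // !fillE.
Qed.

End HalesJewett.

(** * Two-colourings of uniform hypergraphs *)

Section TwoColouring.
Variable V : finType.
Implicit Types (e f g B U : {set V}) (E : {set {set V}}) (s t : seq {set V}).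

Definition splits B e : bool := (e :&: B != set0) && ~~ (e \subset B).
Definition two_colourable E : bool := [exists B : {set V}, [forall e in E, splits B e]].

Lemma splitsC B e : splits (~: B) e = splits B e.
Proof.
by rewrite /splits setI_eq0 disjoints_subset setCK -[e \subset ~: B]disjoints_subset
  -setI_eq0 andbC.
Qed.

Definition critical E : bool := minset (fun E' => ~~ two_colourable E') E.

(** Without [e] the hypergraph has a colouring, and there [e] is monochromatic, say disjoint from
    [B]. Moving [v] into [B] repairs [e], so it must spoil another edge [f], which can only happen
    by [f] lying inside [v |: B]; hence [f] meets [e] in [v] alone. *)
Lemma critical_private E e v : critical E -> e \in E -> (1 < #|e|)%N -> v \in e ->
  exists2 f, f \in E & e :&: f = [set v].
Proof.
move=> /minsetP[ncol minE] eE e2 ve.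
have : two_colourable (E :\ e).
  apply: contraT => /minE/(_ (subsetDl _ _)) /setP/(_ e).
  by rewrite !inE eqxx eE.
case/existsP => B0 /forallP colB0.
have {B0 colB0} [B eB colB] : exists2 B, e :&: B = set0 & forall f, f \in E -> f != e -> splits B f.
  have colB0' f : f \in E -> f != e -> splits B0 f.
    by move=> fE fe; have /implyP := colB0 f; apply; rewrite !inE fe.
  have : ~~ splits B0 e.
    apply: contra ncol => spe; apply/existsP; exists B0; apply/forallP => f; apply/implyP => fE.
    by have [->//|fe] := eqVneq f e; apply: colB0'.
  rewrite {1}/splits negb_and !negbK => /orP[/eqP eB|eB]; first by exists B0.
  exists (~: B0); first by apply/eqP; rewrite setI_eq0 disjoints_subset setCK.
  by move=> f fE fe; rewrite splitsC colB0'.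
have vB : v \notin B.
  by apply/negP => vB; have /setP/(_ v) := eB; rewrite !inE ve vB.
have : ~~ [forall f in E, splits (v |: B) f].
  by apply: contra ncol => H; apply/existsP; exists (v |: B).
rewrite negb_forall => /existsP[f]; rewrite negb_imply => /andP[fE nsp].
have fe : f != e.
  apply: contraNneq nsp => ->; apply/andP; split.
    by apply/set0Pn; exists v; rewrite !inE ve eqxx.
  have /card_gt0P[u] : (0 < #|e :\ v|)%N by rewrite (cardsD1 v) ve in e2.
  rewrite !inE => /andP[uv ue]; apply/subsetPn; exists u => //.
  rewrite !inE (negbTE uv) /=; apply/negP => uB.
  by have /setP/(_ u) := eB; rewrite !inE ue uB.
have /andP[fB nfB] := colB f fE fe.
exists f => //.
move: nsp; rewrite /splits negb_and !negbK => /orP[/eqP/setP H|fvB].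
  by case/set0Pn: fB => x /setIP[xf xB]; have := H x; rewrite !inE xf xB orbT.
have vf : v \in f.
  apply: contraNT nfB => vf; apply/subsetP => x xf.
  have := subsetP fvB x xf; rewrite !inE => /orP[/eqP xv|//].
  by rewrite xv (negbTE vf) in xf.
apply/setP => x; rewrite !inE; apply/andP/eqP => [[xe xf]|->//].
have := subsetP fvB x xf; rewrite !inE => /orP[/eqP//|xB].
by have /setP/(_ x) := eB; rewrite !inE xe xB.
Qed.

(** If no edge crossed the boundary of [U], the edges inside [U] and the others would be colourable
    separately by minimality, and the two colourings could be glued. *)
Lemma critical_connected E U : critical E ->
  (exists2 e, e \in E & e \subset U) -> (exists2 e, e \in E & ~~ (e \subset U)) ->
  exists g, [/\ g \in E, ~~ (g \subset U) & g :&: U != set0].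
Proof.
move=> /minsetP[ncol minE] [e1 e1E e1U] [e2 e2E e2U].
have [/existsP[g /and3P[? ? ?]]|/existsPn none] :=
  boolP [exists g, [&& g \in E, ~~ (g \subset U) & g :&: U != set0]]; first by exists g.
have disj g : g \in E -> ~~ (g \subset U) -> g :&: U = set0.
  by move=> gE gU; apply/eqP; have := none g; rewrite gE gU negbK.
have sub_col (P : pred {set V}) x : x \in E -> ~~ P x ->
    two_colourable [set e in E | P e].
  move=> xE nPx; apply: contraT => /minE H.
  have /H/setP/(_ x) : [set e in E | P e] \subset E by apply/subsetP => y; rewrite inE => /andP[].
  by rewrite inE xE (negbTE nPx).
have /existsP[B1 /forallP c1] := sub_col (fun e => e \subset U) e2 e2E e2U.
have /existsP[B2 /forallP c2] : two_colourable [set e in E | ~~ (e \subset U)].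
  by apply: (sub_col (fun e => ~~ (e \subset U)) e1 e1E); rewrite negbK.
case/negP: ncol; apply/existsP; exists ((B1 :&: U) :|: (B2 :\: U)).
apply/forallP => g; apply/implyP => gE; have [gU|gU] := boolP (g \subset U).
  have /implyP := c1 g; rewrite inE gE gU => /(_ isT).
  have BE x : x \in g -> (x \in B1 :&: U :|: B2 :\: U) = (x \in B1).
    by move=> /(subsetP gU) xU; rewrite !inE xU /= andbT orbF.
  case/andP => /set0Pn[x /setIP[xg xB]] /subsetPn[y yg yB]; apply/andP; split.
    by apply/set0Pn; exists x; rewrite inE xg BE.
  by apply/subsetPn; exists y; rewrite ?BE.
have /implyP := c2 g; rewrite inE gE gU => /(_ isT).
have BE x : x \in g -> (x \in B1 :&: U :|: B2 :\: U) = (x \in B2).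
  move=> xg; have xU : x \notin U.
    by apply/negP => xU; have /setP/(_ x) := disj g gE gU; rewrite !inE xg xU.
  by rewrite !inE (negbTE xU) /= andbF.
case/andP => /set0Pn[x /setIP[xg xB]] /subsetPn[y yg yB]; apply/andP; split.
  by apply/set0Pn; exists x; rewrite inE xg BE.
by apply/subsetPn; exists y; rewrite ?BE.
Qed.

Lemma critical_exists E : ~~ two_colourable E -> exists2 E', critical E' & E' \subset E.
Proof.
move=> ncol; have [E' minE' subE'] := minset_exists (P := fun E' => ~~ two_colourable E') ncol.
by exists E'.
Qed.

Lemma critical_nonempty E : critical E -> exists e, e \in E.
Proof.
move=> /minsetP[ncol _]; apply/set0Pn; apply: contraNneq ncol => ->.
by apply/existsP; exists set0; apply/forallP => e; rewrite inE.
Qed.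

(* Steps of an edge sequence, listed with the latest edge first: the new edge
   meets the previous ones in one vertex of the latest edge (LR), in one vertex
   (LJ), in two vertices (LC), or in at least two but not all its vertices (LI). *)
Inductive label := LR | LJ | LC | LI.

Fixpoint cov s : {set V} := if s is g :: s' then g :|: cov s' else set0.

Definition step_ok (l : label) s g : bool :=
  match l with
  | LR => (#|g :&: cov s| == 1) && (g :&: cov s \subset head set0 s)
  | LJ => #|g :&: cov s| == 1
  | LC => #|g :&: cov s| == 2
  | LI => (1 < #|g :&: cov s|) && ~~ (g \subset cov s)
  end.

Fixpoint matches (ls : seq label) s : bool :=
  match ls, s with
  | [::], g :: s' => nilp s'
  | l :: ls', g :: s' => step_ok l s' g && matches ls' s'
  | _, _ => false
  end.

(** Read from right to left these are: a long path; two edges sharing several vertices whose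
    connecting path closes up; a cycle with an [LI] edge; a cycle with a tail that ends in an [LI]
    edge. All but the first contain exactly one [LC] and one [LI]. *)
Inductive bad_word (L : nat) : seq label -> Prop :=
| bad_long : bad_word L (nseq L LR)
| bad_loop a : a <= L -> bad_word L (LC :: nseq a LR ++ [:: LI])
| bad_cycle a : a <= L -> bad_word L (LI :: LC :: nseq a LR)
| bad_handle a b : a <= L -> b <= L -> bad_word L (LI :: nseq b LR ++ LJ :: LC :: nseq a LR).

Lemma cov_cat s t : cov (s ++ t) = cov s :|: cov t.
Proof. by elim: s => [|g s IH] /=; rewrite ?set0U // IH setUA. Qed.

Lemma mem_cov s g : g \in s -> g \subset cov s.
Proof.
elim: s => //= h s IH; rewrite inE => /orP[/eqP ->|/IH]; first exact: subsetUl.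
by move/subset_trans; apply; apply: subsetUr.
Qed.

Lemma matches_size ls s : matches ls s -> size s = (size ls).+1.
Proof. by elim: ls s => [|l ls IH] [|g s] //=; [case: s|case/andP => _ /IH ->]. Qed.

(** The common vertex lies in the latest edge, so forgetting the oldest edges [t] does not destroy
    an [LR] step. *)
Lemma step_R_prefix s t g : ~~ nilp s -> step_ok LR (s ++ t) g -> step_ok LR s g.
Proof.
case: s => // h s _ /= /andP[/cards1P[v gv] /subsetP sub].
have vh : v \in h by apply: sub; rewrite gv inE.
have -> : g :&: (h :|: cov s) = [set v].
  apply/setP => x; rewrite in_setI; apply/andP/idP => [[xg xs]|].
    rewrite -gv !inE xg /= cov_cat; move: xs; rewrite !inE => /orP[->//|->].
    by rewrite orbT.
  have /setIP[vg _] : v \in g :&: (h :|: cov (s ++ t)) by rewrite gv inE.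
  by rewrite inE => /eqP ->; split; last by rewrite inE vh.
by rewrite cards1 sub1set.
Qed.

Lemma matches_R_prefix n ls s : matches (nseq n LR ++ ls) s -> matches (nseq n LR) (take n.+1 s).
Proof.
elim: n s => [|n IH] s.
  by case: s => [|g s] /=; [case: ls|rewrite take0].
case: s => [//|g s] /= /andP[st m]; have mp := IH _ m; rewrite mp andbT.
have sz : ~~ nilp (take n.+1 s) by case: (s) mp => //; case: (n).
by rewrite -[s](cat_take_drop n.+1) in st; apply: step_R_prefix sz st.
Qed.

Let pred_gt1 w : 2 < w -> 1 < w.-1. Proof. by case: w => [|[|[]]]. Qed.

Let three_ones a b w : 2 < w -> a <= 1 -> b <= 1 -> w <= a + 1 + b ->
  [/\ a = 1, b = 1 & w = 3].
Proof. by move=> h1 h2 h3 h4; split; lia. Qed.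

(** * Critical hypergraphs without bad sequences *)

Section Critical.
Variables (E : {set {set V}}) (w L : nat).
Hypotheses (critE : critical E) (w3 : 2 < w).
Hypothesis cardE : forall e, e \in E -> #|e| = w.
Hypothesis no_bad : forall ls s, bad_word L ls -> {subset s <= E} -> matches ls s -> False.

Let priv e v : e \in E -> v \in e -> exists2 f, f \in E & e :&: f = [set v].
Proof. by move=> eE ve; apply: critical_private => //; rewrite cardE // ltnW. Qed.

Let eq_edge e f : e \in E -> f \in E -> e \subset f -> e = f.
Proof. by move=> eE fE ef; apply/eqP; rewrite eqEcard ef !cardE /=. Qed.

(** [L] consecutive [LR] steps, cut loose from the edges before them, would be a [bad_long]
    sequence, so the extension stops. *)
Lemma maximal_chain ls s : matches ls s -> {subset s <= E} ->
  exists n t, [/\ n < L, {subset t <= E}, matches (nseq n LR ++ ls) t &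
                  forall g, g \in E -> ~~ step_ok LR t g].
Proof.
move=> ms sE.
have : forall m, (exists n t, [/\ n < L, {subset t <= E}, matches (nseq n LR ++ ls) t &
                  forall g, g \in E -> ~~ step_ok LR t g]) \/
    exists t, {subset t <= E} /\ matches (nseq m LR ++ ls) t.
  elim=> [|m [|[t [tE mt]]]]; [by right; exists s|by left|].
  have mL : m < L.
    rewrite ltnNge; apply/negP => Lm.
    have := mt; rewrite -(subnK Lm) addnC nseqD -catA => /matches_R_prefix mL.
    by apply: (no_bad (bad_long L) _ mL) => x /mem_take /tE.
  have [/existsP[g /andP[gE sg]]|/existsPn none] := boolP [exists g, (g \in E) && step_ok LR t g].
    by right; exists (g :: t); split; [move=> x; rewrite inE => /orP[/eqP ->|/tE]|apply/andP].
  by left; exists m, t; split=> // g gE; have := none g; rewrite gE.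
move=> /(_ L) [//|[t [tE]]] /matches_R_prefix mL.
by case: (no_bad (bad_long L) _ mL) => x /mem_take /tE.
Qed.

Lemma card_cov_chain n s : {subset s <= E} -> matches (nseq n LR) s ->
  #|cov s| = n * w.-1 + w.
Proof.
elim: n s => [|n IH] [|g s] //= sE.
  by case: s sE => //= sE _; rewrite setU0 cardE // sE // inE eqxx.
have gE : g \in E by apply: sE; rewrite inE eqxx.
move=> /andP[/andP[/eqP g1 _] /IH H].
have {}H : #|cov s| = n * w.-1 + w by apply: H => x xs; apply: sE; rewrite inE xs orbT.
have := cardsUI g (cov s); rewrite g1 H (cardE gE) mulSn; move: (n * w.-1) w3 => x w3'; lia.
Qed.

Lemma card_cov_cycle n s : {subset s <= E} -> matches (LC :: nseq n LR) s ->
  #|cov s| = n.+2 * w.-1.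
Proof.
case: s => [|g s] //= sE /andP[/eqP g2 /card_cov_chain H].
have gE : g \in E by apply: sE; rewrite inE eqxx.
have {}H : #|cov s| = n * w.-1 + w by apply: H => x xs; apply: sE; rewrite inE xs orbT.
have := cardsUI g (cov s); rewrite g2 H (cardE gE) !mulSn; move: (n * w.-1) w3 => x w3'; lia.
Qed.

(* The only configurations on which the first moment does not vanish are single
   cycles; a cycle that misses a vertex of E can be extended to a bad sequence. *)
Lemma cycle_spans n s : n <= L -> {subset s <= E} -> matches (LC :: nseq n LR) s ->
  forall g, g \in E -> g \subset cov s.
Proof.
move=> nL sE ms g0 g0E; apply: contraT => g0s; exfalso.
have [g1 g1s] : exists g1, g1 \in s by case: (s) ms => // g1 s' _; exists g1; rewrite inE eqxx.
have [|g [gE gs gm]] := critical_connected critE _ (ex_intro2 _ _ g0 g0E g0s).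
  by exists g1; [exact: sE|exact: mem_cov].
have ge1 : 0 < #|g :&: cov s| by rewrite card_gt0.
have subE x (t : seq {set V}) : x \in E -> {subset t <= E} -> {subset x :: t <= E}.
  by move=> xE tE y; rewrite inE => /orP[/eqP ->|/tE].
have [g2|g1'] := ltnP 1 #|g :&: cov s|.
  by apply: (no_bad (bad_cycle nL) (subE _ _ gE sE)); rewrite /= g2 gs.
have gJ : matches (LJ :: LC :: nseq n LR) (g :: s) by rewrite /= -/(matches (LC :: _) s) ms eqn_leq g1' ge1.
have [b [t [bL tE mt tmax]]] := maximal_chain gJ (subE _ _ gE sE).
case: t tE mt tmax => [|h t] tE mt tmax; first by case: (b) mt.
have hE : h \in E by apply: tE; rewrite inE eqxx.
have tE' : {subset t <= E} by move=> x xt; apply: tE; rewrite inE xt orbT.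
have h1 : #|h :&: cov t| = 1.
  by case: (b) mt => [|b'] /= /andP[]; [move=> /eqP|move=> /andP[/eqP]].
have : 0 < #|h :\: cov t| by rewrite cardsD h1 (cardE hE) subn_gt0 ltnW.
case/card_gt0P => v; rewrite inE => /andP[vt vh].
have [f fE hf] := priv hE vh.
have vf : v \in f by have /setIP[] : v \in h :&: f by rewrite hf inE.
(* Otherwise [f] would prolong the maximal tail by an [LR] step. *)
have f2 : 1 < #|f :&: cov (h :: t)|.
  rewrite ltnNge; apply: contra (tmax f fE) => le1.
  have fv : f :&: cov (h :: t) = [set v].
    apply/eqP; rewrite eq_sym eqEcard sub1set cards1 le1 andbT !inE vf vh //.
  by rewrite /= fv cards1 eqxx sub1set.
have [fsub|fsub] := boolP (f \subset cov (h :: t)); last first.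
  apply: (no_bad (bad_handle nL (ltnW bL)) (subE _ _ fE tE)).
  by rewrite /= -/(cov (h :: t)) f2 fsub.
(* Since [f] meets [h] only in [v], its other [w - 1] vertices already lie in [t]; so [f] can
   replace [h] as an [LI] step over [t], which is either the cycle itself or the cycle with a
   shorter tail. *)
have ft : #|f :&: cov t| = w.-1.
  have -> : f :&: cov t = f :\ v.
    apply/setP => x; rewrite !inE andbC; have [xf|xf] := boolP (x \in f); rewrite ?andbF //= !andbT.
    have := subsetP fsub x xf; rewrite /= inE => /orP[xh|xt].
      have : x \in h :&: f by rewrite inE xh.
      by rewrite hf inE => /eqP ->; rewrite eqxx (negbTE vt).
    by rewrite xt; apply/esym; apply: contraNneq vt => <-.
  by have := cardsD1 v f; rewrite vf (cardE fE) add1n => ->.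
have fI : step_ok LI t f.
  rewrite /= ft; apply/andP; split; first exact: pred_gt1.
  by apply/negP => /subsetP/(_ v vf); rewrite (negbTE vt).
case: b mt bL => [|b] /= /andP[_ mt] bL.
  by apply: (no_bad (bad_cycle nL) (subE _ _ fE tE')); apply/andP; split.
apply: (no_bad (bad_handle nL (ltnW (ltnW bL))) (subE _ _ fE tE')).
by apply/andP; split.
Qed.

(** By [cycle_spans] all cycles cover the same vertices, and the number of vertices of a cycle
    determines its length. *)
Lemma cycle_length n s n' s' : n <= L -> {subset s <= E} -> matches (LC :: nseq n LR) s ->
  n' <= L -> {subset s' <= E} -> matches (LC :: nseq n' LR) s' -> n = n'.
Proof.
have cov_sub (m : {set V}) (t : seq {set V}) : {subset t <= E} -> (forall g, g \in E -> g \subset m) -> cov t \subset m.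
  move=> + H; elim: t => [|g t IH] tE /=; first exact: sub0set.
  rewrite subUset H ?IH // => [x xt|]; apply: tE; rewrite inE ?xt ?orbT ?eqxx //.
move=> nL sE ms n'L s'E ms'.
have c1 := cov_sub _ _ s'E (cycle_spans nL sE ms).
have c2 := cov_sub _ _ sE (cycle_spans n'L s'E ms').
have covE : cov s = cov s' by apply/eqP; rewrite eqEsubset c1 c2.
have := card_cov_cycle sE ms; rewrite covE (card_cov_cycle s'E ms') => /eqP.
by rewrite eqn_pmul2r; [move/eqP => -[]|apply: ltnW; exact: pred_gt1].
Qed.

Let disjoint_cov f t : all (fun x => x :&: f == set0) t -> f :&: cov t = set0.
Proof.
elim: t => [|g t IH] /=; first by rewrite setI0.
by case/andP => /eqP gf /IH ft; rewrite setIUr ft setIC gf setU0.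
Qed.

(** The edges of [t] avoid [f], so inserting [f] as the oldest edge leaves their steps intact; only
    [g] acquires a predecessor. *)
Let loop_matches f g t : 1 < #|g :&: f| -> ~~ (g \subset f) ->
  all (fun x => x :&: f == set0) t -> matches (nseq (size t) LR) (t ++ [:: g]) ->
  matches (nseq (size t) LR ++ [:: LI]) (t ++ [:: g; f]).
Proof.
move=> gf ngf; elim: t => [|x t IH] /=; first by rewrite setU0 gf ngf.
case/andP => /eqP xf dt /andP[st mt]; rewrite (IH dt mt) andbT.
have cE : cov (t ++ [:: g; f]) = cov (t ++ [:: g]) :|: f.
  by rewrite !cov_cat /= !setU0 setUA.
have -> : head set0 (t ++ [:: g; f]) = head set0 (t ++ [:: g]) by case: (t).
by rewrite cE setIUr xf setU0.
Qed.

(** Let [g] be the latest edge before [e] that [f] meets: the part of the chain from [g] to [e]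
    closes up with [f]. If [f] met [g] in two vertices, the sequence started with [f] instead would
    have [g] as an [LI] step and [e] as its closing [LC] step, a [bad_loop]. *)
Lemma close_chain n s f v : n <= L -> {subset s <= E} -> matches (nseq n LR) s -> f \in E ->
    head set0 s :&: f = [set v] -> v \notin cov (behead s) -> f :&: cov (behead s) != set0 ->
  exists e t1 g t2, [/\ s = e :: t1 ++ g :: t2, all (fun x => x :&: f == set0) t1,
    #|f :&: g| = 1 & matches (LC :: nseq (size t1).+1 LR) (f :: e :: t1 ++ [:: g])].
Proof.
case: s => [|e s] nL sE ms fE //=; first by case: (n) ms.
move=> ef vs; have [hs _|/hasPn nh] := boolP (has (fun x => x :&: f != set0) s); last first.
  case/negP; apply/eqP; apply: disjoint_cov; apply/allP => x xs.
  by have := nh x xs; rewrite negbK.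
move: hs sE ms vs; case/split_find => g t1 t2 gf nht1; rewrite cat_rcons => sE ms vs.
have dt1 : all (fun x => x :&: f == set0) t1.
  by apply/allP => x xt; have /hasPn/(_ x xt) := nht1; rewrite negbK.
have nE : n = (size t1).+1 + size t2.
  by have := matches_size ms; rewrite /= size_cat size_nseq /= => -[<-]; rewrite addnS.
have mp : matches (nseq (size t1).+1 LR) (e :: t1 ++ [:: g]).
  move: ms; rewrite nE nseqD => /matches_R_prefix /=.
  by rewrite take_cat ltnNge leqnSn /= subSnn /= take0.
have gE : g \in E by apply: sE; rewrite inE mem_cat inE eqxx /= !orbT.
have vU : v \notin cov (t1 ++ [:: g]).
  by move: vs; rewrite !cov_cat /= setU0 !inE !negb_or => /and3P[-> ->].
have vg : v \notin g.
  by move: vU; rewrite cov_cat /= setU0 !inE negb_or => /andP[].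
have /setIP[ve vf] : v \in e :&: f by rewrite ef inE.
have fg1 : #|f :&: g| = 1.
  apply/eqP; rewrite eqn_leq card_gt0 setIC gf andbT leqNgt; apply/negP => fg2.
  have tL : size t1 <= L by rewrite (leq_trans _ nL) // nE addSn leqW // leq_addr.
  case/andP: (mp) => st mt.
  apply: (no_bad (bad_loop tL)) (_ : matches _ (e :: t1 ++ [:: g; f])).
    move=> x; rewrite inE mem_cat !inE => /orP[/eqP ->|/orP[xt|/orP[/eqP -> //|/eqP -> //]]].
      by apply: sE; rewrite inE eqxx.
    by apply: sE; rewrite inE mem_cat xt orbT.
  apply/andP; split.
    have cE : cov (t1 ++ [:: g; f]) = cov (t1 ++ [:: g]) :|: f.
      by rewrite !cov_cat /= !setU0 setUA.
    rewrite /= cE setIUr ef setUC cardsU1 !inE (negbTE vU) andbF.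
    by case/andP: st => /eqP ->.
  apply: loop_matches => //.
  by apply: contra vg => gsf; rewrite (eq_edge gE fE gsf).
exists e, t1, g, t2; split=> //.
apply/andP; split=> //.
rewrite /= cov_cat /= setU0 !setIUr (disjoint_cov dt1) set0U setIC ef cardsU1 fg1.
by rewrite inE (negbTE vg) andbF.
Qed.

(** Let [e] be the newest edge of a maximal chain. It has two vertices [v1] and [v2] outside the
    part of the chain used below, with private edges [f1] and [f2]. By maximality [f1] closes a
    cycle, which spans everything, so [f2] lies inside it; each of [f1], [e] and the rest covers at
    most one vertex of [f2]. Hence [w = 3], and [e], [f1], [f2], [g] are the four triples on six
    points. *)
Lemma critical_bad : False.
Proof.
have subE x (t : seq {set V}) : x \in E -> {subset t <= E} -> {subset x :: t <= E}.
  by move=> xE tE y; rewrite inE => /orP[/eqP ->|/tE].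
have sub0 : {subset [::] <= E} by [].
have [e0 e0E] := critical_nonempty critE.
have [n [s [nL sE ms smax]]] := maximal_chain (isT : matches [::] [:: e0]) (subE _ _ e0E sub0).
rewrite cats0 in ms.
case: s sE ms smax => [|e s] sE ms smax; first by case: (n) ms.
have eE : e \in E by apply: sE; rewrite inE eqxx.
have e1 : #|e :&: cov s| <= 1.
  case: (n) ms => [|n'] /=; first by case: (s) => //= _; rewrite setI0 cards0.
  by case/andP => /andP[/eqP ->].
have /card_gt0P[v1] : 0 < #|e :\: cov s|.
  by rewrite cardsD (cardE eE) subn_gt0 (leq_ltn_trans e1) // ltnW.
rewrite inE => /andP[v1s v1e].
have [f1 f1E ef1] := priv eE v1e.
have /setIP[_ v1f1] : v1 \in e :&: f1 by rewrite ef1 inE.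
have f1s : f1 :&: cov s != set0.
  apply: contra (smax f1 f1E) => /eqP f1s.
  by rewrite /= setIUr f1s setU0 setIC ef1 cards1 eqxx sub1set.
have [e' [t1 [g [t2 [[<- sEq] dt1 f1g m1]]]]] := close_chain (ltnW nL) sE ms f1E ef1 v1s f1s.
have aL : (size t1).+1 <= L.
  apply: leq_trans (ltnW nL); have := matches_size ms.
  by rewrite /= sEq size_cat size_nseq /= addnS => -[<-]; rewrite ltnS leq_addr.
have gE : g \in E by apply: sE; rewrite sEq inE mem_cat !inE eqxx !orbT.
have s'E : {subset e :: t1 ++ [:: g] <= E}.
  move=> x; rewrite inE mem_cat !inE => /orP[/eqP -> //|/orP[xt|/eqP -> //]].
  by apply: sE; rewrite sEq inE mem_cat xt orbT.
case/andP: (m1) => _ mch; case/andP: (mch) => /andP[/eqP eU _] _.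
set U1 := cov (t1 ++ [:: g]) in eU.
have v1U : v1 \notin U1.
  by move: v1s; rewrite sEq /U1 !cov_cat /= setU0 !inE !negb_or => /and3P[-> ->].
have /card_gt0P[v2] : 0 < #|(e :\: U1) :\ v1|.
  have := cardsD1 v1 (e :\: U1); rewrite inE v1U v1e cardsD (cardE eE) eU /= add1n subn1 => H.
  by rewrite -ltnS -H; exact: pred_gt1.
rewrite !inE => /and3P[v21 v2U v2e].
have [f2 f2E ef2] := priv eE v2e.
have /setIP[_ v2f2] : v2 \in e :&: f2 by rewrite ef2 inE.
have v2f1 : v2 \notin f1.
  by apply: contra v21 => v2f1; have : v2 \in e :&: f1 by [rewrite inE v2e]; rewrite ef1 inE.
have v1f2 : v1 \notin f2.
  apply: contra v21 => v1f2; have : v1 \in e :&: f2 by rewrite inE v1e.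
  by rewrite ef2 inE eq_sym.
(* If [f2] meets [U1], it closes a cycle too; by [cycle_length] this cycle is as long as that of
   [f1], so the edge met is again the oldest one, [g], and it is met once. *)
have f2U : #|f2 :&: U1| <= 1.
  have [->|f2U] := eqVneq (f2 :&: U1) set0; first by rewrite cards0.
  have [e'' [t1' [g' [t2' [[<- sEq'] dt1' f2g m2]]]]] := close_chain aL s'E mch f2E ef2 v2U f2U.
  have sub2 : {subset f2 :: e :: t1' ++ [:: g'] <= E}.
    apply: (subE) => //; apply: (subE) => // y yt; apply: s'E; rewrite inE sEq'.
    by move: yt; rewrite !mem_cat !inE => /orP[->|->]; rewrite ?orbT.
  have szE : size t1 + 1 = size t1' + (size t2').+1.
    by have := congr1 size sEq'; rewrite !size_cat.
  have aL' : (size t1').+1 <= L.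
    by apply: leq_trans aL; rewrite -[(size t1).+1]addn1 szE addnS ltnS leq_addr.
  have [st] : (size t1).+1 = (size t1').+1 := cycle_length aL (subE _ _ f1E s'E) m1 aL' sub2 m2.
  move/eqP: sEq'; rewrite eqseq_cat // => /andP[/eqP t1E /eqP[gE' _]].
  by rewrite /U1 cov_cat /= setU0 setIUr t1E (disjoint_cov dt1') set0U gE' f2g.
have f2sub : f2 \subset cov (f1 :: e :: t1 ++ [:: g]) by apply: (cycle_spans aL (subE _ _ f1E s'E) m1).
have f12 : #|f2 :&: f1| <= 1.
  (* Otherwise [f1], [f2], [e], in this order, form a [bad_loop]: [f2] shares two vertices with
     [f1], and [e] meets them in [v1] and [v2]. *)
  rewrite leqNgt; apply/negP => f12.
  apply: (no_bad (bad_loop (leq0n L)) (_ : {subset [:: e; f2; f1] <= E})).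
    by move=> y; rewrite !inE => /or3P[] /eqP ->.
  rewrite /= !setU0 f12 setIUr ef1 ef2 cards2 v21 eqxx /= andbT.
  by apply/subsetPn; exists v2.
have f2cov : f2 = (f2 :&: f1) :|: [set v2] :|: (f2 :&: U1).
  rewrite -ef2 [e :&: f2]setIC -!setIUr; apply/esym/setIidPl.
  by move: f2sub; rewrite /= -/U1 setUA.
have ceq : #|f2| <= #|f2 :&: f1| + 1 + #|f2 :&: U1|.
  rewrite {1}f2cov (leq_trans (leq_card_setU _ _)) // leq_add2r.
  by rewrite (leq_trans (leq_card_setU _ _)) // cards1.
rewrite (cardE f2E) in ceq.
have [f12' f2U' w3'] := three_ones w3 f12 f2U ceq.
(* [e], [f1], [f2] form a triangle, so every cycle has three edges; in particular [t1] is empty. *)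
have mZ : matches (LC :: nseq 1 LR) [:: f2; f1; e].
  rewrite /= !setU0 [f1 :&: e]setIC ef1 cards1 sub1set v1e setIUr [f2 :&: e]setIC ef2 setUC.
  by rewrite cardsU1 !inE (negbTE v2f1) andbF f12'.
have L1 : 1 <= L by exact: leq_trans aL.
have ZE : {subset [:: f2; f1; e] <= E} by move=> y; rewrite !inE => /or3P[] /eqP ->.
have [t10] := cycle_length aL (subE _ _ f1E s'E) m1 L1 ZE mZ.
have {t10} t10 : t1 = [::] by case: (t1) t10.
have U1g : U1 = g by rewrite /U1 t10 /= setU0.
rewrite U1g in eU v1U v2U f2U' f2cov.
have /cards1P[u eg] : #|e :&: g| == 1 by rewrite eU.
have /setIP[ue ug] : u \in e :&: g by rewrite eg inE.
have /cards1P[x f21] : #|f2 :&: f1| == 1 by rewrite f12'.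
have /setIP[xf2 xf1] : x \in f2 :&: f1 by rewrite f21 inE.
have xe : x \notin e.
  by apply: contraNN v2f1 => xe; have : x \in e :&: f2 by [rewrite inE xe]; rewrite ef2 inE => /eqP <-.
have xg : x \notin g.
  apply/negP => xg; have /cards1P[y f2g] : #|f2 :&: g| == 1 by rewrite f2U'.
  have : x \in f2 :&: g by rewrite inE xf2.
  rewrite f2g inE => /eqP xy; move: (cardE f2E).
  by rewrite f2cov f21 f2g -xy setUAC setUid cards2 w3'; case: (_ != _).
have f1sub y : y \in f1 -> y != x -> y \in e :|: g.
  move=> yf1; apply: contraNT => yeg.
  have c1 : #|f1 :&: (e :|: g)| = 2.
    by rewrite setIUr [f1 :&: e]setIC ef1 cardsU1 f1g inE (negbTE v1U) andbF.
  have /cards1P[x' Hx'] : #|f1 :\: (e :|: g)| == 1 by rewrite cardsD c1 (cardE f1E) w3'.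
  have : x \in f1 :\: (e :|: g) by rewrite !inE (negbTE xe) (negbTE xg).
  have : y \in f1 :\: (e :|: g) by rewrite inE yeg.
  by rewrite Hx' !inE => /eqP -> /eqP ->.
(* The class consisting of [u], common to [e] and [g], and [x], common to [f1] and [f2], splits the
   four triples. An edge [h] that is not split avoids both points and so lies in [e :|: g]; it then
   shares two vertices with [e] or [g], a cycle of two edges. *)
have : ~~ [forall h in E, splits [set u; x] h].
  by have /minsetP[ncol _] := critE; apply: contra ncol => H; apply/existsP; exists [set u; x].
rewrite negb_forall => /existsP[h]; rewrite negb_imply => /andP[hE].
have h3 : #|h| = 3 by rewrite cardE.
rewrite /splits negb_and negbK => /orP[|]; rewrite ?negbK; last first.
  by move=> /subset_leq_card; rewrite h3 cards2; case: (u != x).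
move=> /eqP hB.
have uh : u \notin h by apply/negP => uh; have /setP/(_ u) := hB; rewrite !inE uh eqxx.
have xh : x \notin h by apply/negP => xh; have /setP/(_ x) := hB; rewrite !inE xh eqxx orbT.
have hsub : h \subset cov (f1 :: e :: t1 ++ [:: g]) by apply: (cycle_spans aL (subE _ _ f1E s'E) m1).
have heg : h = (h :&: e) :|: (h :&: g).
  rewrite -setIUr; apply/esym/setIidPl/subsetP => y yh.
  have := subsetP hsub y yh; rewrite t10 /= setU0 inE => /orP[yf1|//].
  by apply: f1sub => //; apply: contraNneq xh => <-.
have short k : k \in E -> u \in k -> 1 < #|h :&: k| -> False.
  move=> kE uk hk2.
  have hk : #|h :&: k| = 2.
    apply/eqP; rewrite eqn_leq hk2 andbT -ltnS -w3' -(cardE kE).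
    apply: proper_card; rewrite properE subsetIr /=; apply/subsetPn; exists u => //.
    by rewrite inE negb_and uh.
  have mh : matches (LC :: nseq 0 LR) [:: h; k] by rewrite /= setU0 hk.
  have hkE : {subset [:: h; k] <= E} by move=> y; rewrite !inE => /orP[] /eqP ->.
  by have := cycle_length L1 ZE mZ (leq0n L) hkE mh.
have [he|he] := ltnP 1 #|h :&: e|; first exact: short he.
have [hg|hg] := ltnP 1 #|h :&: g|; first exact: short hg.
have := leq_card_setU (h :&: e) (h :&: g); rewrite -heg h3 => /leq_trans/(_ (leq_add he hg)).
by [].
Qed.

End Critical.
End TwoColouring.

Import Order.TTheory GRing.Theory Num.Theory.
Local Open Scope ring_scope.

(** * Monochromatic solutions and supersaturation *)

Lemma leq_card_bigcup (I T : finType) (P : pred I) (A : I -> {set T}) :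
  (#|\bigcup_(i | P i) A i| <= \sum_(i | P i) #|A i|)%N.
Proof.
elim/big_ind2: _ => [|m B n C mB nC|//]; first by rewrite cards0.
by rewrite (leq_trans (leq_card_setU _ _)) // leq_add.
Qed.

Section Ramsey.
Variable F : finFieldType.

(** A combinatorial line over the alphabet F^M is a coset of an M-dimensional space, the letter
    being copied into the wildcard coordinates, whose indicator is [chi]. The additional first
    coordinate, 1 on every word, makes the base point independent of the directions. *)
Lemma mono_coset (r M : nat) : exists n, forall f : 'rV[F]_n -> 'I_r,
  exists (a : 'rV_n) (B : 'M_(M, n)), row_free (col_mx a B) /\
    forall u : 'rV_M, f (a + u *m B) = f a.
Proof.
have [I hI] := @hales_jewett 'rV[F]_M 'I_r.
pose c := #|I|.
exists (1 + c * M)%N => f.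
pose emb (v : {ffun I -> 'rV[F]_M}) : 'rV[F]_(1 + c * M) :=
  row_mx 1%:M (mxvec (\matrix_(i < c) v (enum_val i))).
have [l [[i0 Hi0] lmono]] := hI (fun v => f (emb v)).
pose chi : 'cV[F]_c := \col_i (l (enum_val i) == None)%:R.
pose phi := fun u : 'rV[F]_M => mxvec (chi *m u).
pose B1 := lin1_mx (mxvec \o mulmx chi : 'rV[F]_M -> 'rV[F]_(c * M)).
have B1E u : u *m B1 = mxvec (chi *m u) by rewrite mul_rV_lin1.
have embE u : emb (fill l u) = emb (fill l 0) + u *m row_mx 0 B1.
  rewrite mul_mx_row mulmx0 B1E /emb add_row_mx addr0 -linearD /=; congr (row_mx _ (mxvec _)).
  apply/matrixP => i j; rewrite !mxE big_ord1 !ffunE !mxE.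
  by case: (l _) => [w|] /=; rewrite ?mul0r ?addr0 // mxE add0r mul1r.
exists (emb (fill l 0)), (row_mx 0 B1); split; last by move=> u; rewrite -embE; exact: lmono.
apply/inj_row_free => v; rewrite -[v]hsubmxK mul_row_col.
move: (lsubmx v) (rsubmx v) => s u; rewrite /emb !mul_mx_row mulmx1 mulmx0 add_row_mx addr0.
move=> /eqP; rewrite -row_mx0 => /eqP/eq_row_mx[-> /eqP].
rewrite mul0mx add0r B1E => /eqP; rewrite -(linear0 (@mxvec F c M)) => /(can_inj mxvecK) /matrixP H.
suff -> : u = 0 by rewrite row_mx0.
apply/rowP => j; have := H (enum_rank i0) j.
by rewrite !mxE big_ord1 !mxE enum_rankK Hi0 eqxx mul1r.
Qed.

Definition lead1 (s : nat) (u : 'rV[F]_s) (i : 'I_s) : Prop :=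
  (forall j : 'I_s, (j < i)%N -> u 0 j = 0) /\ u 0 i = 1.

(** Vectors with leading index 0 fall into the monochromatic coset [a + <B'>]; the others lie in the
    direction space of [B'], where the induction hypothesis applies. *)
Lemma leading_family (r s : nat) : exists n, forall f : 'rV[F]_n -> 'I_r,
  exists B : 'M_(s, n), row_free B /\ exists c : 'I_s -> 'I_r,
    forall i u, lead1 u i -> f (u *m B) = c i.
Proof.
elim: s => [|s [ns IH]].
  exists 0%N => f; exists 0; split; first by rewrite /row_free mxrank0.
  by exists (fun=> f 0) => -[].
rewrite -(add1n s); have [n hn] := mono_coset r ns; exists n => f.
have [a [B' [fB' aB']]] := hn f.
have [B'' [fB'' [c' Hc']]] := IH (fun u => f (u *m B')).
exists (col_mx a (B'' *m B') : 'M_(1 + s, n)); split.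
  apply/inj_row_free => v; rewrite -[v](@hsubmxK _ 1 1 s) mul_row_col mulmxA -mul_row_col.
  move=> /eqP; rewrite -(mul0mx _ (col_mx a B')) => /eqP /(row_free_inj fB').
  rewrite -row_mx0 => /eq_row_mx[-> /eqP]; rewrite -(mul0mx _ B'') => /eqP /(row_free_inj fB'') ->.
  by rewrite row_mx0.
exists (fun i : 'I_(1 + s) => match split i with inl _ => f a | inr j => c' j end).
move=> i u [u0 u1]; move: u0 u1; rewrite -[u](@hsubmxK _ 1 1 s) mul_row_col mulmxA.
move: (@lsubmx _ 1 1 s u) (@rsubmx _ 1 1 s u) => {}u v.
case: (split_ordP i) => j ->; rewrite ?row_mxEl ?row_mxEr => u0 u1.
  have -> : u = 1%:M by apply/matrixP => i' j'; rewrite !ord1 !mxE -u1 ord1.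
  by rewrite mul1mx aB'.
have -> : u = 0.
  by apply/rowP => j'; rewrite ord1 mxE -(u0 (lshift s 0)) ?row_mxEl.
rewrite mul0mx add0r; apply: Hc'; split=> // j' lt.
by rewrite -(u0 (rshift 1 j')) ?row_mxEr //= ltn_add2l.
Qed.

Lemma ord_pigeonhole (r M s : nat) (c : 'I_s -> 'I_r) : (r * M < s)%N ->
  exists (a : 'I_r) (g : 'I_M -> 'I_s),
    (forall i j : 'I_M, (g i < g j)%N = (i < j)%N) /\ forall i, c (g i) = a.
Proof.
move=> lt.
have [a Ha] : exists a, (M < #|[set i | c i == a]|)%N.
  apply/existsP; apply: contraLR lt; rewrite negb_exists -leqNgt => /forallP H.
  rewrite -{1}(card_ord s) -sum1_card (partition_big c xpredT) //=.
  rewrite -[X in (_ <= X * M)%N](card_ord r) -sum_nat_const; apply: leq_sum => a _.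
  by have := H a; rewrite -leqNgt sum1dep_card.
pose t := [seq i <- enum 'I_s | c i == a].
have st : (M < size t)%N.
  have ut : uniq t by rewrite filter_uniq // enum_uniq.
  rewrite -(card_uniqP ut).
  apply: leq_trans Ha _; apply: subset_leq_card; apply/subsetP => i.
  by rewrite inE mem_filter mem_enum => ->.
have [i0 Hi0] : exists i0, i0 \in t by exists (nth (Ordinal (leq_ltn_trans (leq0n _) lt)) t 0); rewrite mem_nth // (leq_ltn_trans _ st).
exists a, (fun i : 'I_M => nth i0 t i); split; last first.
  move=> i; have : nth i0 t i \in t by rewrite mem_nth // (ltn_trans _ st).
  by rewrite mem_filter => /andP[/eqP].
have srt : sorted (relpre (@nat_of_ord s) ltn) t.
  apply: sorted_filter; first by move=> ? ? ?; apply: ltn_trans.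
  by rewrite -sorted_map val_enum_ord iota_ltn_sorted.
have mono : forall i j : 'I_M, (i < j)%N -> (nth i0 t i < nth i0 t j)%N.
  move=> i j ij; apply: (sorted_ltn_nth _ i0 srt) => //; rewrite ?inE ?(ltn_trans _ st) //.
  by move=> ? ? ?; apply: ltn_trans.
move=> i j; case: (ltngtP i j) => [/mono|/mono H|/val_inj ->]; rewrite ?ltnn //.
by apply/negbTE; rewrite -leqNgt ltnW.
Qed.

(** Among [r * M + 1] leading indices, [M] have the same colour; keeping them in increasing order
    preserves leading entries. *)
Lemma mono_leading_family (r M : nat) : exists n, forall f : 'rV[F]_n -> 'I_r,
  exists B : 'M_(M, n), row_free B /\ exists c,
    forall i u, lead1 u i -> f (u *m B) = c.
Proof.
have [n hn] := leading_family r (r * M).+1; exists n => f.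
have [B0 [fB0 [c0 Hc0]]] := hn f.
have [a [g [gmono ga]]] := ord_pigeonhole c0 (ltnSn _).
have ginj : injective g.
  move=> i j gij; apply/val_inj; have := gmono i j; have := gmono j i.
  by rewrite gij ltnn; case: ltngtP.
pose X : 'M[F]_(M, (r * M).+1) := rowsub g 1%:M.
have XE (v : 'rV_M) x : (v *m X) 0 x = \sum_j v 0 j * (g j == x)%:R.
  by rewrite mxE; apply: eq_bigr => j _; rewrite !mxE.
have Xg (v : 'rV_M) i : (v *m X) 0 (g i) = v 0 i.
  rewrite XE (bigD1 i) //= eqxx mulr1 big1 ?addr0 // => j ji.
  by rewrite (inj_eq ginj) (negbTE ji) mulr0.
exists (X *m B0); split.
  apply/inj_row_free => v /eqP; rewrite mulmxA -(mul0mx _ B0) => /eqP /(row_free_inj fB0) H.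
  by apply/rowP => i; rewrite -Xg H !mxE.
exists a => i u [u0 u1]; rewrite mulmxA -(ga i); apply: Hc0; split; last by rewrite Xg.
move=> j ji; rewrite XE big1 // => j' _; have [E|_] := eqVneq; last by rewrite mulr0.
by rewrite u0 ?mul0r // -gmono E.
Qed.

(** For [y = [c | 1] B] the rows of [G *m y] have coordinates [[G c | G]] in the family [B]. The
    block [c] makes them start with a 1, and the identity block makes [y] row free. *)
Lemma mono_solution (r k d m : nat) (G : 'M[F]_(k, d)) (c : 'M[F]_(d, m)) :
    (forall j, exists i, lead1 (row j (G *m c)) i) ->
  exists n, forall f : 'rV[F]_n -> 'I_r,
    exists y : 'M_(d, n), row_free y /\ exists a, forall j, f (row j (G *m y)) = a.
Proof.
move=> lead; have [n hn] := mono_leading_family r (m + d); exists n => f.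
have [B [fB [a Ha]]] := hn f.
exists (row_mx c 1%:M *m B); split.
  apply/inj_row_free => v /eqP; rewrite mulmxA -(mul0mx _ B) => /eqP /(row_free_inj fB).
  by rewrite mul_mx_row mulmx1 -row_mx0 => /eq_row_mx[].
exists a => j; have [i [H0 H1]] := lead j.
rewrite mulmxA row_mul mul_mx_row mulmx1; apply: (Ha (lshift d i)).
have E x : row j (row_mx (G *m c) G) 0 (lshift d x) = row j (G *m c) 0 x.
  by rewrite [LHS]mxE row_mxEl [RHS]mxE.
split; last by rewrite E.
move=> j' lt; case: (split_ordP j') lt => x -> /= lt; first by rewrite E H0.
by have := ltn_addr x (ltn_ord i); rewrite ltnNge ltnW.
Qed.

Lemma card_mulmx_eq0 (a b n : nat) (B : 'M[F]_(a, b)) :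
  #|[set x : 'M_(b, n) | B *m x == 0]| = (#|F| ^ (n * (b - \rank B)))%N.
Proof.
pose K := row_base (kermx B^T).
have -> : (#|F| ^ (n * (b - \rank B)) = #|{: 'M[F]_(n, \rank (kermx B^T))}|)%N.
  by rewrite card_mx mxrank_ker mxrank_tr.
rewrite -cardsT -(card_imset _ (f := fun w : 'M_(n, _) => (w *m K)^T)); last first.
  by move=> u v /trmx_inj /(row_free_inj (row_base_free _)).
apply: eq_card => x; rewrite inE; apply/eqP/imsetP => [Hx|[w _ ->]].
  have : (x^T <= K)%MS.
    by rewrite eq_row_base; apply/sub_kermxP; rewrite -trmx_mul Hx trmx0.
  by case/submxP => w Hw; exists w; rewrite ?inE // -Hw trmxK.
apply/trmx_inj; rewrite trmx_mul trmxK trmx0 -mulmxA.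
suff -> : K *m B^T = 0 by rewrite mulmx0.
by apply/sub_kermxP; rewrite eq_row_base.
Qed.

Lemma card_mulmx_eq_le (a b n : nat) (B : 'M[F]_(a, b)) (y : 'M_(a, n)) :
  (#|[set x : 'M_(b, n) | B *m x == y]| <= #|F| ^ (n * (b - \rank B)))%N.
Proof.
have [-> | [x0]] := set_0Vmem [set x : 'M_(b, n) | B *m x == y]; first by rewrite cards0.
rewrite inE => /eqP Hx0; rewrite -card_mulmx_eq0.
rewrite -(card_imset _ (addIr (- x0))); apply: subset_leq_card.
apply/subsetP => _ /imsetP[x Hx ->]; rewrite inE in Hx; rewrite inE.
by rewrite mulmxBr Hx0 (eqP Hx) subrr.
Qed.

(** Pull the colouring back along a linear map [phi] from F^n0 to F^n. If [phi] is injective and no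
    nonzero vector lands in [D], a monochromatic solution [y] in F^n0 becomes the solution
    [y *m phi]; as [y] is row free, each value of [y *m phi] comes from at most [N ^ (n0 - d)]
    maps. *)
Lemma supersaturation (r k d m : nat) (G : 'M[F]_(k, d)) (c : 'M[F]_(d, m)) :
    (forall j, exists i, lead1 (row j (G *m c)) i) ->
    injective (fun i => row i G) ->
  exists M n1 : nat, (0 < M)%N /\ forall n, (n1 <= n)%N ->
    forall (D : {set 'rV[F]_n}) (f : 'rV[F]_n -> 'I_r),
    (M * #|D| <= #|F| ^ n)%N ->
    (#|F| ^ (n * d) <= M * #|[set y : 'M[F]_(d, n) |
       [&& injectiveb (fun i => row i (G *m y)),
           [forall i, row i (G *m y) \notin D] &
           [exists a, forall i, f (row i (G *m y)) == a]]]|)%N.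
Proof.
move=> lead Ginj; have [n0 H0] := mono_solution r lead.
have rowN0 j : row j G != 0.
  apply/eqP => E; have [i [_]] := lead j.
  by rewrite row_mul E mul0mx mxE => /eqP; rewrite eq_sym oner_eq0.
pose Q := #|{: 'rV[F]_n0}|; pose M0 := #|{: 'M[F]_(d, n0)}|.
(* [4 * Q], in both places, makes at most half of the maps bad; [2 * M0] pays for this half and for
   the choice of [y]. *)
exists (4 * Q + 2 * M0)%N, (4 * Q)%N.
have Q0 : (0 < Q)%N by apply/card_gt0P; exists 0.
split; first by rewrite ltn_addr // muln_gt0.
move=> n hn D f hD; set N := (#|F| ^ n)%N.
set T := [set y | _].
have F1 : (1 < #|F|)%N by rewrite card_finNzRing_gt1.
have NQ : (4 * Q <= N)%N by rewrite (leq_trans hn) // ltnW // ltn_expl.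
pose bad := [set phi : 'M[F]_(n0, n) | [exists v : 'rV_n0, (v != 0) && (v *m phi \in 0 |: D)]].
pose good := ~: bad.
have fib (b : nat) (B : 'M[F]_(b, n0)) y : row_free B ->
    (#|[set x : 'M_(n0, n) | B *m x == y]| * N ^ b <= N ^ n0)%N.
  move=> fB; have bn : (b <= n0)%N by rewrite -(eqP fB) rank_leq_col.
  apply: leq_trans (leq_mul (card_mulmx_eq_le _ _) (leqnn _)) _.
  by rewrite (eqP fB) -!expnM -expnD -mulnDr subnK.
have rf1 (v : 'rV[F]_n0) : v != 0 -> row_free v by move=> v0; rewrite /row_free rank_rV v0.
have cbad : (#|bad| * (2 * N) <= N ^ n0 * N)%N.
  have sub : bad \subset \bigcup_(v : 'rV[F]_n0 | v != 0)
      \bigcup_(u in 0 |: D) [set phi | v *m phi == u].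
    apply/subsetP => phi; rewrite inE => /existsP[v /andP[v0 vD]].
    apply/bigcupP; exists v => //; apply/bigcupP; exists (v *m phi) => //.
    by rewrite inE.
  have B1 : (#|bad| * N <= Q * ((1 + #|D|) * N ^ n0))%N.
    apply: leq_trans (leq_mul (subset_leq_card sub) (leqnn _)) _.
    apply: leq_trans (leq_mul (leq_card_bigcup _ _) (leqnn _)) _.
    rewrite big_distrl /= -[Q]sum1_card big_distrl /= big_mkcond.
    apply: leq_sum => v _; case: ifP => // v0; rewrite mul1n.
    apply: leq_trans (leq_mul (leq_card_bigcup _ _) (leqnn _)) _.
    rewrite big_distrl /=; apply: leq_trans (_ : \sum_(u in 0%R |: D) N ^ n0 <= _)%N.
      by apply: leq_sum => u _; have := fib _ v u (rf1 v v0); rewrite expn1.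
    by rewrite sum_nat_const leq_mul2r cardsU1 leq_add2r leq_b1 orbT.
  have B2 : (4 * Q * #|D| <= N)%N.
    by apply: leq_trans hD; rewrite leq_mul2r leq_addr orbT.
  move: (N ^ n0)%N B1 => Z B1.
  have B3 : (Q * (1 + #|D|) * 2 <= N)%N by lia.
  apply: leq_trans (_ : Q * ((1 + #|D|) * Z) * 2 <= _)%N; first by lia.
  by have := leq_mul (leqnn Z) B3; lia.
have cgood : (N ^ n0 <= 2 * #|good|)%N.
  have := cardsC bad; rewrite card_mx (mulnC n0) expnM -/N => E.
  have N0 : (0 < N)%N by rewrite expn_gt0 (ltnW F1).
  rewrite -(leq_pmul2r N0); move: cbad; rewrite -E -/good mulnDl; lia.
pose Y0 := [set y : 'M[F]_(d, n0) | row_free y].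
have sub : good \subset \bigcup_(y in Y0) \bigcup_(z in T) [set phi | y *m phi == z].
  apply/subsetP => phi; rewrite !inE negb_exists => /forallP gphi.
  have {}gphi v : v != 0 -> v *m phi != 0 /\ v *m phi \notin D.
    by move=> v0; have := gphi v; rewrite v0 !inE /= negb_or => /andP[].
  have [y [fy [a Ha]]] := H0 (fun v => f (v *m phi)).
  apply/bigcupP; exists y; first by rewrite inE.
  apply/bigcupP; exists (y *m phi); last by rewrite inE.
  have yN0 (v : 'rV_d) : v != 0 -> v *m y != 0.
    by apply: contra => /eqP E; apply/eqP/(row_free_inj fy); rewrite mul0mx.
  have E i : row i (G *m (y *m phi)) = row i G *m y *m phi by rewrite row_mul mulmxA.
  rewrite inE; apply/and3P; split.
  - apply/injectiveP => i j /eqP; rewrite !E -subr_eq0 -!mulmxBl => /eqP H.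
    apply: Ginj; apply/eqP; rewrite -subr_eq0; apply/negPn/negP => /yN0 /gphi [].
    by rewrite H eqxx.
  - by apply/forallP => i; rewrite E; have [] := gphi _ (yN0 _ (rowN0 i)).
  - by apply/existsP; exists a; apply/forallP => i; rewrite -(Ha i) E row_mul.
have B4 : (#|good| * N ^ d <= M0 * (#|T| * N ^ n0))%N.
  apply: leq_trans (leq_mul (subset_leq_card sub) (leqnn _)) _.
  apply: leq_trans (leq_mul (leq_card_bigcup _ _) (leqnn _)) _.
  rewrite big_distrl /= -[M0]sum1_card big_distrl /= big_mkcond /=.
  apply: leq_sum => y _; case: ifP => //; rewrite inE => fy; rewrite mul1n.
  apply: leq_trans (leq_mul (leq_card_bigcup _ _) (leqnn _)) _.
  rewrite big_distrl /= -sum_nat_const; apply: leq_sum => z _; exact: fib.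
rewrite expnM -/N.
have Z0 : (0 < N ^ n0)%N by rewrite !expn_gt0 (ltnW F1).
rewrite -(leq_pmul2r Z0); move: (N ^ n0)%N Z0 cgood B4 => Z Z0 cgood B4.
have : (N ^ d * Z <= N ^ d * (2 * #|good|))%N by rewrite leq_mul2l cgood orbT.
move: (N ^ d)%N B4 => Nd; nia.
Qed.

End Ramsey.

(** * Hypergraph containers *)

Lemma ler_sum_sub (R : numDomainType) (I : finType) (P Q : pred I) (F : I -> R) :
  (forall i, P i -> Q i) -> (forall i, Q i -> 0 <= F i) ->
  \sum_(i | P i) F i <= \sum_(i | Q i) F i.
Proof.
move=> PQ F0; rewrite big_mkcond [leRHS]big_mkcond; apply: ler_sum => i _.
by have [/PQ -> //|_] := boolP (P i); case: ifP => // /F0.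
Qed.

(** * Linear inequalities for the container argument *)

Section Arith.
Variable R : realFieldType.
Implicit Types a b c x y z E K N D dl p q : R.

Lemma quarter_loss E a b c x : E <= a -> a - b - c <= x -> c <= E / 4 -> b <= E / 4 -> E / 2 <= x.
Proof. lra. Qed.

Lemma subtract_losses a b x y z : x <= y -> a <= x + b + z -> a - y - z <= b.
Proof. lra. Qed.

Lemma quarter_scale p E : 4^-1 * (p * E) <= p * (E / 4).
Proof. lra. Qed.

Lemma dense_from_average E K N D dl : 0 < E -> 0 < N -> dl <= 4^-1 ->
  E / 2 <= K * (E / N) * D + dl * E -> N <= 4 * K * D.
Proof.
move=> E0 N0 dl4 h.
have h1 : dl * E <= 4^-1 * E by rewrite ler_wpM2r // ltW.
have h2 : 4^-1 * E <= K * (E / N) * D by lra.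
have h3 : E * N * 4^-1 <= E * (K * D).
  have -> : E * (K * D) = N * (K * (E / N) * D) by field; rewrite lt0r_neq0.
  have -> : E * N * 4^-1 = N * (4^-1 * E) by ring.
  by rewrite ler_pM2l.
have : N * 4^-1 <= K * D by rewrite -(ler_pM2l E0) mulrA.
lra.
Qed.

End Arith.

Section WeightedHypergraphs.
Variables (R : realType) (V : finType).
Implicit Types (w h G : {set V} -> R) (e f T S I C D : {set V}) (u v : V).

Definition total w : R := \sum_e w e.
Definition deg w T : R := \sum_(e : {set V} | T \subset e) w e.
Definition independent w I : Prop := forall e : {set V}, e \subset I -> w e = 0.
Definition restrict C w e : R := if e \subset C then w e else 0.

Definition unsaturated (thr : nat -> R) G e : bool :=
  [forall T : {set V}, (T != set0) && (T \subset e) ==> (deg G T < thr #|T|)].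

Definition alive (thr : nat -> R) w G S e : R :=
  if [disjoint e & S] && unsaturated thr G e then w e else 0.

Definition link h v f : R := if v \in f then 0 else h (v |: f).

Definition pickmax (h : V -> R) I : option V :=
  [pick v in I | [forall u in I, h u <= h v]].

(** The state is the fingerprint chosen so far with a weighted hypergraph of edges one vertex
    smaller. The vertex of [I] of largest degree among the alive edges joins the fingerprint, and
    its link joins the hypergraph. As [I] is independent, it is independent in all these links. *)
Definition container_step (thr : nat -> R) w I (st : {set V} * ({set V} -> R)) :=
  let h := alive thr w st.2 st.1 in
  if pickmax (fun v => deg h [set v]) I is Some v
  then (v |: st.1, fun f => st.2 f + link h v f) else st.

Definition container_round (thr : nat -> R) w I b : {set V} * ({set V} -> R) :=
  iter b (container_step thr w I) (set0, fun=> 0).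

Lemma pickmaxP (h : V -> R) I v : pickmax h I = Some v ->
  v \in I /\ forall u, u \in I -> h u <= h v.
Proof.
rewrite /pickmax; case: pickP => // x /andP[xI /forallP H] [<-]; split=> // u uI.
by have /implyP := H u; apply.
Qed.

Lemma pickmax_none (h : V -> R) I : pickmax h I = None -> I = set0.
Proof.
have [//|[v0 v0I]] := set_0Vmem I; rewrite /pickmax; case: pickP => // H _.
case: (arg_maxP h v0I) => v vI vmax; have := H v; rewrite /= (vI : v \in I) /= => /forallP[].
by move=> u; apply/implyP => uI; apply: vmax.
Qed.

(** Ties are broken by the enumeration of [V], not by [I]. This is what makes a container
    recoverable from its fingerprint. *)
Lemma pickmax_sub (h : V -> R) I I' v : pickmax h I = Some v ->
  v \in I' -> I' \subset I -> pickmax h I' = Some v.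
Proof.
move=> pI vI' sI; have [vI vmax] := pickmaxP pI.
have E : enum [pred x | (x \in I') && [forall u in I', h u <= h x]] =
         [seq x <- enum [pred x | (x \in I) && [forall u in I, h u <= h x]] | x \in I'].
  rewrite /enum_mem -filter_predI; apply: eq_filter => x; rewrite !inE /=.
  have [xI' /=|//] := boolP (x \in I'); rewrite (subsetP sI) //=.
  apply/forallP/forallP => H u; apply/implyP => uI.
    have /implyP/(_ vI') := H v; apply: le_trans; exact: vmax.
  by have /implyP := H u; apply; apply: (subsetP sI).
move: pI; rewrite /pickmax /pick; rewrite /=.
rewrite -[enum (fun x => (x \in I') && _)]/(enum [pred x | (x \in I') && [forall u in I', h u <= h x]]) E.
rewrite -[enum (fun x => (x \in I) && _)]/(enum [pred x | (x \in I) && [forall u in I, h u <= h x]]).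
by case: (enum _) => //= x s [->]; rewrite vI'.
Qed.

Lemma container_round_subset thr w I b : (container_round thr w I b).1 \subset I.
Proof.
elim: b => [|b IH]; first exact: sub0set.
rewrite /container_round iterS -/(container_round _ _ _ _) /container_step.
case E: pickmax => [v|//]; have [vI _] := pickmaxP E.
by rewrite subUset sub1set vI.
Qed.

Lemma container_round_stable thr w I b I' :
  (container_round thr w I b).1 \subset I' -> I' \subset I ->
  container_round thr w I' b = container_round thr w I b.
Proof.
elim: b => [//|b IH]; rewrite /container_round !iterS -!/(container_round _ _ _ _).
rewrite {1}/container_step; case E: pickmax => [v|] /=.
  rewrite subUset sub1set => /andP[vI' sI'] sI.
  by rewrite IH // {1}/container_step (pickmax_sub E) // /container_step E.
move=> sI' sI; rewrite IH // /container_step E.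
case E': pickmax => [v|//]; have [/(subsetP sI)] := pickmaxP E'.
by rewrite (pickmax_none E) inE.
Qed.

Lemma container_round_card thr w I b : (#|(container_round thr w I b).1| <= b)%N.
Proof.
elim: b => [|b IH]; first by rewrite cards0.
rewrite /container_round iterS -/(container_round _ _ _ _) /container_step.
case: pickmax => [v|] /=; last exact: leqW.
by rewrite cardsU1; case: (v \notin _) => /=; [rewrite add1n ltnS|rewrite add0n leqW].
Qed.

Lemma deg_ge0 w T : (forall e, 0 <= w e) -> 0 <= deg w T.
Proof. by move=> w0; apply: sumr_ge0. Qed.

Lemma total_ge0 w : (forall e, 0 <= w e) -> 0 <= total w.
Proof. by move=> w0; apply: sumr_ge0. Qed.

Lemma deg_le w w' T : (forall e, w e <= w' e) -> deg w T <= deg w' T.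
Proof. by move=> ww'; apply: ler_sum. Qed.

Lemma sum_deg w : \sum_T deg w T = \sum_e w e * (2 ^ #|e|)%:R.
Proof.
rewrite /deg (exchange_big_dep xpredT) //=; apply: eq_bigr => e _.
rewrite sumr_const mulr_natr -card_powerset; congr (_ *+ _).
by apply: eq_card => T; rewrite !inE.
Qed.

Lemma sum_link h v T : \sum_(f : {set V} | T \subset f) link h v f =
  if v \in T then 0 else deg h (v |: T).
Proof.
rewrite /link; case: ifP => vT.
  by rewrite big1 // => f /subsetP/(_ _ vT) ->.
rewrite (bigID (fun f => v \in f)) /= big1 ?add0r; last by move=> f /andP[_ ->].
rewrite /deg [RHS](reindex_onto (fun f => v |: f) (fun e => e :\ v)); last first.
  by move=> e /subsetP/(_ v); rewrite setU11 => /(_ isT) ve; rewrite setD1K.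
apply: eq_big => [f|f /andP[_ /negbTE -> //]].
rewrite /= subUset sub1set setU11 /=; have [vf|vf] := boolP (v \in f).
  rewrite andbF; apply/esym/negbTE; rewrite negb_and; apply/orP; right.
  by apply/negP => /eqP/setP/(_ v); rewrite !inE eqxx vf.
rewrite setU1K // eqxx !andbT; apply/idP/idP => [|/subsetP H]; first by move/subset_trans; apply; apply: subsetUr.
apply/subsetP => x xT; have := H x xT; rewrite !inE => /orP[/eqP E|//].
by rewrite E in xT; rewrite xT in vT.
Qed.

Lemma unsaturated_mono thr G G' e : (forall f, G f <= G' f) ->
  unsaturated thr G' e -> unsaturated thr G e.
Proof.
move=> GG' /forallP H; apply/forallP => T; apply/implyP => HT.
by have /implyP/(_ HT) := H T; apply: le_lt_trans; apply: deg_le.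
Qed.

(** * One round of the container algorithm *)

Section Round.
Variables (j b : nat) (w : {set V} -> R) (E K p : R) (I : {set V}).
Let N : R := #|V|%:R.
Let thr t : R := K * p ^+ t * E / N.
Hypotheses (V0 : (0 < #|V|)%N) (E0 : 0 < E) (K0 : 0 < K) (p01 : 0 < p <= 1) (pb : p * N <= b%:R).
Hypotheses (w0 : forall e, 0 <= w e) (wsupp : forall e, w e != 0 -> #|e| = j.+1).
Hypothesis wdeg : forall T, T != set0 -> deg w T <= K * p ^+ #|T|.-1 * E / N.
Hypothesis Iind : independent w I.

Let N0 : 0 < N. Proof. by rewrite ltr0n. Qed.
Let p0 : 0 < p. Proof. by case/andP: p01. Qed.
Let thr0 t : 0 < thr t. Proof. by rewrite /thr divr_gt0 // !mulr_gt0 // exprn_gt0. Qed.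

Let st m := container_round thr w I m.
Let S m := (st m).1.
Let G m := (st m).2.
Let H m := alive thr w (G m) (S m).

Lemma alive_ge0 G' S' e : 0 <= alive thr w G' S' e.
Proof. by rewrite /alive; case: ifP. Qed.

Lemma alive_le G' S' e : alive thr w G' S' e <= w e.
Proof. by rewrite /alive; case: ifP. Qed.

Lemma link_ge0 h v f : (forall e, 0 <= h e) -> 0 <= link h v f.
Proof. by rewrite /link => h0; case: ifP. Qed.

Lemma roundS m : st m.+1 = container_step thr w I (st m).
Proof. by []. Qed.

Lemma round_G_ge0 m f : 0 <= G m f.
Proof.
rewrite /G; elim: m f => [|m IH] f; first exact: lexx.
rewrite roundS /container_step; case: pickmax => //= v.
by rewrite addr_ge0 // link_ge0 // => e; apply: alive_ge0.
Qed.

Lemma round_G_mono m f : G m f <= G m.+1 f.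
Proof.
rewrite /G roundS /container_step; case: pickmax => //= v.
by rewrite lerDl link_ge0 // => e; apply: alive_ge0.
Qed.

Lemma round_S_mono m : S m \subset S m.+1.
Proof. by rewrite /S roundS /container_step; case: pickmax => //= v; apply: subsetUr. Qed.

Lemma round_G_supp m f : G m f != 0 -> exists v, [/\ v \in I, v \notin f & w (v |: f) != 0].
Proof.
rewrite /G; elim: m => [|m IH]; first by rewrite eqxx.
rewrite roundS /container_step; case P: pickmax => [v|] //=.
have [->|/IH //] := eqVneq ((st m).2 f) 0; rewrite add0r /link.
case: ifP => vf; first by rewrite eqxx.
rewrite /alive; case: ifP => _; last by rewrite eqxx.
by exists v; have [vI _] := pickmaxP P; rewrite vI vf.
Qed.

(** A link is added over [T] only while [T] is below its cap, since edges containing a saturated set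
    are not alive; one link adds at most [deg w (v |: T)], which is another cap. *)
Lemma round_G_deg m T : T != set0 -> deg (G m) T <= 2 * thr #|T|.
Proof.
move=> T0; rewrite /G; elim: m => [|m IH].
  by rewrite /deg big1 // mulr_ge0 // ltW.
rewrite roundS /container_step; case P: pickmax => [v|] //=.
rewrite /deg big_split /= sum_link -/(deg _ _).
case: ifP => vT; first by rewrite addr0.
have [sat|unsat] := leP (thr #|T|) (deg (st m).2 T); last first.
  rewrite mulr_natl mulr2n lerD // ?(ltW unsat) //.
  apply: le_trans (deg_le _ (alive_le _ _)) _; apply: le_trans (wdeg _) _.
    by apply/set0Pn; exists v; rewrite setU11.
  by rewrite cardsU1 vT.
rewrite [X in _ + X](_ : _ = 0) ?addr0 //; apply: big1 => e; rewrite subUset sub1set => /andP[_ Te].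
rewrite /alive; case: ifP => // /andP[_ /forallP/(_ T)]; rewrite T0 Te /=.
by rewrite ltNge sat.
Qed.

Lemma total_link h v : total (link h v) = deg h [set v].
Proof.
have := sum_link h v set0; rewrite inE setU0 => <-.
by apply: eq_bigl => f; rewrite sub0set.
Qed.

(** An edge still unsaturated was alive when the fingerprint first hit it, and its weight entered
    [G] with that link. *)
Lemma round_hit_le m :
  \sum_(e : {set V} | ~~ [disjoint e & S m] && unsaturated thr (G m) e) w e <= total (G m).
Proof.
elim: m => [|m IH].
  apply: le_trans (_ : 0 <= _); last by apply: total_ge0; exact: round_G_ge0.
  by rewrite big1 // => e; rewrite /S /= disjoint_sym disjoints_subset sub0set.
rewrite {1}/S {1 2}/G roundS /container_step; case P: pickmax => [v|] //=.
rewrite /total big_split /= -!/(total _) total_link -/(G m) -/(S m) -/(H m).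
apply: le_trans (lerD IH (lexx _)).
rewrite (bigID (fun e => ~~ [disjoint e & S m])) /=; apply: lerD.
  apply: ler_sum_sub => // e /andP[/andP[_ un] ->] /=.
  by apply: unsaturated_mono un => f; rewrite lerDl link_ge0 // => e'; apply: alive_ge0.
rewrite /deg /H big_mkcond [leRHS]big_mkcond /=; apply: ler_sum => e _.
rewrite /alive negbK sub1set; have [vS|vS] := boolP (v \in e) => /=.
  have [dj|_] /= := boolP [disjoint e & S m]; last by rewrite andbF.
  rewrite andbT; case: ifP => [/andP[_ un]|_]; last by case: ifP.
  suff -> : unsaturated thr (G m) e by [].
  by apply: unsaturated_mono un => f; rewrite lerDl link_ge0 // => e'; apply: alive_ge0.
case: ifP => // /andP[/andP[ndj _] dj]; move: ndj; rewrite disjoint_sym.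
case/negP; rewrite disjoints_subset subUset sub1set inE vS /=.
by rewrite -disjoints_subset disjoint_sym.
Qed.

(** Alive degrees only decrease, so each of the [m] chosen vertices contributed at least the present
    alive degree of [u]. *)
Lemma round_maxdeg_le m u : u \in I -> m%:R * deg (H m) [set u] <= total (G m).
Proof.
move=> uI; elim: m => [|m IH].
  by rewrite mul0r total_ge0 // => e; exact: round_G_ge0.
have Hle e : H m.+1 e <= H m e.
  rewrite /H /alive; case: ifP => [/andP[dj un]|_]; last by case: ifP.
  rewrite (unsaturated_mono (round_G_mono m) un) andbT.
  suff -> : [disjoint e & S m] by [].
  by apply: disjointWr dj; apply: round_S_mono.
have Hdeg := deg_le [set u] Hle.
rewrite /G roundS /container_step; case P: pickmax => [v|] //=; last first.
  by have := pickmax_none P => I0; rewrite I0 inE in uI.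
rewrite /total big_split /= -!/(total _) total_link -/(G m) -/(S m) -/(H m).
have [_ vmax] := pickmaxP P.
rewrite -natr1 mulrDl mul1r; apply: lerD.
  by apply: le_trans IH; apply: ler_wpM2l.
by apply: le_trans Hdeg _; apply: vmax.
Qed.

(** Charge a saturated edge to a saturated subset [T]: there
    [p * deg w T <= thr #|T| <= deg (G m) T]. Each edge of [G m] has [2 ^ j] subsets. *)
Lemma round_saturated_le m :
  p * (\sum_(e | ~~ unsaturated thr (G m) e) w e) <= (2 ^ j)%:R * total (G m).
Proof.
have sub : \sum_(e | ~~ unsaturated thr (G m) e) w e <=
    \sum_(T : {set V} | (T != set0) && (thr #|T| <= deg (G m) T)) deg w T.
  rewrite /deg (exchange_big_dep xpredT) //= big_mkcond /=; apply: ler_sum => e _.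
  case: ifP => [|_]; last exact: sumr_ge0.
  rewrite negb_forall => /existsP[T]; rewrite negb_imply -leNgt => /andP[/andP[T0 Te] sat].
  rewrite (bigD1 T) /=; last by rewrite T0 sat Te.
  by rewrite lerDl sumr_ge0.
apply: le_trans (ler_wpM2l (ltW p0) sub) _; rewrite mulr_sumr.
apply: le_trans (_ : \sum_T deg (G m) T <= _).
  rewrite big_mkcond; apply: ler_sum => T _; case: ifP => [/andP[T0 sat]|_]; last first.
    by apply: deg_ge0; apply: round_G_ge0.
  apply: le_trans sat; apply: le_trans (ler_wpM2l (ltW p0) (wdeg T0)) _.
  have tE : p ^+ #|T| = p * p ^+ #|T|.-1 by rewrite -exprS prednK ?card_gt0.
  rewrite /thr tE.
  by rewrite le_eqVlt; apply/orP; left; apply/eqP; ring.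
rewrite sum_deg mulr_sumr; apply: ler_sum => f _; rewrite mulrC.
have [->|/round_G_supp[v [_ vf]]] := eqVneq (G m f) 0; first by rewrite !mulr0.
by move/wsupp; rewrite cardsU1 vf add1n => -[->].
Qed.

Lemma total_alive_ge m : total w - total (G m) -
   \sum_(e | ~~ unsaturated thr (G m) e) w e <= total (H m).
Proof.
have := round_hit_le m.
pose X := \sum_(e : {set V} | ~~ [disjoint e & S m] && unsaturated thr (G m) e) w e.
pose Z := \sum_(e | ~~ unsaturated thr (G m) e) w e; rewrite -/X -/Z => hX.
apply: (subtract_losses hX).
rewrite /total (bigID (unsaturated thr (G m))) /= lerD //.
rewrite (bigID (fun e : {set V} => ~~ [disjoint e & S m])) /= lerD //.
  by apply: ler_sum_sub => // e /andP[-> ->].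
rewrite big_mkcond; apply: ler_sum => e _; rewrite /H /alive negbK andbC.
by case: ifP => // _; case: ifP.
Qed.

(** If [G] stays light, the edges hit and the edges saturated each cost at most [E / 4], because
    [2 ^ j * dl = 1 / 4]. Half of [E] remains alive, which forces many vertices of large alive
    degree, while by [round_maxdeg_le] with [b >= p * N] no vertex of [I] has such a degree. *)
Lemma round_dense : E <= total w ->
  let dl := (2 ^ (j + 2))%:R^-1 in
  total (G b) < dl * p * E ->
  let D := [set v | dl * E / N <= deg (H b) [set v]] in
  [/\ [disjoint I & D], N <= 4 * K * #|D|%:R &
      forall v, v \in D -> exists e, v \in e /\ w e != 0].
Proof.
move=> Ew dl; set g := total (G b) => gl D.
have dl0 : 0 < dl by rewrite invr_gt0 ltr0n expn_gt0.
have dl4 : dl <= 4^-1.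
  rewrite lef_pV2 ?posrE ?ltr0n ?expn_gt0 // ler_nat expnD.
  by rewrite leq_pmull // expn_gt0.
split.
- rewrite disjoint_sym disjoints_subset; apply/subsetP => v; rewrite !inE => vD.
  apply/negP => vI; have := round_maxdeg_le b vI; rewrite -/g.
  apply/negP; rewrite -ltNge; apply: lt_le_trans gl _.
  apply: le_trans (_ : (p * N) * (dl * E / N) <= _).
    by rewrite le_eqVlt; apply/orP; left; apply/eqP; field; rewrite lt0r_neq0.
  have h0 : 0 <= dl * E / N by rewrite !mulr_ge0 ?invr_ge0 // ?ltW.
  apply: le_trans (ler_wpM2r h0 pb) _; exact: ler_wpM2l.
- have half : E / 2 <= total (H b).
    have h1 := total_alive_ge b; have h2 := round_saturated_le b.
    move: h1 h2; pose Z := \sum_(e | ~~ unsaturated thr (G b) e) w e; rewrite -/g -/Z => h1 h2.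
    have g0 : 0 <= g by apply: total_ge0; exact: round_G_ge0.
    have dlE : dl * (2 ^ j)%:R = 4^-1.
      rewrite /dl expnD natrM invfM mulrAC mulVf ?mul1r //.
      by rewrite pnatr_eq0 expn_eq0.
    have hZ : Z <= E / 4.
      rewrite -(ler_pM2l p0); apply: le_trans h2 _.
      apply: le_trans (ler_wpM2l (ler0n _ _) (ltW gl)) _.
      have -> : (2 ^ j)%:R * (dl * p * E) = dl * (2 ^ j)%:R * (p * E) by ring.
      by rewrite dlE; exact: quarter_scale.
    have hg : g <= E / 4.
      apply: le_trans (ltW gl) _; rewrite -mulrA mulrC; apply: ler_pM => //.
      - by rewrite mulr_ge0 // ltW.
      - by rewrite ltW.
      by rewrite ger_pMl //; case/andP: p01.
    exact: (quarter_loss Ew h1 hZ hg).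
  have : total (H b) <= \sum_v deg (H b) [set v].
    rewrite /deg (exchange_big_dep xpredT) //=; apply: ler_sum => e _.
    have [->|He] := eqVneq (H b e) 0; first exact: sumr_ge0.
    have /card_gt0P[v ve] : (0 < #|e|)%N.
      rewrite (wsupp (e := e)) //; apply: contraNneq He => we.
      by rewrite /H /alive we; case: ifP.
    rewrite (bigD1 v) ?sub1set //= lerDl sumr_ge0 // => i _; exact: alive_ge0.
  have bound : \sum_v deg (H b) [set v] <= \sum_(v in D) (K * E / N) + \sum_(v : V) dl * E / N.
    rewrite [X in X + _]big_mkcond -big_split; apply: ler_sum => v _ /=.
    case: ifP => vD.
      apply: le_trans (_ : K * E / N <= _); last by rewrite lerDl !mulr_ge0 ?invr_ge0 // ?ltW.
      apply: le_trans (deg_le _ (alive_le _ _)) _; apply: le_trans (wdeg _) _.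
        by apply/set0Pn; exists v; rewrite inE.
      by rewrite cards1 mulr1.
    by rewrite add0r ltW // ltNge; move: vD; rewrite inE => ->.
  move=> h3; move: (le_trans half (le_trans h3 bound)).
  rewrite !sumr_const -(mulr_natr (K * E / N)) -(mulr_natr (dl * E / N)) -/N.
  move=> h4; apply: (dense_from_average E0 N0 dl4); apply: le_trans h4 _.
  by rewrite (divfK (lt0r_neq0 N0)) -!mulrA.
- move=> v; rewrite inE => vD.
  have : 0 < deg (H b) [set v].
    by apply: lt_le_trans vD; rewrite divr_gt0 // mulr_gt0.
  move=> /lt0r_neq0 /eqP nz.
  have /existsP[e /andP[ve we]] : [exists e : {set V}, (v \in e) && (w e != 0)].
    case: (boolP [exists _, _]) => // /existsPn H0; case: nz.
    apply: big1 => e; rewrite sub1set => ve; have := H0 e; rewrite ve negbK /= => /eqP we.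
    by rewrite /H /alive we; case: ifP.
  by exists e.
Qed.

Lemma round_independent : independent (G b) I.
Proof.
move=> f fI; apply/eqP/negPn/negP => /round_G_supp[v [vI vf]].
by rewrite Iind ?eqxx // subUset sub1set vI.
Qed.

Lemma round_supp f : G b f != 0 -> #|f| = j.
Proof. by move=> /round_G_supp[v [_ vf /wsupp]]; rewrite cardsU1 vf add1n => -[]. Qed.

End Round.

(* Edges of [w] have [j.+1] elements; the second component is a set of
   vertices outside [I] which depends on the fingerprint only. *)
Fixpoint fingerprint (b : nat) (p : R) (j : nat) (K E : R) w I : {set V} * {set V} :=
  if j is j'.+1 then
    let thr t := K * p ^+ t * E / #|V|%:R in
    let st := container_round thr w I b in
    let dl := (2 ^ (j + 2))%:R^-1 in
    if total st.2 < dl * p * E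
    then (st.1, [set v | dl * E / #|V|%:R <= deg (alive thr w st.2 st.1) [set v]])
    else let r := fingerprint b p j' (2 * K / dl) (dl * p * E) st.2 I in
         (st.1 :|: r.1, r.2)
  else (set0, [set v | w [set v] != 0]).

(** Inverse density of the set excluded by [fingerprint]. Passing to the link hypergraph doubles the
    caps and lowers the guaranteed total from [E] to [dl * p * E], hence the new constant
    [2 * K / dl]. *)
Fixpoint density_loss (j : nat) (K : R) : R :=
  if j is j'.+1 then
    Num.max (4 * K) (density_loss j' (2 * K / (2 ^ (j + 2))%:R^-1))
  else K.

Lemma density_loss_gt0 j K : 0 < K -> 0 < density_loss j K.
Proof.
by case: j => [//|j] K0 /=; rewrite lt_max mulr_gt0 ?orTb // ltr0n.
Qed.

Lemma fingerprint_stable b p j K E w I I' :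
  (fingerprint b p j K E w I).1 \subset I' -> I' \subset I ->
  fingerprint b p j K E w I' = fingerprint b p j K E w I.
Proof.
elim: j K E w => [//|j IH] K E w /=.
set thr := fun t => _; set st := container_round thr w I b.
have E1 : st.1 \subset I' -> I' \subset I -> container_round thr w I' b = st.
  exact: container_round_stable.
case: ifP => lt /=.
  by move=> sI' sI; rewrite E1 // lt.
rewrite subUset => /andP[sI' rI'] sI; rewrite E1 // lt IH //.
Qed.

(** A light link hypergraph gives a dense excluded set by [round_dense]; a heavy one satisfies the
    same hypotheses with smaller edges. At edge size one, the vertices of positive weight are
    excluded from [I] outright. *)
Lemma fingerprint_spec b p j K E w I :
  (0 < #|V|)%N -> 0 < E -> 0 < K -> 0 < p <= 1 -> p * #|V|%:R <= b%:R ->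
  (forall e, 0 <= w e) -> (forall e, w e != 0 -> #|e| = j.+1) ->
  (forall T, T != set0 -> deg w T <= K * p ^+ #|T|.-1 * E / #|V|%:R) ->
  E <= total w -> independent w I ->
  let r := fingerprint b p j K E w I in
  [/\ r.1 \subset I, (#|r.1| <= j * b)%N, [disjoint I & r.2],
      #|V|%:R <= density_loss j K * #|r.2|%:R &
      forall v, v \in r.2 -> exists e, v \in e /\ w e != 0].
Proof.
move=> V0; elim: j K E w => [|j IH] K E w E0 K0 p01 pb w0 wsupp wdeg Ew ind /=.
  have N0 : 0 < #|V|%:R :> R by rewrite ltr0n.
  split; rewrite ?sub0set ?cards0 //.
  - rewrite disjoint_sym disjoints_subset; apply/subsetP => v; rewrite !inE.
    by apply: contra => vI; rewrite ind ?sub1set.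
  - set D := [set v | _].
    have h : total w <= \sum_(v in D) K * E / #|V|%:R.
      apply: le_trans (_ : \sum_(v in D) w [set v] <= _).
        rewrite /total (bigID (fun e => e \in [set [set v] | v in D])) /=.
        rewrite big_imset /=; last by move=> ? ? _ _; apply: set1_inj.
        rewrite [X in _ + X]big1 ?addr0 // => e; apply: contraNeq => we.
        have /eqP/cards1P[v ev] := wsupp _ we.
        by apply/imsetP; exists v; rewrite // inE -ev.
      apply: ler_sum => v _; apply: le_trans (_ : deg w [set v] <= _).
        by rewrite /deg (bigD1 [set v]) //= lerDl sumr_ge0.
      apply: le_trans (wdeg _ _) _; first by apply/set0Pn; exists v; rewrite inE.
      by rewrite cards1 mulr1.
    move: (le_trans Ew h); rewrite sumr_const -(mulr_natr (K * E / _)) => h2.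
    rewrite -(ler_pM2l E0); apply: le_trans (ler_wpM2r (ltW N0) h2) _.
    by rewrite le_eqVlt; apply/orP; left; apply/eqP; field; rewrite lt0r_neq0.
  - by move=> v; rewrite inE => wv; exists [set v]; rewrite set11.
set thr := fun t => _; set st := container_round thr w I b.
set dl := (2 ^ _)%:R^-1.
have dl0 : 0 < dl by rewrite invr_gt0 ltr0n expn_gt0.
have p0 : 0 < p by case/andP: p01.
have stI : st.1 \subset I by exact: container_round_subset.
have stb : (#|st.1| <= b)%N by exact: container_round_card.
case: ifP => lt.
  have [h1 h2 h3] := round_dense V0 E0 p01 pb w0 wsupp wdeg Ew lt.
  split=> //; first by rewrite mulSn (leq_trans stb) // leq_addr.
  apply: le_trans h2 _; apply: ler_wpM2r => //; by rewrite le_max lexx.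
have le := lt; move/negbT: le; rewrite -leNgt => le.
have [|||||||||h1 h2 h3 h4 h5] := IH (2 * K / dl) (dl * p * E) st.2.
- by rewrite !mulr_gt0.
- by rewrite divr_gt0 // mulr_gt0.
- by [].
- by [].
- by move=> e; apply: round_G_ge0.
- by move=> e; apply: (round_supp wsupp).
- move=> T T0; apply: le_trans (round_G_deg _ V0 E0 K0 p01 w0 wdeg _ T0) _.
  have tE : p ^+ #|T| = p * p ^+ #|T|.-1 by rewrite -exprS prednK ?card_gt0.
  rewrite /thr tE le_eqVlt; apply/orP; left; apply/eqP.
  have N0 : 0 < #|V|%:R :> R by rewrite ltr0n.
  move: (#|V|%:R) (dl) N0 dl0 => n d0 N0 d00.
  by field; rewrite (lt0r_neq0 N0) (lt0r_neq0 d00).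
- exact: le.
- exact: round_independent.
split=> /=.
- by rewrite subUset stI.
- by rewrite mulSn (leq_trans (leq_card_setU _ _)) // leq_add.
- by [].
- apply: le_trans h4 _; apply: ler_wpM2r => //; by rewrite le_max lexx orbT.
- move=> v /h5[f [vf Gf]]; have [u [_ _ wu]] := round_G_supp Gf.
  by exists (u |: f); rewrite inE vf orbT.
Qed.

Fixpoint container (b : nat) (p : R) (j : nat) (K E eps : R) w (fuel : nat) C I :
    {set V} * {set V} :=
  if total (restrict C w) < eps * E then (set0, C) else
  if fuel is fuel'.+1 then
    let r := fingerprint b p j (K / eps) (eps * E) (restrict C w) I in
    let s := container b p j K E eps w fuel' (C :\: r.2) I in
    (r.1 :|: s.1, s.2)
  else (set0, C).

Lemma container_stable b p j K E eps w fuel C I I' :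
  (container b p j K E eps w fuel C I).1 \subset I' -> I' \subset I ->
  container b p j K E eps w fuel C I' = container b p j K E eps w fuel C I.
Proof.
elim: fuel C => [|fuel IH] C /=; first by case: ifP.
case: ifP => // _ /=; rewrite subUset => /andP[h1 h2] sI.
by rewrite (fingerprint_stable h1 sI) IH.
Qed.

(** While the weight inside [C] is at least [eps * E], a round removes at least
    [#|V| / density_loss] vertices of [C], so a bounded [fuel] suffices. The degree condition is
    kept relative to [eps * E] by taking [K / eps]. *)
Lemma container_spec b p j K E eps w fuel C I :
  (0 < #|V|)%N -> 0 < E -> 0 < K -> 0 < eps -> 0 < p <= 1 -> p * #|V|%:R <= b%:R ->
  (forall e, 0 <= w e) -> (forall e, w e != 0 -> #|e| = j.+1) ->
  (forall T, T != set0 -> deg w T <= K * p ^+ #|T|.-1 * E / #|V|%:R) ->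
  independent w I -> I \subset C ->
  #|C|%:R * density_loss j (K / eps) <= fuel%:R * #|V|%:R ->
  let r := container b p j K E eps w fuel C I in
  [/\ r.1 \subset I, (#|r.1| <= fuel * (j * b))%N, I \subset r.2 &
      total (restrict r.2 w) < eps * E].
Proof.
move=> V0 E0 K0 eps0 p01 pb w0 wsupp wdeg ind.
have rest0 C' e : 0 <= restrict C' w e by rewrite /restrict; case: ifP.
have Ke0 : 0 < K / eps by rewrite divr_gt0.
elim: fuel C => [|fuel IH] C IC hC /=.
  have C0 : C = set0.
    apply/eqP; rewrite -cards_eq0 -leqn0 -(ler_nat R).
    by rewrite -(pmulr_lle0 _ (density_loss_gt0 j Ke0)); move: hC; rewrite mul0r.
  move: IC; rewrite C0 => IC; have Z : total (restrict set0 w) = 0.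
    apply: big1 => e _; rewrite /restrict subset0; case: eqP => // ->.
    by apply/eqP/negPn/negP => /wsupp; rewrite cards0.
  by rewrite Z mulr_gt0 //=; split; rewrite ?sub0set ?cards0 ?Z ?mulr_gt0.
case: ifP => lt /=; first by rewrite sub0set cards0.
move/negbT: lt; rewrite -leNgt => le.
have [|||||h1 h2 h3 h4 h5] := @fingerprint_spec b p j (K / eps) (eps * E) (restrict C w) I V0 _ Ke0 p01 pb (rest0 C).
- by rewrite mulr_gt0.
- move=> e; rewrite /restrict; case: ifP => _; last by rewrite eqxx.
  exact: wsupp.
- move=> T T0; apply: le_trans (deg_le (w' := w) _ _) _.
    by move=> e; rewrite /restrict; case: ifP.
  have -> : K / eps * p ^+ #|T|.-1 * (eps * E) / #|V|%:R = K * p ^+ #|T|.-1 * E / #|V|%:R.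
    have N0 : 0 < #|V|%:R :> R by rewrite ltr0n.
    by field; rewrite (lt0r_neq0 N0) (lt0r_neq0 eps0).
  exact: wdeg.
- exact: le.
- by move=> e eI; rewrite /restrict ind //; case: ifP.
set r := fingerprint _ _ _ _ _ _ _ in h1 h2 h3 h4 h5 *.
have rC : r.2 \subset C.
  apply/subsetP => v /h5[e [ve]]; rewrite /restrict; case: ifP; last by rewrite eqxx.
  by move=> /subsetP/(_ _ ve).
have [||g1 g2 g3 g4] := IH (C :\: r.2).
- by rewrite subsetD IC.
- rewrite cardsD (setIidPr rC) natrB ?subset_leq_card // mulrBl.
  rewrite lerBlDr; apply: le_trans hC _; rewrite -natr1 mulrDl mul1r lerD2l.
  by rewrite mulrC.
split=> //; first by rewrite subUset h1.
by rewrite mulSn (leq_trans (leq_card_setU _ _)) // leq_add.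
Qed.

End WeightedHypergraphs.

Theorem hypergraph_containers (R : realType) (j : nat) (K eps : R) :
  0 < K -> 0 < eps -> exists M : nat,
  forall (V : finType) (b : nat) (p E : R) (w : {set V} -> R),
  (0 < #|V|)%N -> 0 < E -> 0 < p <= 1 -> p * #|V|%:R <= b%:R ->
  (forall e, 0 <= w e) -> (forall e, w e != 0 -> #|e| = j.+1) ->
  (forall T, T != set0 -> deg w T <= K * p ^+ #|T|.-1 * E / #|V|%:R) ->
  exists phi : {set V} -> {set V} * {set V}, forall I, independent w I ->
  [/\ (phi I).1 \subset I, (#|(phi I).1| <= M * b)%N, I \subset (phi I).2,
      total (restrict (phi I).2 w) < eps * E &
      phi (phi I).1 = phi I].
Proof.
move=> K0 eps0; pose fuel := Num.bound (density_loss j (K / eps)).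
have fuelP : density_loss j (K / eps) <= fuel%:R.
  apply: ltW; apply: archi_boundP; apply: ltW; apply: density_loss_gt0.
  by rewrite divr_gt0.
exists (fuel * j)%N => V b p E w V0 E0 p01 pb w0 wsupp wdeg.
exists (container b p j K E eps w fuel [set: V]) => I ind.
have [|h1 h2 h3 h4] := container_spec (fuel := fuel) V0 E0 K0 eps0 p01 pb w0 wsupp wdeg ind (subsetT I).
  by rewrite cardsT mulrC ler_wpM2r.
by split=> //; [rewrite -mulnA|apply: container_stable].
Qed.

(** * Random subsets *)

Section RandomSubset.
Variables (R : realType) (V : finType) (p : R).
Hypothesis p01 : 0 <= p <= 1.
Implicit Types (X U D : {set V}) (E : pred {set V}).

Let p0 : 0 <= p. Proof. by case/andP: p01. Qed.
Let p1 : 0 <= 1 - p. Proof. by rewrite subr_ge0; case/andP: p01. Qed.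

Lemma subset_weight_ge0 X : 0 <= \prod_(x : V) (if x \in X then p else 1 - p).
Proof. by apply: prodr_ge0 => x _; case: ifP. Qed.

Lemma binomial_subset_pr_ge0 E : 0 <= binomial_subset_pr p E.
Proof. by apply: sumr_ge0 => X _; exact: subset_weight_ge0. Qed.

Lemma binomial_subset_prT : binomial_subset_pr p (@predT {set V}) = 1.
Proof.
rewrite /binomial_subset_pr -(bigA_distr _ _ (fun=> p) (fun=> 1 - p)).
by rewrite big1 // => x _ /=; rewrite subrKC.
Qed.

Lemma binomial_subset_prC E :
  binomial_subset_pr p E = 1 - binomial_subset_pr p (predC E).
Proof.
rewrite -binomial_subset_prT /binomial_subset_pr [in RHS](bigID E) /=.
by rewrite addrK.
Qed.

Lemma binomial_subset_pr_cylinder U D : [disjoint U & D] ->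
  binomial_subset_pr p (fun X => (U \subset X) && [disjoint X & D]) =
  p ^+ #|U| * (1 - p) ^+ #|D|.
Proof.
move=> UD; rewrite /binomial_subset_pr big_mkcond /=.
transitivity (\sum_(X : {set V}) \prod_(x : V)
    (if x \in X then (if x \in D then 0 else p) else (if x \in U then 0 else 1 - p))).
  apply: eq_bigr => X _; case: ifP => [/andP[/subsetP UX XD]|/negbT].
    apply: eq_bigr => x _; case: ifP => xX.
      by rewrite (disjointFr XD).
    by case: ifP => // /UX; rewrite xX.
  rewrite negb_and => /orP[/subsetPn[x xU xX]|].
    by rewrite (bigD1 x) //= (negbTE xX) xU mul0r.
  rewrite -setI_eq0 => /set0Pn[x]; rewrite inE => /andP[xX xD].
  by rewrite (bigD1 x) //= xX xD mul0r.
rewrite -(bigA_distr _ _ (fun x => if x \in D then 0 else p)) /=.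
rewrite (bigID (mem U)) /= -[p ^+ #|U|]prodr_const; congr (_ * _).
  apply: eq_bigr => x xU; rewrite (disjointFr UD) // xU addr0 //.
rewrite (bigID (mem D)) /= [X in _ * X]big1 ?mulr1; last first.
  by move=> x /andP[/negbTE -> /negbTE ->]; rewrite subrKC.
rewrite -prodr_const; apply: eq_big => [x|x /andP[/negbTE -> ->]]; last by rewrite add0r.
by case xD: (x \in D); rewrite ?andbF // (disjointFl UD).
Qed.

Lemma binomial_subset_pr_superset U :
  binomial_subset_pr p (fun X => U \subset X) = p ^+ #|U|.
Proof.
have d0 : [disjoint U & set0] by rewrite disjoint_sym disjoints_subset sub0set.
have := binomial_subset_pr_cylinder d0; rewrite cards0 mulr1 => <-.
apply: eq_bigl => X.
by rewrite [[disjoint X & _]]disjoint_sym disjoints_subset sub0set andbT.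
Qed.

Lemma binomial_subset_pr_union (I : finType) (P : pred I) E (F : I -> pred {set V}) :
  (forall X, E X -> exists2 i, P i & F i X) ->
  binomial_subset_pr p E <= \sum_(i | P i) binomial_subset_pr p (F i).
Proof.
move=> H; rewrite /binomial_subset_pr.
rewrite (exchange_big_dep xpredT) //= big_mkcond /=; apply: ler_sum => X _.
case: ifP => [/H[i Pi Fi]|_]; last by apply: sumr_ge0 => i _; exact: subset_weight_ge0.
rewrite (bigD1 i) ?Pi //= lerDl; apply: sumr_ge0 => j _; exact: subset_weight_ge0.
Qed.

Lemma binomial_subset_pr_le E (F : pred {set V}) : (forall X, E X -> F X) ->
  binomial_subset_pr p E <= binomial_subset_pr p F.
Proof. by move=> EF; apply: ler_sum_sub => // X _; exact: subset_weight_ge0. Qed.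

(* A set which is not Ramsey is covered by few containers, hence misses a large
   set that is determined by the fingerprints; the union bound over all
   families of fingerprints [g] is weighted by [lam ^+ #|U|]. *)
Lemma not_ramsey_pr_le (r M m : nat) (lam : R) (w : {set V} -> R)
    (Q : {set V} -> Prop) (phi : {set V} -> {set V} * {set V}) (good : pred {set V}) :
  0 < lam <= 1 ->
  (forall I, independent w I -> [/\ (phi I).1 \subset I, (#|(phi I).1| <= M)%N,
      I \subset (phi I).2, Q (phi I).2 & phi (phi I).1 = phi I]) ->
  (forall C : 'I_r -> {set V}, (forall a, Q (C a)) -> (m <= #|~: \bigcup_a C a|)%N) ->
  (forall X, ~~ good X -> exists f : V -> 'I_r, forall a, independent w [set v in X | f v == a]) ->
  binomial_subset_pr p (predC good) <=
    (1 - p) ^+ m * lam ^- (r * M) * (1 + (2 ^ r)%:R * (lam * p)) ^+ #|V|.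
Proof.
move=> /andP[lam0 lam1] Hphi HC Hgood.
(* A family of [r] fingerprints is encoded by the set of colours whose fingerprint contains a given
   vertex; after dropping [ok], the sum over all families factors over the vertices. *)
pose Sg (g : {ffun V -> {set 'I_r}}) a := [set v | a \in g v].
pose U (g : {ffun V -> {set 'I_r}}) := [set v | g v != set0].
pose D (g : {ffun V -> {set 'I_r}}) := ~: \bigcup_a (phi (Sg g a)).2.
pose ok g := [&& (#|U g| <= r * M)%N, [disjoint U g & D g] & (m <= #|D g|)%N].
apply: le_trans (@binomial_subset_pr_union _ ok _
  (fun g X => (U g \subset X) && [disjoint X & D g]) _) _.
  move=> X /Hgood[f Hf]; pose I a := [set v in X | f v == a].
  pose g : {ffun V -> {set 'I_r}} := [ffun v => [set a | v \in (phi (I a)).1]].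
  have SgE a : Sg g a = (phi (I a)).1 by apply/setP => v; rewrite !inE ffunE inE.
  have phE a : phi (Sg g a) = phi (I a).
    by rewrite SgE; case: (Hphi _ (Hf a)).
  have UE : U g = \bigcup_a (phi (I a)).1.
    apply/setP => v; rewrite inE; apply/set0Pn/bigcupP => [[a]|[a _ va]].
      by rewrite ffunE inE; exists a.
    by exists a; rewrite ffunE inE.
  have UX : U g \subset X.
    rewrite UE; apply/bigcupsP => a _; case: (Hphi _ (Hf a)) => + _ _ _ _.
    by move/subset_trans; apply; apply/subsetP => v; rewrite inE => /andP[].
  have XD : [disjoint X & D g].
    rewrite disjoints_subset; apply/subsetP => v vX; rewrite /D setCK.
    apply/bigcupP; exists (f v) => //; rewrite phE.
    by case: (Hphi _ (Hf (f v))) => _ _ /subsetP H _ _; apply: H; rewrite !inE vX eqxx.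
  exists g; last by rewrite UX XD.
  apply/and3P; split.
  - rewrite UE; apply: leq_trans (leq_card_bigcup _ _) _.
    rewrite -[X in (_ <= X * _)%N](card_ord r) -sum_nat_const; apply: leq_sum => a _.
    by case: (Hphi _ (Hf a)).
  - exact: disjointWl UX XD.
  - by apply: HC => a; rewrite phE; case: (Hphi _ (Hf a)).
apply: le_trans (_ : \sum_g (1 - p) ^+ m * lam ^- (r * M) * (lam * p) ^+ #|U g| <= _).
  rewrite big_mkcond; apply: ler_sum => g _; case: ifP => [/and3P[h1 h2 h3]|_]; last first.
    by rewrite !mulr_ge0 ?exprn_ge0 ?invr_ge0 ?exprn_ge0 // ?mulr_ge0 // ltW.
  rewrite binomial_subset_pr_cylinder // exprMn -!mulrA mulrC.
  apply: ler_pM; rewrite ?exprn_ge0 //.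
    by apply: ler_wiXn2l => //; rewrite gerBl.
  rewrite mulrA ler_peMl ?exprn_ge0 // mulrC -(subnK h1) addnC exprD invfM mulrA.
  rewrite mulfV ?mul1r; last by rewrite expf_neq0 // lt0r_neq0.
  rewrite invf_ge1 ?exprn_gt0 //; apply: exprn_ile1 => //; exact: ltW.
rewrite -mulr_sumr; apply: ler_wpM2l.
  by rewrite mulr_ge0 ?exprn_ge0 // invr_ge0 exprn_ge0 // ltW.
have -> : \sum_g (lam * p) ^+ #|U g| =
    \sum_(g : {ffun V -> {set 'I_r}}) \prod_v (if g v != set0 then lam * p else 1).
  apply: eq_bigr => g _; rewrite -prodr_const big_mkcond /=.
  by apply: eq_bigr => v _; rewrite inE.
rewrite -(bigA_distr_bigA (fun (v : V) (A : {set 'I_r}) => if A != set0 then lam * p else 1)) /=.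
rewrite -prodr_const; apply: ler_prod => v _; apply/andP; split.
  by apply: sumr_ge0 => A _; case: ifP => _ //; rewrite mulr_ge0 // ltW.
rewrite (bigD1 set0) //= eqxx lerD2l.
apply: le_trans (_ : \sum_(A : {set 'I_r}) lam * p <= _).
  rewrite big_mkcond; apply: ler_sum => A _; case: eqP => _ /=.
    by rewrite mulr_ge0 // ltW.
  exact: lexx.
rewrite sumr_const -(mulr_natl (lam * p)); apply: ler_wpM2r; first by rewrite mulr_ge0 // ltW.
rewrite ler_nat -cardsT -[[set: {set 'I_r}]](_ : powerset [set: 'I_r] = _).
  by rewrite card_powerset cardsT card_ord.
by apply/setP => A; rewrite !inE subsetT.
Qed.

End RandomSubset.

(** * First moments of edge sequences *)

Lemma binomial_subset_pr_union_seq (R : realType) (V : finType) (p : R) (I : eqType)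
    (r : seq I) (E : pred {set V}) (F : I -> pred {set V}) :
  0 <= p <= 1 -> (forall X, E X -> exists2 i, i \in r & F i X) ->
  binomial_subset_pr p E <= \sum_(i <- r) binomial_subset_pr p (F i).
Proof.
move=> p01 H; rewrite big_tnth.
apply: (binomial_subset_pr_union p01) => X /H[i ir Fi].
by case/seq_tnthP: ir => j ij; exists j => //; rewrite -ij.
Qed.

Lemma bin_leq_exp n m : ('C(n, m) <= n ^ m)%N.
Proof.
apply: leq_trans (_ : n ^_ m <= _)%N.
  by rewrite -bin_ffact leq_pmulr // fact_gt0.
elim: m n => [|m IH] n; first by [].
rewrite ffactnS expnS leq_mul2l; apply/orP; right; apply: leq_trans (IH _) _.
by case: (m) => [|m']; rewrite ?expn0 // leq_exp2r // leq_pred.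
Qed.

Lemma word_size1 a L : (a <= L -> (a + 1).+1 <= 2 * L + 4)%N. Proof. lia. Qed.
Lemma word_size2 a L : (a <= L -> a.+2 <= 2 * L + 4)%N. Proof. lia. Qed.
Lemma word_size3 a b L : (a <= L -> b <= L -> (b + a.+2).+1 <= 2 * L + 4)%N.
Proof. lia. Qed.

Section EdgeSequences.
Variables (R : realType) (V : finType) (H : {set {set V}}) (w : nat) (p eta tau rho : R).
Implicit Types (e f g U T : {set V}) (s t : seq {set V}).
Hypotheses (w3 : (2 < w)%N) (p01 : 0 <= p <= 1).
Hypothesis cardH : forall e, e \in H -> #|e| = w.

Definition edges_over T : {set {set V}} := [set g in H | T \subset g].

(** [eta], [tau] and [rho] bound the expected number of completions to an edge of one given vertex,
    of two, and of any number from two to [w - 1]. *)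
Hypothesis deg1 : forall v, #|edges_over [set v]|%:R * p ^+ w.-1 <= eta.
Hypothesis deg2 : forall T, #|T| = 2 -> #|edges_over T|%:R * p ^+ (w - 2) <= tau.
Hypothesis degI : forall T, (1 < #|T| < w)%N -> #|edges_over T|%:R * p ^+ (w - #|T|) <= rho.
Hypotheses (eta0 : 0 <= eta) (tau0 : 0 <= tau) (rho0 : 0 <= rho).

Let p0 : 0 <= p. Proof. by case/andP: p01. Qed.

Fixpoint candidates (ls : seq label) : seq (seq {set V}) :=
  if ls is l :: ls' then
    [seq g :: s | s <- candidates ls', g <- [seq g <- enum H | step_ok l s g]]
  else [seq [:: g] | g <- enum H].

Lemma candidatesP ls s : {subset s <= H} -> matches ls s -> s \in candidates ls.
Proof.
elim: ls s => [|l ls IH] [|g s] //= sH.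
  by case: s sH => // sH _; apply: map_f; rewrite mem_enum sH // inE eqxx.
case/andP => st ms; apply/allpairsPdep; exists s, g; split=> //.
  by apply: IH => // x xs; apply: sH; rewrite inE xs orbT.
by rewrite mem_filter st mem_enum sH // inE eqxx.
Qed.

Lemma candidates_sub ls s : s \in candidates ls -> {subset s <= H}.
Proof.
elim: ls s => [|l ls IH] s /=.
  by case/mapP => g; rewrite mem_enum => gH -> x; rewrite inE => /eqP ->.
case/allpairsPdep => t [g [/IH tH]]; rewrite mem_filter mem_enum => /andP[_ gH] -> x.
by rewrite inE => /orP[/eqP ->|/tH].
Qed.

Lemma candidates_size ls s : s \in candidates ls -> size s = (size ls).+1.
Proof.
elim: ls s => [|l ls IH] s /=; first by case/mapP => g _ ->.
by case/allpairsPdep => t [g [/IH st _ ->]] /=; rewrite st.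
Qed.

Lemma card_cov_le s : {subset s <= H} -> (#|cov s| <= w * size s)%N.
Proof.
elim: s => [|g s IH] sH /=; first by rewrite cards0.
rewrite mulnS (leq_trans (leq_card_setU _ _)) // leq_add ?IH // ?cardH ?sH ?inE ?eqxx //.
by move=> x xs; apply: sH; rewrite inE xs orbT.
Qed.

Lemma sum_by_trace U (P : pred {set V}) :
  \sum_(g in H | P (g :&: U)) p ^+ #|g :\: U| <=
  \sum_(T : {set V} | (T \subset U) && P T) #|edges_over T|%:R * p ^+ (w - #|T|).
Proof.
rewrite (partition_big (fun g => g :&: U) (fun T => (T \subset U) && P T)) /=; last first.
  by move=> g /andP[_ ->]; rewrite subsetIr.
apply: ler_sum => T _; rewrite mulr_natl -sumr_const.
rewrite big_mkcond [leRHS]big_mkcond; apply: ler_sum => g _.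
case: ifP => [/andP[/andP[gH _] /eqP gT]|_]; last by case: ifP => // _; rewrite exprn_ge0.
by rewrite inE gH -gT subsetIl cardsD cardH.
Qed.

Lemma sum_draws_le U (t : nat) (theta : R) : 0 <= theta ->
  (forall T, #|T| = t -> #|edges_over T|%:R * p ^+ (w - t) <= theta) ->
  \sum_(T : {set V} | (T \subset U) && (#|T| == t)) #|edges_over T|%:R * p ^+ (w - #|T|) <=
  (#|U| ^ t)%:R * theta.
Proof.
move=> th0 hT; apply: le_trans (_ : \sum_(T : {set V} | (T \subset U) && (#|T| == t)) theta <= _).
  by apply: ler_sum => T /andP[_ /eqP Tt]; rewrite Tt; apply: hT.
rewrite sumr_const -(mulr_natl theta); apply: ler_wpM2r => //; rewrite ler_nat.
by apply: leq_trans (bin_leq_exp _ _); rewrite -cards_draws cardsE.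
Qed.

(** [B] bounds the number of vertices covered so far. [LR] costs only [w], since the common vertex
    is one of the latest edge; so the bound for paths is geometric however long they are. For [LI],
    [w] counts the sizes of the trace and [B ^+ w] the traces of a given size. *)
Definition step_factor (B : R) (l : label) : R :=
  match l with
  | LR => w%:R * eta
  | LJ => B * eta
  | LC => B ^+ 2 * tau
  | LI => w%:R * B ^+ w * rho
  end.

Lemma step_factor_ge0 B l : 0 <= B -> 0 <= step_factor B l.
Proof. by move=> B0; case: l; rewrite /= !mulr_ge0 ?exprn_ge0. Qed.

Lemma step_sum (M : nat) l s : {subset s <= H} -> ~~ nilp s ->
  (0 < M)%N -> (#|cov s| <= M)%N ->
  \sum_(g in H | step_ok l s g) p ^+ #|g :\: cov s| <= step_factor M%:R l.
Proof.
move=> sH s0 M0 cM.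
have deg1' T : #|T| = 1%N -> #|edges_over T|%:R * p ^+ (w - 1) <= eta.
  by move=> /eqP/cards1P[v ->]; rewrite subn1.
case: l => /=.
- rewrite -/(cov s).
  apply: le_trans (@sum_by_trace (cov s) (fun T => (#|T| == 1%N) && (T \subset head set0 s))) _.
  have hw : #|head set0 s| = w.
    by case: (s) s0 sH => // h s' _ sH; rewrite cardH // sH // inE eqxx.
  apply: le_trans (le_trans (_ : _ <= _) (sum_draws_le (head set0 s) eta0 deg1')) _; last first.
    by rewrite hw expn1.
  apply: ler_sum_sub => [T /andP[_ /andP[-> ->]] //|T _].
  by rewrite mulr_ge0 // exprn_ge0.
- apply: le_trans (@sum_by_trace (cov s) (fun T => (#|T| == 1%N))) _.
  apply: le_trans (sum_draws_le (cov s) eta0 deg1') _.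
  by rewrite expn1 ler_wpM2r // ler_nat.
- apply: le_trans (@sum_by_trace (cov s) (fun T => (#|T| == 2%N))) _.
  apply: le_trans (sum_draws_le (cov s) tau0 deg2) _.
  by rewrite natrX ler_wpM2r // lerXn2r ?nnegrE ?ler0n // ler_nat.
rewrite (eq_bigl (fun g => (g \in H) && (1 < #|g :&: cov s| < w)%N)); last first.
  move=> g; have [gH|//] := boolP (g \in H); congr (_ && _) => /=.
  rewrite -(cardH gH) -[~~ _ in LHS](_ : (g :&: cov s \proper g) = _).
    congr (_ && _); apply/idP/idP; first exact: proper_card.
    by move=> lt; rewrite properEcard subsetIl.
  by rewrite properE subsetIl /= subsetI subxx.
apply: le_trans (@sum_by_trace (cov s) (fun T => (1 < #|T| < w)%N)) _.
apply: le_trans (_ : \sum_(T : {set V} | (T \subset cov s) && (1 < #|T| < w)%N) rho <= _).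
  by apply: ler_sum => T /andP[_]; apply: degI.
rewrite sumr_const -(mulr_natl rho); apply: ler_wpM2r => //.
rewrite -natrX -natrM ler_nat -sum1_card.
rewrite (partition_big (fun T : {set V} => inord #|T| : 'I_w.-1.+1) xpredT) //=.
rewrite -[X in (_ <= X * _)%N](_ : w.-1.+1 = w); last by rewrite prednK // (ltn_trans _ w3).
rewrite -[X in (_ <= X * _)%N](card_ord) -sum_nat_const; apply: leq_sum => t _.
apply: leq_trans (_ : #|[set T : {set V} | T \subset cov s & #|T| == t]| <= _)%N.
  rewrite sum1_card; apply: subset_leq_card; apply/subsetP => T.
  rewrite !inE unfold_in /= => /andP[/andP[-> /andP[_ Tw]] /eqP <-] /=.
  by rewrite inordK // prednK // (ltn_trans _ w3).
rewrite cards_draws; apply: leq_trans (bin_leq_exp _ _) _.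
have tw : (t <= w)%N by rewrite (leq_trans (leq_ord t)) // leq_pred.
by apply: leq_trans (_ : M ^ t <= _)%N; [case: (nat_of_ord t) => // t'; rewrite leq_exp2r|rewrite leq_pexp2l].
Qed.

Lemma candidates_sum (M : nat) ls : (0 < M)%N -> (w * size ls <= M)%N ->
  \sum_(s <- candidates ls) p ^+ #|cov s| <=
  #|V|%:R * p * eta * \prod_(l <- ls) step_factor M%:R l.
Proof.
move=> M0; elim: ls => [|l ls IH] hM /=.
  rewrite big_nil mulr1 big_map big_enum /=.
  apply: le_trans (_ : \sum_(v : V) p * (#|edges_over [set v]|%:R * p ^+ w.-1) <= _).
    under [leRHS]eq_bigr do rewrite mulrCA -exprS prednK ?(ltn_trans _ w3) // mulr_natl -sumr_const.
    rewrite (exchange_big_dep (mem H)) /=; last by move=> v g _; rewrite inE => /andP[].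
    apply: ler_sum => g gH; rewrite setU0 cardH //.
    have /card_gt0P[v vg] : (0 < #|g|)%N by rewrite cardH // (ltn_trans _ w3).
    rewrite (bigD1 v) /=; last by rewrite inE gH sub1set.
    by rewrite lerDl sumr_ge0 // => *; rewrite exprn_ge0.
  apply: le_trans (_ : \sum_(v : V) p * eta <= _).
    by apply: ler_sum => v _; apply: ler_wpM2l.
  by rewrite sumr_const -(mulr_natl (p * eta)) mulrA.
have hM' : (w * size ls <= M)%N by apply: leq_trans hM; rewrite mulnS leq_addl.
rewrite big_allpairs_dep /= big_cons mulrCA.
apply: le_trans (_ : \sum_(s <- candidates ls) step_factor M%:R l * p ^+ #|cov s| <= _).
  rewrite big_seq [leRHS]big_seq; apply: ler_sum => s sc.
  rewrite big_filter big_enum_cond /=.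
  apply: le_trans (_ : (\sum_(g in H | step_ok l s g) p ^+ #|g :\: cov s|) * p ^+ #|cov s| <= _).
    rewrite mulr_suml; apply: ler_sum => g _; rewrite -exprD.
    by rewrite cardsU cardsD addnBAC // subset_leq_card // subsetIl.
  apply: ler_wpM2r; first by rewrite exprn_ge0.
  apply: step_sum => //; first exact: (candidates_sub sc).
    by rewrite /nilp (candidates_size sc).
  apply: leq_trans (card_cov_le (candidates_sub sc)) _.
  by rewrite (candidates_size sc).
rewrite -mulr_sumr; apply: ler_wpM2l; last exact: IH.
by apply: step_factor_ge0.
Qed.

Lemma prod_chain_le1 B a : w%:R * eta <= 1 ->
  0 <= \prod_(l <- nseq a LR) step_factor B l <= 1.
Proof.
move=> we; have we0 : 0 <= w%:R * eta by rewrite mulr_ge0.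
elim: a => [|a /andP[h0 h1]]; rewrite /= ?big_nil ?ler01 ?lexx // big_cons /= mulr_ge0 //=.
exact: mulr_ile1.
Qed.

Definition bad_candidates (L : nat) : seq (seq {set V}) :=
  candidates (nseq L LR) ++
  flatten [seq candidates (LC :: nseq a LR ++ [:: LI]) | a <- iota 0 L.+1] ++
  flatten [seq candidates (LI :: LC :: nseq a LR) | a <- iota 0 L.+1] ++
  flatten [seq candidates (LI :: nseq b LR ++ LJ :: LC :: nseq a LR) |
             a <- iota 0 L.+1, b <- iota 0 L.+1].

Lemma bad_candidatesP L ls s : bad_word L ls -> {subset s <= H} -> matches ls s ->
  s \in bad_candidates L.
Proof.
have io a : (a <= L)%N -> a \in iota 0 L.+1 by rewrite mem_iota.
have memcat (x : seq {set V}) r1 r2 : x \in r1 \/ x \in r2 -> x \in r1 ++ r2.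
  by move=> h; rewrite mem_cat; apply/orP.
move=> bw sH ms; have := candidatesP sH ms; rewrite /bad_candidates.
case: bw => [sc|a aL sc|a aL sc|a b aL bL sc]; apply: (memcat); first by left.
- right; apply: (memcat); left; apply/flattenP.
  exists (candidates (LC :: nseq a LR ++ [:: LI])) => //.
  exact: (map_f (fun a => candidates (LC :: nseq a LR ++ [:: LI])) (io _ aL)).
- right; apply: (memcat); right; apply: (memcat); left; apply/flattenP.
  exists (candidates (LI :: LC :: nseq a LR)) => //.
  exact: (map_f (fun a => candidates (LI :: LC :: nseq a LR)) (io _ aL)).
right; apply: (memcat); right; apply: (memcat); right; apply/flattenP.
exists (candidates (LI :: nseq b LR ++ LJ :: LC :: nseq a LR)) => //.
by apply/allpairsPdep; exists a, b; rewrite !io.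
Qed.

(** Apart from the long path, a bad word has one [LC], one [LI] and at most one [LJ], with powers of
    [B] adding up to at most [w + 3]; its [LR] steps cost at most 1. [3 * L.+1 ^ 2] bounds the
    number of these words, and [2 * L + 4] their length. *)
Lemma bad_candidates_sum (L : nat) (B : R) : B = (w * (2 * L + 4))%:R ->
  w%:R * eta <= 1 -> eta <= 1 ->
  \sum_(s <- bad_candidates L) p ^+ #|cov s| <=
  #|V|%:R * p * eta * (w%:R * eta) ^+ L +
  3 * (L.+1)%:R ^+ 2 * (#|V|%:R * p * tau) * (w%:R * B ^+ (w + 3) * rho).
Proof.
set M := (w * (2 * L + 4))%N => BM we e1.
have w0 : (0 < w)%N by apply: ltn_trans w3.
have M0 : (0 < M)%N by rewrite muln_gt0 w0 addn_gt0 orbT.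
have B1 : 1 <= B by rewrite BM ler1n.
have B0 : 0 <= B by rewrite BM ler0n.
have Np0 : 0 <= #|V|%:R * p by rewrite mulr_ge0.
pose Y := (#|V|%:R * p * tau) * (w%:R * B ^+ (w + 3) * rho).
have Y0 : 0 <= Y by rewrite !mulr_ge0 ?exprn_ge0.
have BY : (#|V|%:R * p) * (B ^+ 2 * tau * (w%:R * B ^+ w * rho)) * B = Y.
  by rewrite /Y exprD; ring.
have BY1 : (#|V|%:R * p) * (B ^+ 2 * tau * (w%:R * B ^+ w * rho)) <= Y.
  by rewrite -BY ler_peMr // !mulr_ge0 ?exprn_ge0.
have bound ls : (size ls <= 2 * L + 4)%N ->
    #|V|%:R * p * \prod_(l <- ls) step_factor B l <= Y ->
    \sum_(s <- candidates ls) p ^+ #|cov s| <= Y.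
  move=> sz hY; apply: le_trans (@candidates_sum M ls M0 _) _.
    by rewrite leq_mul2l sz orbT.
  apply: le_trans hY; rewrite -BM mulrAC ler_piMr // mulr_ge0 //.
  by apply: prodr_ge0 => l _; apply: step_factor_ge0.
have chain a c : 0 <= c -> c * \prod_(l <- nseq a LR) step_factor B l <= c.
  by move=> c0; rewrite ler_piMr //; case/andP: (prod_chain_le1 B a we).
have szL a : a \in iota 0 L.+1 -> (a <= L)%N by rewrite mem_iota.
rewrite /bad_candidates; have := size_iota 0 L.+1.
move: (iota 0 L.+1) szL => r szL szr.
rewrite !big_cat !big_flatten !big_map.
apply: lerD.
  apply: le_trans (@candidates_sum M _ M0 _) _.
    rewrite size_nseq leq_mul2l; apply/orP; right.
    by rewrite (leq_trans _ (leq_addr _ _)) // leq_pmull.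
  by rewrite -BM big_nseq /= iter_mulr mulr1.
have sumY (f : nat -> R) (C : R) : (forall a, (a <= L)%N -> f a <= C) ->
    \sum_(a <- r) f a <= L.+1%:R * C.
  move=> hf; rewrite big_seq; apply: le_trans (_ : \sum_(a <- r | a \in r) C <= _).
    by apply: ler_sum => a /szL; apply: hf.
  by rewrite -big_seq big_const_seq count_predT szr iter_addr addr0 mulr_natl.
have LY : L.+1%:R * Y <= L.+1%:R ^+ 2 * Y.
  by apply: ler_wpM2r => //; rewrite ler_eXnr // ler1n.
have -> : 3 * L.+1%:R ^+ 2 * (#|V|%:R * p * tau) * (w%:R * B ^+ (w + 3) * rho) =
    L.+1%:R ^+ 2 * Y + (L.+1%:R ^+ 2 * Y + L.+1%:R ^+ 2 * Y).
  by rewrite /Y; ring.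
apply: lerD; last apply: lerD.
- apply: le_trans LY; apply: sumY => a aL; apply: bound.
    by rewrite /= size_cat size_nseq /=; exact: word_size1.
  rewrite big_cons big_cat big_seq1 /=; apply: le_trans BY1; apply: ler_wpM2l => //.
  set P := \prod_(l <- _) _.
  have -> : B ^+ 2 * tau * (P * (w%:R * B ^+ w * rho)) =
    B ^+ 2 * tau * (w%:R * B ^+ w * rho) * P by ring.
  by apply: chain; rewrite !mulr_ge0 ?exprn_ge0.
- apply: le_trans LY; apply: sumY => a aL; apply: bound.
    by rewrite /= size_nseq /=; exact: word_size2.
  rewrite !big_cons /=; apply: le_trans BY1; apply: ler_wpM2l => //.
  rewrite mulrA [X in X * _ <= _]mulrC; apply: chain.
  by rewrite !mulr_ge0 ?exprn_ge0.
- rewrite expr2 -mulrA; apply: (sumY _ (L.+1%:R * Y)) => a aL; rewrite big_map; apply: sumY => b bL; apply: bound.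
    by rewrite /= size_cat !size_nseq /= size_nseq; exact: word_size3.
  rewrite !big_cons big_cat !big_cons /= -BY -[leRHS]mulrA; apply: ler_wpM2l => //.
  set P1 := \prod_(l <- nseq b LR) _; set P2 := \prod_(l <- nseq a LR) _.
  have -> : w%:R * B ^+ w * rho * (P1 * (B * eta * (B ^+ 2 * tau * P2))) =
     B ^+ 2 * tau * (w%:R * B ^+ w * rho) * B * eta * P1 * P2 by ring.
  have X0 : 0 <= B ^+ 2 * tau * (w%:R * B ^+ w * rho) * B by rewrite !mulr_ge0 ?exprn_ge0.
  apply: le_trans (chain a _ _) _.
    by rewrite !mulr_ge0 // ?(proj1 (andP (prod_chain_le1 B b we))) // ?exprn_ge0.
  apply: le_trans (chain b _ _) _; first by rewrite mulr_ge0.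
  by rewrite ler_piMr.
Qed.

Theorem not_two_colourable_pr_le (L : nat) (B : R) : B = (w * (2 * L + 4))%:R ->
  w%:R * eta <= 1 -> eta <= 1 ->
  binomial_subset_pr p (fun X => ~~ two_colourable [set e in H | e \subset X]) <=
  #|V|%:R * p * eta * (w%:R * eta) ^+ L +
  3 * (L.+1)%:R ^+ 2 * (#|V|%:R * p * tau) * (w%:R * B ^+ (w + 3) * rho).
Proof.
move=> BM we e1; apply: le_trans (bad_candidates_sum BM we e1).
apply: le_trans (binomial_subset_pr_union_seq (r := bad_candidates L)
   (F := fun s X => cov s \subset X) p01 _) _; last first.
  by apply: ler_sum => s _; rewrite binomial_subset_pr_superset.
move=> X /critical_exists[E' cE' sE'].
have [/hasP[s sb sX]|/hasPn none] := boolP (has (fun s => cov s \subset X) (bad_candidates L)).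
  by exists s.
exfalso.
have E'H e : e \in E' -> e \in H /\ e \subset X.
  by move=> /(subsetP sE'); rewrite inE => /andP[].
apply: (@critical_bad V E' w L cE' w3).
  by move=> e /E'H[/cardH].
move=> ls s bw sE ms.
have sH : {subset s <= H} by move=> e /sE /E'H[].
have := none s (bad_candidatesP bw sH ms); case/negP.
elim: (s) sE => [|g s' IH] sE /=; first exact: sub0set.
have [_ gX] := E'H g (sE g (mem_head _ _)).
by rewrite subUset gX IH // => x xs; apply: sE; rewrite inE xs orbT.
Qed.

End EdgeSequences.

(** * Kernels and ranks *)

Definition rows_on (F : fieldType) (k d : nat) (W : {set 'I_k}) (G : 'M[F]_(k, d)) : 'M_(#|W|, d) :=
  rowsub (fun j : 'I_#|W| => enum_val j) G.

Definition rank_on (F : fieldType) (k d : nat) (G : 'M[F]_(k, d)) (W : {set 'I_k}) : nat :=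
  \rank (rows_on W G).

Section RankOn.
Variables (F : fieldType) (k d : nat) (G : 'M[F]_(k, d)).

Lemma rowsub_sub (a b : nat) (f : 'I_a -> 'I_k) (g : 'I_b -> 'I_k) :
  (forall i, exists j, g j = f i) -> (rowsub f G <= rowsub g G)%MS.
Proof.
move=> fg; apply/row_subP => i; have [j gj] := fg i.
by rewrite row_rowsub -gj -row_rowsub row_sub.
Qed.

Lemma rank_on_subset (W W' : {set 'I_k}) : W \subset W' -> (rank_on G W <= rank_on G W')%N.
Proof.
move=> sWW'; apply: mxrankS; apply: rowsub_sub => i.
have iW : enum_val i \in W' by apply: (subsetP sWW'); apply: enum_valP.
by exists (enum_rank_in iW (enum_val i)); rewrite enum_rankK_in.
Qed.

Lemma rank_onT : rank_on G [set: 'I_k] = \rank G.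
Proof.
have GE : rowsub id G = G by apply/matrixP => i j; rewrite !mxE.
have h1 : (rows_on [set: 'I_k] G <= rowsub id G)%MS.
  by apply: rowsub_sub => i; exists (enum_val i).
have h2 : (rowsub id G <= rows_on [set: 'I_k] G)%MS.
  by apply: rowsub_sub => i; exists (enum_rank_in (in_setT i) i); rewrite enum_rankK_in ?inE.
by rewrite -[in RHS]GE; apply/eqP; rewrite eqn_leq /rank_on !mxrankS.
Qed.

Lemma rank_on_ge2 (W : {set 'I_k}) i j : i \in W -> j \in W ->
  (forall a b : F, a *: row i G + b *: row j G = 0 -> a = 0 /\ b = 0) -> (2 <= rank_on G W)%N.
Proof.
move=> iW jW ind; pose f (a : 'I_2) := if a == 0 then i else j.
have fr : row_free (rowsub f G).
  apply/inj_row_free => v; rewrite mulmx_sum_row !big_ord_recl big_ord0 addr0 !row_rowsub /=.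
  case/ind => v0 v1; apply/rowP => a; rewrite mxE.
  by case: (unliftP 0 a) => [b|] ->; [rewrite (ord1 b)|].
apply: leq_trans (_ : \rank (rowsub f G) <= _)%N; first by rewrite (eqP fr).
apply: mxrankS; apply: rowsub_sub => a.
have fW : f a \in W by rewrite /f; case: ifP.
by exists (enum_rank_in fW (f a)); rewrite enum_rankK_in.
Qed.

Lemma rank_on_gt0 (W : {set 'I_k}) i : i \in W -> row i G != 0 -> (0 < rank_on G W)%N.
Proof.
move=> iW; rewrite lt0n; apply: contra; rewrite mxrank_eq0 => /eqP G0.
apply/eqP; have := row_rowsub (fun j : 'I_#|W| => enum_val j) G (enum_rank_in iW i).
by rewrite enum_rankK_in // -/(rows_on W G) G0 => <-; rewrite row0.
Qed.

Lemma rows_onE n (W : {set 'I_k}) (y z : 'M_(d, n)) : (forall i, i \in W -> row i (G *m y) = row i (G *m z)) ->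
  rows_on W G *m y = rows_on W G *m z.
Proof.
move=> H; apply/row_matrixP => a; have := H _ (enum_valP a).
by rewrite !row_mul row_rowsub.
Qed.

(** Proportional rows whose images both start with a 1 have proportionality factor 1, that is, they
    are equal. Thus sets of two rows have rank 2 and the denominators of the densities are
    positive. *)
Lemma lead_independent m (c : 'M[F]_(d, m)) (i j : 'I_k) : row i G != row j G ->
  (exists a : 'I_m, (forall b : 'I_m, (b < a)%N -> (G *m c) i b = 0) /\ (G *m c) i a = 1) ->
  (exists a : 'I_m, (forall b : 'I_m, (b < a)%N -> (G *m c) j b = 0) /\ (G *m c) j a = 1) ->
  forall a b : F, a *: row i G + b *: row j G = 0 -> a = 0 /\ b = 0.
Proof.
move=> nij [ai [i0 i1]] [aj [j0 j1]] a b H0.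
have H x : a * (G *m c) i x + b * (G *m c) j x = 0.
  have /rowP/(_ x) := congr1 (fun v => v *m c) H0.
  rewrite mul0mx mulmxDl -!scalemxAl -!row_mul mxE [X in X + _]mxE [X in _ + X]mxE.
  by rewrite [row i _ _ _]mxE [row j _ _ _]mxE [RHS]mxE.
have := H ai; have := H aj; rewrite i1 j1 !mulr1.
case: (ltngtP ai aj) => [lt|lt|/val_inj eq].
- rewrite (j0 _ lt) mulr0 addr0 => Hj a0; move: Hj.
  by rewrite a0 mul0r add0r.
- rewrite (i0 _ lt) mulr0 add0r => b0; rewrite b0 mul0r addr0 => a0; by split.
rewrite -eq i1 mulr1 => ab _; have bE : b = - a by apply/eqP; rewrite -addr_eq0 addrC ab.
have : a *: (row i G - row j G) = 0 by rewrite scalerBr -scaleNr -bE.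
move/eqP; rewrite scaler_eq0 subr_eq0 (negbTE nij) orbF => /eqP a0.
by rewrite bE a0 oppr0.
Qed.

End RankOn.

(** * Counting solutions through a given set *)

Section ImageCount.
Variables (F : finFieldType) (k d n : nat) (G : 'M[F]_(k, d)).

Definition image_set (y : 'M[F]_(d, n)) : {set 'rV[F]_n} := [set row i (G *m y) | i : 'I_k].
Definition distinct_rows (y : 'M[F]_(d, n)) : bool := injectiveb (fun i => row i (G *m y)).

Lemma card_image_set y : distinct_rows y -> #|image_set y| = k.
Proof. by move/injectiveP => inj; rewrite card_imset // card_ord. Qed.

(** There are at most [k ^ #|T|] ways to assign rows to the elements of [T]; once the rows in [W]
    are prescribed, [y] solves a linear system of rank [rank_on G W]. *)
Lemma card_image_over (R : realType) (T : {set 'rV[F]_n}) (b : R) :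
  0 <= b ->
  (forall W : {set 'I_k}, #|W| = #|T| -> (#|F| ^ (n * (d - rank_on G W)))%:R <= b) ->
  #|[set y | distinct_rows y && (T \subset image_set y)]|%:R <= (k ^ #|T|)%:R * b.
Proof.
move=> b0 hb; set S := [set y | _].
pose S_ (g : {ffun 'I_#|T| -> 'I_k}) :=
  [set y : 'M[F]_(d, n) | [forall a, row (g a) (G *m y) == enum_val a]].
have sub : S \subset \bigcup_(g : {ffun 'I_#|T| -> 'I_k} | injectiveb g) S_ g.
  apply/subsetP => y; rewrite inE => /andP[_ /subsetP Ty].
  have H (a : 'I_#|T|) : exists i, row i (G *m y) == enum_val a.
    by have /imsetP[i _ ->] := Ty _ (enum_valP a); exists i.
  have [g Hg] := fin_all_exists H.
  apply/bigcupP; exists [ffun a => g a]; last first.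
    by rewrite inE; apply/forallP => a; rewrite ffunE.
  apply/injectiveP => a a'; rewrite !ffunE => E; apply: enum_val_inj.
  by rewrite -(eqP (Hg a)) -(eqP (Hg a')) E.
apply: le_trans (_ : (\sum_(g : {ffun 'I_#|T| -> 'I_k} | injectiveb g) #|S_ g|)%:R <= _).
  rewrite ler_nat; apply: leq_trans (subset_leq_card sub) _; exact: leq_card_bigcup.
rewrite natr_sum; apply: le_trans (_ : \sum_(g : {ffun 'I_#|T| -> 'I_k}) b <= _); last first.
  by rewrite sumr_const card_ffun !card_ord mulr_natl.
rewrite big_mkcond; apply: ler_sum => g _; case: ifP => [/injectiveP ginj|//].
have cW : #|[set g a | a : 'I_#|T|]| = #|T| by rewrite card_imset // card_ord.
apply: le_trans (hb _ cW); rewrite ler_nat.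
have [->|[y0 y0S]] := set_0Vmem (S_ g); first by rewrite cards0.
apply: leq_trans (card_mulmx_eq_le (rows_on [set g a | a : 'I_#|T|] G) (rows_on [set g a | a : 'I_#|T|] G *m y0)).
apply: subset_leq_card; apply/subsetP => y yS; rewrite inE; apply/eqP.
apply: rows_onE => _ /imsetP[a _ ->]; move: yS y0S; rewrite !inE.
by move=> /forallP/(_ a)/eqP -> /forallP/(_ a)/eqP ->.
Qed.

End ImageCount.

Lemma complement_rank_arith (a b c x y k l : nat) : (a <= c -> b <= y -> x + y = k ->
  c + l = k -> c - a = y - b -> x + b = a + l)%N.
Proof. lia. Qed.

(** * The kernel of the matrix *)

Section Kernel.
Variables (F : finFieldType) (l k : nat) (A : 'M[int]_(l, k)).
Let Af : 'M[F]_(l, k) := int_mx F A.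

Definition ker_dim : nat := \rank (kermx Af^T).
Definition ker_mx : 'M[F]_(k, ker_dim) := (row_base (kermx Af^T))^T.

Lemma mulmx_ker_mx : Af *m ker_mx = 0.
Proof.
apply/trmx_inj; rewrite trmx_mul trmxK trmx0; apply/sub_kermxP.
by rewrite eq_row_base.
Qed.

Lemma ker_mxP n (x : 'M[F]_(k, n)) : Af *m x = 0 -> exists y, x = ker_mx *m y.
Proof.
move=> Ax; have : (x^T <= row_base (kermx Af^T))%MS.
  by rewrite eq_row_base; apply/sub_kermxP; rewrite -trmx_mul Ax trmx0.
by case/submxP => z xz; exists z^T; apply/trmx_inj; rewrite trmx_mul !trmxK.
Qed.

Lemma ker_mx_inj n : injective (fun y : 'M[F]_(ker_dim, n) => ker_mx *m y).
Proof.
move=> y z /(congr1 trmx); rewrite !trmx_mul trmxK.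
by move/(row_free_inj (row_base_free _))/trmx_inj.
Qed.

Lemma rank_ker_mx : \rank ker_mx = ker_dim.
Proof. by rewrite mxrank_tr eq_row_base. Qed.

Hypothesis fullA : full_rank F A.

Lemma ker_dimE : (ker_dim + l = k)%N.
Proof.
rewrite /ker_dim mxrank_ker mxrank_tr (eqP fullA) subnK //.
by rewrite -(eqP fullA) rank_leq_col.
Qed.

Lemma mulmx_outside n (W : {set 'I_k}) (x : 'M[F]_(k, n)) : rows_on W x = 0 ->
  Af *m x = cols_outside F A W *m rows_on (~: W) x.
Proof.
move=> xW; apply/matrixP => i j; rewrite !mxE (bigID (mem (~: W))) /= [X in _ + X]big1 ?addr0.
  by rewrite big_enum_val /=; apply: eq_bigr => a _; rewrite !mxE.
move=> a; rewrite inE negbK => aW; have /matrixP/(_ (enum_rank_in aW a) j) := xW.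
by rewrite !mxE enum_rankK_in // => ->; rewrite mulr0.
Qed.

(** Solutions vanishing on [W] are counted twice: as the [y] killed by the rows of [ker_mx] in [W],
    and as the kernel of the columns outside [W]. *)
Lemma rank_on_ker_mx (W : {set 'I_k}) :
  (#|W| + \rank (cols_outside F A W) = rank_on ker_mx W + l)%N.
Proof.
pose S1 := [set y : 'M[F]_(ker_dim, 1) | rows_on W ker_mx *m y == 0].
pose S2 := [set z : 'M[F]_(#|~: W|, 1) | cols_outside F A W *m z == 0].
pose f (y : 'M[F]_(ker_dim, 1)) := rows_on (~: W) (ker_mx *m y).
have rowsM (W' : {set 'I_k}) n (y : 'M_(ker_dim, n)) :
    rows_on W' (ker_mx *m y) = rows_on W' ker_mx *m y.
  by rewrite /rows_on mul_rowsub_mx.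
have cE : #|S1| = #|S2|.
  have <- : f @: S1 = S2.
    apply/setP => z; rewrite inE; apply/imsetP/eqP => [[y]|Az].
      rewrite inE => /eqP yW ->; rewrite -mulmx_outside ?rowsM //.
      by rewrite mulmxA mulmx_ker_mx mul0mx.
    pose x : 'M[F]_(k, 1) := (rows_on (~: W) 1%:M)^T *m z.
    have xE i j : x i j = \sum_a (enum_val a == i)%:R * z a j.
      by rewrite mxE; apply: eq_bigr => a _; rewrite !mxE.
    have xW : rows_on W x = 0.
      apply/matrixP => i j; rewrite mxE xE big1 ?mxE // => a _.
      have [E|_] := eqVneq; last by rewrite mul0r.
      by have := enum_valP a; rewrite inE E enum_valP.
    have xz : rows_on (~: W) x = z.
      apply/matrixP => i j; rewrite mxE xE (bigD1 i) //= eqxx mul1r big1 ?addr0 // => a ai.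
      by rewrite (inj_eq enum_val_inj) (negbTE ai) mul0r.
    have [y xy] : exists y, x = ker_mx *m y.
      by apply: ker_mxP; rewrite -/Af (mulmx_outside xW) xz.
    by exists y; [rewrite inE -rowsM -xy xW|rewrite /f -xy xz].
  rewrite card_in_imset // => y y'; rewrite !inE => /eqP y0 /eqP y0' fyy'.
  apply: ker_mx_inj; apply/row_matrixP => i; have [iW|iW] := boolP (i \in W).
    have H (v : 'M_(ker_dim, 1)) : rows_on W ker_mx *m v = 0 -> row i (ker_mx *m v) = 0.
      move=> v0; have := row_rowsub (fun j : 'I_#|W| => enum_val j) (ker_mx *m v) (enum_rank_in iW i).
      by rewrite enum_rankK_in // -/(rows_on W _) rowsM v0 row0.
    by rewrite !H.
  have iW' : i \in ~: W by rewrite inE.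
  have H (v : 'M_(ker_dim, 1)) : row i (ker_mx *m v) = row (enum_rank_in iW' i) (f v).
    by rewrite /f /rows_on row_rowsub enum_rankK_in.
  by rewrite !H fyy'.
have F1 := card_finNzRing_gt1 F.
have := cE; rewrite !card_mulmx_eq0 !mul1n => /eqP; rewrite eqn_exp2l // => /eqP.
have h1 : (rank_on ker_mx W <= ker_dim)%N.
  by have := rank_on_subset ker_mx (subsetT W); rewrite rank_onT rank_ker_mx.
have h2 : (\rank (cols_outside F A W) <= #|~: W|)%N by apply: rank_leq_col.
have h3 := cardsC W; rewrite card_ord in h3; have h4 := ker_dimE.
by move=> h5; exact: (complement_rank_arith h1 h2 h3 h4 h5).
Qed.

End Kernel.

Lemma Fp_morphism (F : finFieldType) (q t : nat) : prime q -> #|F| = (q ^ t)%N ->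
  exists psi : {rmorphism 'F_q -> F}, True.
Proof.
move=> pq cF; have qF := card_finPcharP cF pq.
pose psi : {rmorphism 'F_q -> pPrimeCharType qF} :=
  GRing.RMorphism.clone _ _ (in_alg (pPrimeCharType qF)) _.
by exists psi.
Qed.

Section Columns.
Variables (F : finFieldType) (l k : nat) (A : 'M[int]_(l, k)).

(** The i-th column of [U] is the relation expressing the sum over [C i] through the columns of
    earlier classes. So the row of [j] in [C i] vanishes before position [i] and is 1 there; the
    columns of [U] being solutions, [U] factors through [ker_mx]. *)
Lemma columns_lead (q t : nat) : prime q -> #|F| = (q ^ t)%N -> q_columns_condition q A ->
  exists m (c : 'M[F]_(ker_dim F A, m)), forall j, exists i, lead1 (row j (ker_mx F A *m c)) i.
Proof.
move=> pq cF [m [C [[C0 Cdis] Ccov Csum Clin]]].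
have [psi _] := Fp_morphism pq cF.
have Clin' i : exists a : 'I_k -> 'F_q,
    \sum_(j in C i) col j (map_mx intr A : 'M['F_q]_(l, k)) =
    \sum_(j in \bigcup_(i' < m.+1 | (i' < i)%N) C i') a j *: col j (map_mx intr A).
  have [->|/Clin //] := eqVneq i ord0; exists (fun=> 0).
  by rewrite Csum big1 // => j _; rewrite scale0r.
have [a Ha] := fin_all_exists Clin'.
pose low (i : 'I_m.+1) := \bigcup_(i' < m.+1 | (i' < i)%N) C i'.
have lowP i j : j \in C i -> forall i' : 'I_m.+1, (i' <= i)%N -> j \notin low i'.
  move=> jC i' ii'; apply/negP => /bigcupP[i'' lt jC''].
  have ne : i'' != i by apply: contraTneq (leq_trans lt ii') => ->; rewrite ltnn.
  by have := Cdis _ _ ne; rewrite -setI_eq0 => /eqP/setP/(_ j); rewrite !inE jC'' jC.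
pose U : 'M[F]_(k, m.+1) := \matrix_(j, i)
  ((j \in C i)%:R - (j \in low i)%:R * psi (a i j)).
have AU : int_mx F A *m U = 0.
  apply/matrixP => x i; rewrite !mxE.
  under eq_bigr do rewrite [U _ _]mxE mulrBr.
  rewrite sumrB; apply/eqP; rewrite subr_eq0; apply/eqP.
  have /matrixP/(_ x 0) := Ha i; rewrite !summxE => /(congr1 psi); rewrite !rmorph_sum /=.
  rewrite big_mkcond [X in _ = X -> _]big_mkcond /= => E.
  transitivity (\sum_j (if j \in C i then psi (col j (map_mx intr A : 'M['F_q]_(l, k)) x 0) else 0)).
    apply: eq_bigr => j _; case: ifP => _; last by rewrite mulr0.
    by rewrite !mxE rmorph_int mulr1.
  rewrite E; apply: eq_bigr => j _; rewrite -/(low i); case: ifP => _; last by rewrite mul0r mulr0.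
  by rewrite !mxE rmorphM /= rmorph_int mul1r mulrC.
have [c Uc] := ker_mxP AU.
exists m.+1, c => j; rewrite -Uc.
have /bigcupP[i _ jC] : j \in \bigcup_i C i by rewrite Ccov inE.
have nC i' : i' != i -> (j \in C i') = false.
  by move=> /Cdis; rewrite -setI_eq0 => /eqP/setP/(_ j); rewrite !inE jC andbT.
exists i; split=> [i' lt|]; rewrite !mxE.
  rewrite nC; last by apply: contraTneq lt => ->; rewrite ltnn.
  by rewrite (negbTE (lowP _ _ jC _ (ltnW lt))) mul0r subr0.
by rewrite jC (negbTE (lowP _ _ jC _ (leqnn _))) mul0r subr0.
Qed.

Lemma irredundant_rows n : irredundant F A n -> injective (fun i => row i (ker_mx F A)).
Proof.
case/existsP => x /andP[/injectiveP xinj /eqP Ax] i j eij.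
have [y xy] := ker_mxP Ax; apply: xinj => /=.
by rewrite xy !row_mul eij.
Qed.

End Columns.

Section Compression.
Variables (F : fieldType) (k d : nat) (G : 'M[F]_(k, d)) (W : {set 'I_k}).

(* The rows of G in W, written in a basis of the space they span. *)
Definition compress : 'M[F]_(#|W|, rank_on G W) := col_base (rows_on W G).

Lemma compress_mul n (y : 'M[F]_(d, n)) (a : 'I_#|W|) :
  row a (compress *m (row_base (rows_on W G) *m y)) = row (enum_val a) (G *m y).
Proof. by rewrite mulmxA mulmx_base !row_mul row_rowsub. Qed.

Lemma rank_on_compress (W' : {set 'I_#|W|}) :
  rank_on compress W' = rank_on G [set enum_val a | a in W'].
Proof.
have fr : row_free (row_base (rows_on W G)) by exact: row_base_free.
rewrite {1}/rank_on -(mxrankMfree _ fr) /rows_on mul_rowsub_mx mulmx_base.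
have cE : rowsub (fun j : 'I_#|W'| => enum_val j) (rowsub (fun j : 'I_#|W| => enum_val j) G) =
    rowsub (fun j : 'I_#|W'| => enum_val (enum_val j)) G.
  by apply/matrixP => i j; rewrite !mxE.
rewrite cE; apply/eqP; rewrite eqn_leq; apply/andP; split; apply: mxrankS; apply: rowsub_sub => i.
  have iW : enum_val (enum_val i) \in [set enum_val a | a in W'].
    by apply/imsetP; exists (enum_val i) => //; exact: enum_valP.
  by exists (enum_rank_in iW (enum_val (enum_val i))); rewrite enum_rankK_in.
have /imsetP[a aW' ->] := enum_valP i.
by exists (enum_rank_in aW' a); rewrite enum_rankK_in.
Qed.

End Compression.

(** * Probability bounds for hypergraphs of images *)

Section ZeroBound.
Variables (R : realType) (F : finFieldType) (w d n : nat) (G : 'M[F]_(w, d)).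
Variables (p p0 c beta : R).
Let N : R := (#|F| ^ n)%:R.

Definition image_hypergraph : {set {set 'rV[F]_n}} :=
  [set image_set G y | y in [set y : 'M_(d, n) | distinct_rows G y]].

Hypotheses (w3 : (2 < w)%N) (d2 : (1 < d)%N) (p01 : 0 <= p <= 1) (pp0 : p <= c * p0).
Hypotheses (p00 : 0 < p0) (c0 : 0 < c) (c1 : c <= 1) (hc : w%:R * (w%:R * c) <= (2 * #|F|%:R)^-1).
Hypothesis balanced : p0 ^+ w.-1 * N ^+ d.-1 = 1.
Hypothesis strict : forall W : {set 'I_w}, (1 < #|W| < w)%N ->
  N ^+ (d - rank_on G W) * p0 ^+ (w - #|W|) <= beta.
Hypothesis rank1 : forall W : {set 'I_w}, W != set0 -> (0 < rank_on G W)%N.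
Hypothesis rank2 : forall W : {set 'I_w}, (1 < #|W|)%N -> (1 < rank_on G W)%N.
Hypothesis beta0 : 0 <= beta.

Let F1 : (1 < #|F|)%N := card_finNzRing_gt1 F.
Let N1 : 1 <= N. Proof. by rewrite ler1n expn_gt0 ltnW. Qed.
Let N0 : 0 < N. Proof. exact: lt_le_trans N1. Qed.
Let p_ge0 : 0 <= p. Proof. by case/andP: p01. Qed.
Let w0 : (0 < w)%N. Proof. exact: ltn_trans w3. Qed.

Lemma card_image_hypergraph e : e \in image_hypergraph -> #|e| = w.
Proof. by case/imsetP => y; rewrite inE => dy ->; exact: card_image_set. Qed.

Lemma edges_over_le (T : {set 'rV[F]_n}) (b : R) : 0 <= b ->
  (forall W : {set 'I_w}, #|W| = #|T| -> N ^+ (d - rank_on G W) <= b) ->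
  #|edges_over image_hypergraph T|%:R <= (w ^ #|T|)%:R * b.
Proof.
move=> b0 hb; apply: le_trans (@card_image_over F w d n G R T b b0 _); last first.
  by move=> W WT; rewrite expnM natrX; exact: hb.
rewrite ler_nat; apply: leq_trans (leq_imset_card (image_set G) _).
apply: subset_leq_card; apply/subsetP => e; rewrite inE => /andP[/imsetP[y]].
by rewrite inE => dy -> Ty; apply/imsetP; exists y; rewrite // inE dy.
Qed.

Lemma pexp_le j : p ^+ j <= (c * p0) ^+ j.
Proof. by rewrite lerXn2r // nnegrE ?mulr_ge0 // ltW. Qed.

Lemma pexp_le0 j : p ^+ j <= p0 ^+ j.
Proof.
apply: le_trans (pexp_le j) _; have h : c * p0 <= p0 by rewrite ler_piMl // ltW.
by rewrite lerXn2r // nnegrE ?mulr_ge0 // ltW.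
Qed.

(** Take paths of length [n]: by [hc] a step costs at most [(2 * #|F|)^-1], so the [N] starting
    points leave [2^-n]. By [balanced] the factor [N * p0 * tau] is the constant [w ^ 2], so the
    other configurations are governed by [beta]. *)
Lemma not_two_colourable_bound :
  binomial_subset_pr p (fun X => ~~ two_colourable [set e in image_hypergraph | e \subset X]) <=
  (2^-1) ^+ n + 3 * n.+1%:R ^+ 2 * w%:R ^+ 2 *
    (w%:R * (w * (2 * n + 4))%:R ^+ (w + 3) * (w%:R ^+ w * beta)).
Proof.
pose eta := w%:R * c; pose tau := w%:R ^+ 2 * (N ^+ (d - 2) * p0 ^+ (w - 2)).
pose rho := w%:R ^+ w * beta.
have c0' := ltW c0; have p00' := ltW p00.
have w1 : 1 <= w%:R :> R by rewrite ler1n.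
have eta0 : 0 <= eta by rewrite mulr_ge0.
have tau0 : 0 <= tau by rewrite !mulr_ge0 ?exprn_ge0 // ltW.
have rho0 : 0 <= rho by rewrite mulr_ge0 ?exprn_ge0.
have q0 : 0 < #|F|%:R :> R by rewrite ltr0n ltnW.
have we : w%:R * eta <= (2 * #|F|%:R)^-1 by [].
have inv1 : (2 * #|F|%:R)^-1 <= 1 :> R.
  rewrite invf_le1 ?mulr_gt0 // -natrM ler1n muln_gt0 /=; exact: ltnW.
have we1 : w%:R * eta <= 1 by apply: le_trans inv1.
have eta1 : eta <= 1.
  by apply: le_trans we1; rewrite ler_peMl.
have h1 (v : 'rV[F]_n) : #|edges_over image_hypergraph [set v]|%:R * p ^+ w.-1 <= eta.
  apply: le_trans (_ : (w%:R * N ^+ d.-1) * (c * p0) ^+ w.-1 <= _).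
    apply: ler_pM => //; rewrite ?exprn_ge0 ?pexp_le //.
    have := @edges_over_le [set v] (N ^+ d.-1); rewrite cards1 expn1; apply.
      by rewrite exprn_ge0 // ltW.
    move=> W /eqP/cards1P[i ->]; rewrite ler_weXn2l //.
    have : (0 < rank_on G [set i])%N by apply: rank1; apply/set0Pn; exists i; rewrite inE.
    by case: (d) (rank_on _ _) => [|d'] [|e'] //= _; rewrite subSS leq_subr.
  have -> : w%:R * N ^+ d.-1 * (c * p0) ^+ w.-1 = w%:R * c ^+ w.-1 * (p0 ^+ w.-1 * N ^+ d.-1).
    by rewrite exprMn; ring.
  rewrite balanced mulr1 /eta; apply: ler_wpM2l => //; have -> : w.-1 = w.-2.+1 by rewrite prednK // -subn1 subn_gt0 ltnW.
  by rewrite exprS ler_piMr // exprn_ile1.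
have h2 (T : {set 'rV[F]_n}) : #|T| = 2%N -> #|edges_over image_hypergraph T|%:R * p ^+ (w - 2) <= tau.
  move=> T2; rewrite /tau mulrA; apply: ler_pM => //; rewrite ?exprn_ge0 ?pexp_le0 //.
  have := @edges_over_le T (N ^+ (d - 2)); rewrite T2 natrX; apply.
    by rewrite exprn_ge0 // ltW.
  by move=> W W2; rewrite ler_weXn2l // leq_sub2l // rank2 // W2.
have hI (T : {set 'rV[F]_n}) : (1 < #|T| < w)%N ->
    #|edges_over image_hypergraph T|%:R * p ^+ (w - #|T|) <= rho.
  move=> /andP[T1 Tw].
  have pw : 0 < p0 ^+ (w - #|T|) by rewrite exprn_gt0.
  apply: le_trans (_ : ((w ^ #|T|)%:R * (beta / p0 ^+ (w - #|T|))) * p0 ^+ (w - #|T|) <= _).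
    apply: ler_pM => //; rewrite ?exprn_ge0 ?pexp_le0 //.
    apply: edges_over_le; first by rewrite divr_ge0 // ltW.
    by move=> W WT; rewrite ler_pdivlMr // -WT strict // WT T1.
  rewrite -mulrA divfK ?lt0r_neq0 // /rho -natrX; apply: ler_wpM2r => //.
  by rewrite ler_nat leq_pexp2l // ltnW.
apply: le_trans (@not_two_colourable_pr_le R _ image_hypergraph w p eta tau rho w3 p01
  card_image_hypergraph h1 h2 hI eta0 tau0 rho0 n _ erefl we1 eta1) _.
have VN : #|{: 'rV[F]_n}|%:R = N by rewrite card_mx mul1n.
rewrite VN; apply: lerD.
  apply: le_trans (_ : N * ((2 * #|F|%:R)^-1) ^+ n <= _).
    apply: ler_pM; rewrite ?mulr_ge0 ?exprn_ge0 ?mulr_ge0 // ?(ltW N0) //.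
      rewrite -mulrA ler_piMr ?(ltW N0) // mulr_ile1 //; by case/andP: p01.
    by rewrite lerXn2r // nnegrE ?mulr_ge0 // invr_ge0 mulr_ge0 // ltW.
  rewrite /N natrX -exprMn invfM mulrCA mulfV ?mulr1 //; exact: lt0r_neq0.
apply: ler_wpM2r; first by rewrite !mulr_ge0 ?exprn_ge0.
apply: ler_wpM2l; first by rewrite mulr_ge0 ?exprn_ge0.
apply: le_trans (_ : N * p0 * tau <= _).
  apply: ler_wpM2r => //; apply: ler_wpM2l; first exact: ltW.
  by have := pexp_le0 1; rewrite !expr1.
have -> : N * p0 * tau = w%:R ^+ 2 * ((p0 * p0 ^+ (w - 2)) * (N * N ^+ (d - 2))).
  by rewrite /tau; ring.
rewrite -!exprS; have -> : (w - 2).+1 = w.-1 by rewrite -subSn ?subSS ?subn1 // ltnW.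
have -> : (d - 2).+1 = d.-1 by rewrite -subSn ?subSS ?subn1 // ltnW.
by rewrite balanced mulr1.
Qed.

End ZeroBound.

Lemma sum_card_fibres (I J : finType) (P : pred I) (Q : pred J) (f : I -> J) :
  (\sum_(e | Q e) #|[set y | P y && (f y == e)]| = #|[set y | P y && Q (f y)]|)%N.
Proof.
rewrite -[RHS]sum1_card (partition_big f Q) /=; last by move=> y; rewrite inE => /andP[].
apply: eq_bigr => e Qe; rewrite -sum1_card; apply: eq_bigl => y; rewrite !inE.
by case: eqP => [->|_]; rewrite ?Qe ?andbT ?andbF.
Qed.

Lemma leq_double_floor (y q x M : nat) : (0 < q -> x < M -> y = q * M + x -> y <= 2 * (M * q))%N.
Proof.
move=> q0 xM ->; rewrite mul2n -addnn mulnC leq_add2l (leq_trans (ltnW xM)) //.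
exact: leq_pmulr.
Qed.

(** * The container bound for the 1-statement *)

Section OneBound.
Variables (R : realType) (F : finFieldType) (k d m r : nat) (G : 'M[F]_(k, d)) (c : 'M[F]_(d, m)).
Hypotheses (k0 : (0 < k)%N) (r0 : (0 < r)%N).
Hypothesis lead : forall j, exists i, lead1 (row j (G *m c)) i.
Hypothesis Ginj : injective (fun i => row i G).

(** Weighting an edge by the number of solutions with this image turns totals and degrees into
    numbers of matrices [y]. *)
Let weight n (e : {set 'rV[F]_n}) : R :=
  #|[set y | distinct_rows G y && (image_set G y == e)]|%:R.

Let total_weight n (C : {set 'rV[F]_n}) :
  total (restrict C (weight (n := n))) = #|[set y | distinct_rows G y && (image_set G y \subset C)]|%:R.
Proof.
rewrite /total /restrict -big_mkcond -natr_sum; congr _%:R.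
exact: (sum_card_fibres (distinct_rows G (n := n)) (fun e : {set _} => e \subset C)).
Qed.

Let deg_weight n (T : {set 'rV[F]_n}) :
  deg (weight (n := n)) T = #|[set y | distinct_rows G y && (T \subset image_set G y)]|%:R.
Proof.
rewrite /deg -natr_sum; congr _%:R.
exact: (sum_card_fibres (distinct_rows G (n := n)) (fun e : {set _} => T \subset e)).
Qed.

Lemma not_ramsey_bound : exists M1 M2 n1 : nat, (0 < M1)%N /\
  forall n (p0 p lam : R) (good : pred {set 'rV[F]_n}), (n1 <= n)%N ->
  let N : R := (#|F| ^ n)%:R in
  0 < p0 <= 1 -> 1 <= p0 * N ->
  (forall W : {set 'I_k}, W != set0 -> N ^+ (d - rank_on G W) * N <= N ^+ d * p0 ^+ #|W|.-1) ->
  0 <= p <= 1 -> 0 < lam <= 1 ->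
  (forall X, ~~ good X -> exists f : 'rV[F]_n -> 'I_r, forall y : 'M_(d, n),
     distinct_rows G y -> image_set G y \subset X ->
     ~ exists a, forall i, f (row i (G *m y)) = a) ->
  exists b mm : nat, [/\ b%:R <= 2 * (p0 * N), N <= 2 * M1%:R * mm%:R &
    binomial_subset_pr p (predC good) <=
    (1 - p) ^+ mm * lam ^- (r * (M2 * b)) * (1 + (2 ^ r)%:R * (lam * p)) ^+ (#|F| ^ n)].
Proof.
have [M1 [n1 [M10 ssat]]] := supersaturation r lead Ginj.
have K0 : 0 < (k ^ k)%:R :> R by rewrite ltr0n expn_gt0 k0.
(* With this [eps], [r] containers together hold fewer than [N ^ d / M1] solutions, so by
   supersaturation they miss at least about [N / M1] vectors. *)
have eps0 : 0 < (M1 * r)%:R^-1 :> R by rewrite invr_gt0 ltr0n muln_gt0 M10.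
have [M2 cont] := hypergraph_containers k.-1 K0 eps0.
exists M1, M2, (n1 + M1)%N; split=> // n p0 p lam good hn N p01 pN rk hp hlam hgood.
have hn1 : (n1 <= n)%N by apply: leq_trans hn; rewrite leq_addr.
have F1 := card_finNzRing_gt1 F.
have NM : (M1 <= #|F| ^ n)%N.
  apply: leq_trans (ltnW (ltn_expl n F1)); apply: leq_trans hn; exact: leq_addl.
have Nn0 : (0 < #|F| ^ n)%N by rewrite expn_gt0 ltnW.
have N0 : 0 < N by rewrite ltr0n.
have [p00 p01'] := andP p01.
have VN : #|{: 'rV[F]_n}| = (#|F| ^ n)%N by rewrite card_mx mul1n.
pose E : R := N ^+ d.
have E0 : 0 < E by rewrite exprn_gt0.
pose b := (Num.truncn (p0 * N)).+1.
have pN0 : 0 <= p0 * N by rewrite mulr_ge0 // ltW.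
have /andP[b1 b2] := truncn_itv pN0.
have bN : b%:R <= 2 * (p0 * N) by rewrite /b -natr1 mulr_natl mulr2n lerD.
have wdeg (T : {set 'rV[F]_n}) : T != set0 ->
    deg (weight (n := n)) T <= (k ^ k)%:R * p0 ^+ #|T|.-1 * E / #|{: 'rV[F]_n}|%:R.
  move=> T0; rewrite VN -/N deg_weight.
  have bb0 : 0 <= N ^+ d * p0 ^+ #|T|.-1 / N by rewrite !mulr_ge0 ?exprn_ge0 ?invr_ge0 // ltW.
  have [Tk|kT] := leqP #|T| k; last first.
    rewrite [X in X%:R <= _](_ : _ = 0%N).
      by rewrite !mulr_ge0 ?exprn_ge0 ?invr_ge0 // ltW.
    apply: eq_card0 => y; rewrite !inE; apply/negP => /andP[dy /subset_leq_card].
    by rewrite card_image_set // leqNgt kT.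
  apply: le_trans (card_image_over bb0 _) _.
    move=> W WT; rewrite expnM natrX ler_pdivlMr // -WT; apply: rk.
    by rewrite -card_gt0 WT card_gt0.
  have -> : (k ^ k)%:R * p0 ^+ #|T|.-1 * E / N = (k ^ k)%:R * (N ^+ d * p0 ^+ #|T|.-1 / N).
    by rewrite /E [N ^+ d * _]mulrC !mulrA.
  by apply: ler_wpM2r => //; rewrite ler_nat leq_pexp2l.
have [|||||phi Hphi] := cont _ b p0 E (weight (n := n)) _ E0 p01.
- by rewrite VN.
- by rewrite VN -/N ltW.
- by move=> e; exact: ler0n.
- move=> e; rewrite pnatr_eq0 -lt0n => /card_gt0P[y]; rewrite inE => /andP[dy /eqP <-].
  by rewrite card_image_set // prednK.
- exact: wdeg.
exists b, (#|F| ^ n %/ M1)%N; split=> //.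
  rewrite -mulrA -!natrM ler_nat.
  apply: (leq_double_floor (q := #|F| ^ n %/ M1) (x := #|F| ^ n %% M1)).
  - by rewrite divn_gt0.
  - exact: ltn_pmod.
  - exact: divn_eq.
rewrite -[X in _ <= _ * _ ^+ X]VN.
apply: (not_ramsey_pr_le (w := weight (n := n))
  (Q := fun C => total (restrict C (weight (n := n))) < (M1 * r)%:R^-1 * E) hp hlam Hphi).
- move=> C HC; rewrite leqNgt; apply/negP => Dlt.
  have a0 : 'I_r := Ordinal r0.
  pose f v := odflt a0 [pick a | v \in C a].
  have fP (v : 'rV[F]_n) : v \notin ~: (\bigcup_a C a) -> v \in C (f v).
    rewrite inE negbK => /bigcupP[a _ va]; rewrite /f; case: pickP => //= /(_ a).
    by rewrite va.
  have hD : (M1 * #|~: \bigcup_a C a| <= #|F| ^ n)%N.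
    by apply: leq_trans (leq_trunc_div _ M1); rewrite mulnC leq_mul2r ltnW ?orbT.
  have := ssat n hn1 _ f hD; set S := [set y | _] => sS.
  have : S \subset \bigcup_a [set y | distinct_rows G y && (image_set G y \subset C a)].
    apply/subsetP => y; rewrite inE => /and3P[dy /forallP yD /existsP[a /forallP ya]].
    apply/bigcupP; exists a => //; rewrite inE; apply/andP; split=> //.
    by apply/subsetP => _ /imsetP[i _ ->]; have := fP _ (yD i); rewrite (eqP (ya i)).
  move=> /subset_leq_card /leq_trans /(_ (leq_card_bigcup _ _)) sS2.
  have : E <= M1%:R * \sum_a total (restrict (C a) (weight (n := n))).
    under eq_bigr do rewrite total_weight.
    rewrite -natr_sum -natrM /E -natrX -expnM ler_nat.
    by apply: leq_trans sS _; rewrite leq_mul2l sS2 orbT.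
  apply/negP; rewrite -ltNge.
  apply: lt_le_trans (_ : M1%:R * \sum_(a : 'I_r) (M1 * r)%:R^-1 * E <= _).
    rewrite ltr_pM2l ?ltr0n //; apply: ltr_sum => [|a _]; last exact: HC.
    by apply/hasP; exists a0; rewrite ?mem_index_enum.
  rewrite sumr_const card_ord -(mulr_natl ((M1 * r)%:R^-1 * E)) !mulrA -natrM.
  by rewrite mulfV ?mul1r // pnatr_eq0 -lt0n muln_gt0 M10.
- move=> X /hgood[f Hf]; exists f => a e eI; apply/eqP; rewrite pnatr_eq0 -leqn0 leqNgt.
  apply/negP => /card_gt0P[y]; rewrite inE => /andP[dy /eqP ye]; apply: (Hf y dy).
    rewrite ye; apply: subset_trans eI _; apply/subsetP => v; by rewrite inE => /andP[].
  exists a => i; have : row i (G *m y) \in [set v in X | f v == a].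
    by apply: (subsetP eI); rewrite -ye; apply/imsetP; exists i.
  by rewrite inE => /andP[_ /eqP].
Qed.

End OneBound.

From mathcomp Require Import all_classical all_reals all_analysis.

Import numFieldNormedType.Exports.

(** * The threshold *)

Section Numeric.
Variable R : realType.

Lemma powR_le1_exp (a x : R) : 1 < a -> x < 0 -> a `^ x < 1.
Proof.
move=> a1 x0; rewrite /powR gt_eqF ?(lt_trans _ a1) // expR_lt1.
by rewrite nmulr_rlt0 // ln_gt0.
Qed.

Lemma powR_gt1_exp (a x : R) : 1 < a -> 0 < x -> 1 < a `^ x.
Proof.
move=> a1 x0; rewrite /powR gt_eqF ?(lt_trans _ a1) // expR_gt1.
by rewrite mulr_gt0 // ln_gt0.
Qed.

Lemma exp_mul_root (q m : R) (a b : nat) : 0 < q ->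
  q ^+ a * (q `^ (- m^-1)) ^+ b = q `^ (a%:R - b%:R / m).
Proof.
move=> q0; rewrite powRD; last by rewrite (gt_eqF q0) implybT.
rewrite powR_mulrn ?ltW // -(powR_mulrn b (powR_ge0 _ _)) -powRrM.
by congr (_ * _ `^ _); rewrite mulNr mulrC.
Qed.

(** Half of the decay absorbs the polynomial: [g] is the square root of [beta], and [s] is chosen so
    that [expR (s * D.+1) = g^-1]. *)
Lemma expr_poly_geometric (D : nat) (beta : R) : 0 < beta < 1 ->
  exists C0 g : R, [/\ 0 <= g, g < 1 & forall n, n.+1%:R ^+ D * beta ^+ n <= C0 * g ^+ n].
Proof.
move=> /andP[b0 b1].
pose s := - ln beta / (2 * D.+1%:R).
have s0 : 0 < s by rewrite divr_gt0 ?mulr_gt0 ?ltr0n // oppr_gt0 ln_lt0 // b0.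
pose g := expR (ln beta / 2).
have g0 : 0 < g by exact: expR_gt0.
have g1 : g < 1 by rewrite expR_lt1 pmulr_llt0 ?invr_gt0 // ln_lt0 // b0.
have gg : g ^+ 2 = beta.
  by rewrite -expRM_natl mulrC divfK // lnK ?posrE.
exists (s ^- D / g), g; split=> //; first exact: ltW.
move=> n.
have h1 : n.+1%:R <= s^-1 * expR (s * n.+1%:R).
  rewrite mulrC ler_pdivlMr // mulrC.
  by apply: le_trans (expR_ge1Dx _); rewrite lerDr.
have h2 : n.+1%:R ^+ D <= s ^- D * expR (s * n.+1%:R) ^+ D.
  by rewrite -exprVn -exprMn lerXn2r ?nnegrE ?ler0n ?mulr_ge0 ?invr_ge0 ?expR_ge0 ?(ltW s0).
have h3 : expR (s * n.+1%:R) ^+ D <= g^-1 ^+ n.+1.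
  have -> : g^-1 = expR (s * D.+1%:R).
    rewrite /g -expRN; congr expR; rewrite /s.
    by rewrite invfM mulrA divfK ?pnatr_eq0 // mulNr.
  rewrite -!expRM_natl ler_expR mulrCA [leRHS]mulrCA ler_wpM2l ?(ltW s0) //.
  by rewrite mulrC ler_wpM2l // ler_nat.
apply: le_trans (_ : s ^- D * g^-1 ^+ n.+1 * beta ^+ n <= _).
  apply: ler_wpM2r; first by rewrite exprn_ge0 // ltW.
  by apply: le_trans h2 _; apply: ler_wpM2l => //; rewrite invr_ge0 exprn_ge0 // ltW.
rewrite -gg -exprM mul2n -addnn exprD exprS exprVn.
have gn : g ^+ n != 0 by rewrite expf_neq0 // gt_eqF.
by rewrite le_eqVlt; apply/orP; left; apply/eqP; field; rewrite gn !gt_eqF // exprn_gt0.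
Qed.

Lemma exponent_arith (A B C D x : R) : 2 * A <= B -> C <= D -> D + x <= A ->
  - B + C + A <= - x.
Proof. by move=> ? ? ?; lra. Qed.

(** The gain is [mm * p >= N * p / (2 * M1)]. The value of [s] gives
    [2 ^ r * expR (- s) <= 1 / (4 * M1)], so the sum over fingerprints uses up half of the gain. The
    lower bound on [p * N] makes the other half pay for [lam ^- (r * M2 * b)] and leaves [x]. *)
Lemma exp_union_bound (p x : R) (b mm r M1 M2 N : nat) (s := (2 ^ r * 4 * M1)%:R : R) :
  0 <= p <= 1 -> 0 <= x -> (0 < M1)%N -> b%:R <= 2 * x -> N%:R <= 2 * M1%:R * mm%:R :> R ->
  4 * M1%:R * (2 * s * (r * M2)%:R + 1) * x <= p * N%:R ->
  (1 - p) ^+ mm * expR (- s) ^- (r * (M2 * b)) * (1 + (2 ^ r)%:R * (expR (- s) * p)) ^+ N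
  <= expR (- x).
Proof.
move=> /andP[p0 p1] x0 M10 bx Nm Cx.
have M0 : 0 < M1%:R :> R by rewrite ltr0n.
have s0 : 0 < s by rewrite ltr0n !muln_gt0 expn_gt0 M10.
have e1 : (1 - p) ^+ mm <= expR (- (mm%:R * p)).
  rewrite -mulrN expRM_natl lerXn2r ?nnegrE ?subr_ge0 ?expR_ge0 //.
  exact: expR_ge1Dx.
have e2 : expR (- s) ^- (r * (M2 * b)) = expR ((r * (M2 * b))%:R * s).
  by rewrite expRN expRM_natl exprVn invrK.
have ls : (2 ^ r)%:R * expR (- s) <= (4 * M1%:R)^-1.
  have h : s <= expR s by apply: le_trans (expR_ge1Dx _); rewrite lerDr.
  rewrite expRN; apply: le_trans (_ : (2 ^ r)%:R / s <= _).
    by apply: ler_wpM2l => //; rewrite lef_pV2 ?posrE ?expR_gt0.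
  have sE : s = (2 ^ r)%:R * (4 * M1%:R) by rewrite /s -mulnA !natrM.
  have P0 : (2 ^ r)%:R != 0 :> R by rewrite pnatr_eq0 expn_eq0.
  by rewrite sE invfM mulrA mulfV // mul1r.
have z0 : 0 <= (2 ^ r)%:R * (expR (- s) * p) by rewrite !mulr_ge0 ?expR_ge0.
have e3 : (1 + (2 ^ r)%:R * (expR (- s) * p)) ^+ N <= expR (N%:R * ((4 * M1%:R)^-1 * p)).
  rewrite expRM_natl lerXn2r ?nnegrE ?addr_ge0 ?expR_ge0 //.
  apply: le_trans (expR_ge1Dx _) _; rewrite ler_expR mulrA.
  by apply: ler_wpM2r.
apply: le_trans (_ : expR (- (mm%:R * p)) * expR ((r * (M2 * b))%:R * s) *
    expR (N%:R * ((4 * M1%:R)^-1 * p)) <= _).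
  apply: ler_pM => //; first by rewrite e2 mulr_ge0 ?exprn_ge0 ?subr_ge0 ?expR_ge0.
    by rewrite exprn_ge0 // addr_ge0.
  by rewrite e2; apply: ler_wpM2r; rewrite ?expR_ge0.
rewrite -!expRD ler_expR.
have h1 : N%:R * p / (2 * M1%:R) <= mm%:R * p.
  rewrite mulrAC ler_wpM2r // ler_pdivrMr ?mulr_gt0 //.
  by rewrite mulrC.
have h2 : (r * (M2 * b))%:R * s <= 2 * s * (r * M2)%:R * x.
  rewrite mulnA natrM [_ * b%:R]mulrC -[leLHS]mulrA.
  apply: le_trans (ler_wpM2r _ bx) _; first by rewrite mulr_ge0 // ltW.
  by rewrite le_eqVlt; apply/orP; left; apply/eqP; ring.
have h3 : 2 * s * (r * M2)%:R * x + x <= N%:R * p / (4 * M1%:R).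
  rewrite -{2}[x]mul1r -mulrDl ler_pdivlMr ?mulr_gt0 // mulrC [N%:R * p]mulrC.
  by apply: le_trans Cx; rewrite mulrA.
have h4 : N%:R * ((4 * M1%:R)^-1 * p) = N%:R * p / (4 * M1%:R) by rewrite mulrCA mulrC.
have h5 : N%:R * p / (2 * M1%:R) = 2 * (N%:R * p / (4 * M1%:R)).
  by field; rewrite gt_eqF.
rewrite h4; rewrite h5 in h1.
move: h1 h2 h3; move: (N%:R * p / (4 * M1%:R)) (mm%:R * p) ((r * (M2 * b))%:R * s)
  (2 * s * (r * M2)%:R * x) => A B C D.
exact: exponent_arith.
Qed.

End Numeric.

Section Threshold.
Variables (R : realType) (F : finFieldType) (k d : nat) (G : 'M[F]_(k, d)).
Hypotheses (k2 : (1 < k)%N) (dk : (d < k)%N) (rankG : \rank G = d).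
Hypothesis rank1 : forall W : {set 'I_k}, W != finset.set0 -> (0 < rank_on G W)%N.
Hypothesis rank2 : forall W : {set 'I_k}, (1 < #|W|)%N -> (1 < rank_on G W)%N.

Definition density_ratio (W : {set 'I_k}) : R := (#|W|%:R - 1) / ((rank_on G W)%:R - 1).
Definition max_density : R :=
  \big[Num.max/0]_(W : {set 'I_k} | (2 <= #|W|)%N) density_ratio W.

Let m := max_density.
Let Q : R := #|F|%:R.
Let kappa := Q `^ (- m^-1).

Let Q1 : 1 < Q. Proof. by rewrite ltr1n card_finNzRing_gt1. Qed.
Let Q0 : 0 < Q. Proof. exact: lt_trans Q1. Qed.

Let rk1 (W : {set 'I_k}) : (1 < #|W|)%N -> 0 < (rank_on G W)%:R - 1 :> R.
Proof. by move=> W2; rewrite subr_gt0 ltr1n rank2. Qed.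

Let cardT : #|[set: 'I_k]| = k. Proof. by rewrite cardsT card_ord. Qed.

Let d2 : (1 < d)%N.
Proof. by have := @rank2 [set: 'I_k]; rewrite cardT rank_onT rankG; apply. Qed.

Lemma density_ratio_le (W : {set 'I_k}) : (1 < #|W|)%N -> density_ratio W <= m.
Proof. by move=> W2; rewrite /m /max_density; apply: (le_bigmax_cond _ (j := W)). Qed.

Lemma max_density_gt1 : 1 < m.
Proof.
apply: lt_le_trans (_ : density_ratio [set: 'I_k] <= _); last by apply: density_ratio_le; rewrite cardT.
rewrite /density_ratio ltr_pdivlMr; last by apply: rk1; rewrite cardT.
by rewrite mul1r cardT rank_onT rankG ltrD2r ltr_nat.
Qed.

Let m0 : 0 < m. Proof. exact: lt_trans max_density_gt1. Qed.

(** The exponent form of the degree condition for containers at p0. *)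
Lemma card_over_density_le (W : {set 'I_k}) : W != finset.set0 ->
  #|W|.-1%:R / m <= (rank_on G W)%:R - 1.
Proof.
move=> W0; have [W2|W1] := ltnP 1 #|W|.
  have := density_ratio_le W2; rewrite /density_ratio ler_pdivrMr ?rk1 // => h.
  rewrite ler_pdivrMr // mulrC -subn1 natrB //; exact: ltnW.
have -> : #|W|.-1 = 0%N by case: #|W| W1 => [|[]].
by rewrite mul0r subr_ge0 ler1n rank1.
Qed.

Lemma optimal_subset : exists W : {set 'I_k}, [/\ (1 < #|W|)%N, density_ratio W = m &
  forall W' : {set 'I_k}, (1 < #|W'| < #|W|)%N -> density_ratio W' < m].
Proof.
have T2 : (2 <= #|[set: 'I_k]|)%N by rewrite cardT.
have ge0 (W : {set 'I_k}) : (2 <= #|W|)%N -> 0 <= density_ratio W.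
  move=> W2; rewrite divr_ge0 ?(ltW (rk1 _)) // subr_ge0 ler1n; exact: ltnW.
have [W0 W02 W0E] : exists2 W0 : {set 'I_k}, (2 <= #|W0|)%N & density_ratio W0 == m.
  rewrite /m /max_density (bigmax_eq_arg _ _ _ _ T2 ge0).
  by case: arg_maxP => // W0 W02 _; exists W0.
pose P (W : {set 'I_k}) := (2 <= #|W|)%N && (density_ratio W == m).
have P0 : P W0 by rewrite /P W02.
case: (arg_minnP (fun W : {set 'I_k} => #|W|) P0) => W /andP[W2 /eqP WE] Wmin.
exists W; split=> // W' /andP[W'2 W'W]; rewrite lt_neqAle density_ratio_le // andbT.
apply/negP => W'E; have := Wmin W'; rewrite /P W'2 W'E => /(_ isT).
by rewrite leqNgt W'W.
Qed.

Let kappa0 : 0 < kappa. Proof. exact: powR_gt0. Qed.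

Theorem zero_statement : exists c C0 g : R, [/\ 0 < c, 0 <= g < 1 &
  forall n (p : R) (good : pred {set 'rV[F]_n}), 0 <= p <= 1 -> p <= c * kappa ^+ n ->
  (forall X, good X -> forall B : {set 'rV[F]_n}, exists y : 'M[F]_(d, n),
     [/\ distinct_rows G y, image_set G y \subset X &
         (forall i, row i (G *m y) \in B) \/ (forall i, row i (G *m y) \notin B)]) ->
  binomial_subset_pr p good <= C0 * g ^+ n].
Proof.
have [W [W2 WE Wstrict]] := optimal_subset.
pose w := #|W|; pose d' := rank_on G W; pose G' := compress G W.
have d'2 : (1 < d')%N := rank2 W2.
have wd : w%:R - 1 = m * (d'%:R - 1) :> R.
  by rewrite -WE /density_ratio divfK // gt_eqF ?rk1.
have w3 : (2 < w)%N.
  have : d'%:R - 1 < w%:R - 1 :> R by rewrite wd ltr_pMl ?max_density_gt1 // rk1.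
  by rewrite ltrD2r ltr_nat; exact: leq_ltn_trans.
have w0 : (0 < w)%N by apply: ltn_trans w3.
pose im (W' : {set 'I_w}) : {set 'I_k} := [set enum_val a | a in W'].
have cim W' : #|im W'| = #|W'| by rewrite card_imset //; exact: enum_val_inj.
have imW W' : im W' \subset W by apply/fintype.subsetP => _ /imsetP[a _ ->]; exact: enum_valP.
have rkim W' : rank_on G' W' = rank_on G (im W') := rank_on_compress G W'.
pose X (W' : {set 'I_w}) : R := Q ^+ (d' - rank_on G' W') * kappa ^+ (w - #|W'|).
have X1 (W' : {set 'I_w}) : (1 < #|W'| < w)%N -> X W' < 1.
  move=> /andP[W'2 W'w]; rewrite /X exp_mul_root //; apply: powR_le1_exp => //.
  have i2 : (1 < #|im W'|)%N by rewrite cim.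
  have := Wstrict (im W'); rewrite cim W'2 W'w => /(_ isT).
  rewrite /density_ratio ltr_pdivrMr ?rk1 // cim rkim => h.
  have le : (rank_on G (im W') <= d')%N by exact: rank_on_subset.
  rewrite natrB // natrB ?(ltnW W'w) //; move: h wd; move: (rank_on _ _)%:R => e h wd.
  rewrite subr_lt0 ltr_pdivlMr //; move: h wd; move: (w%:R : R) (d'%:R : R) (#|W'|%:R : R) => a b t h wd.
  by rewrite [_ * m]mulrC mulrBr; move: h wd; rewrite !mulrBr mulr1; lra.
pose beta := \big[Num.max/2^-1]_(W' : {set 'I_w} | (1 < #|W'| < w)%N) X W'.
have beta1 : beta < 1 by apply/bigmax_ltP; split=> //; rewrite invf_lt1 // ltr1n.
have betaX (W' : {set 'I_w}) : (1 < #|W'| < w)%N -> X W' <= beta by move=> h; exact: (le_bigmax_cond _ (j := W')).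
have beta0 : 0 < beta.
  by apply: lt_le_trans (bigmax_ge_id _ _ _ _); rewrite invr_gt0.
have b01 : 0 < beta < 1 by rewrite beta0.
(* The exponent collects [w + 3] from the powers of the number of covered vertices and 2 from the
   number of bad words. *)
have [C1 [g1 [g10 g11 hg]]] := expr_poly_geometric (w + 5) b01.
pose K : R := 3 * w%:R ^+ 2 * (w%:R * (4 * w%:R) ^+ (w + 3) * w%:R ^+ w).
have K0 : 0 <= K by rewrite !mulr_ge0 ?exprn_ge0 ?mulr_ge0.
(* Chosen so that [w * (w * c)] is exactly [(2 * Q)^-1]. *)
pose c : R := (2 * Q * w%:R ^+ 2)^-1.
have w1 : 1 <= w%:R :> R by rewrite ler1n.
have wp : 0 < w%:R :> R by rewrite ltr0n.
have c0 : 0 < c by rewrite invr_gt0 !mulr_gt0 ?exprn_gt0.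
have c1 : c <= 1.
  rewrite invf_le1 ?mulr_gt0 ?exprn_gt0 //.
  have Q1' : 1 <= Q by exact: ltW.
  have t1 : 1 <= 2 :> R by rewrite ler1n.
  by rewrite !mulr_ege1 ?exprn_ege1.
have hc : w%:R * (w%:R * c) <= (2 * Q)^-1.
  rewrite mulrA -expr2 /c invfM mulrC divfK // ?gt_eqF ?exprn_gt0 //.
exists c, (1 + K * C1), (Num.max 2^-1 g1); split=> //.
  by rewrite le_max invr_ge0 ler0n gt_max g11 invf_lt1 // ltr1n.
move=> n p good p01 pc Hgood.
apply: le_trans (_ : binomial_subset_pr p (fun X => ~~ two_colourable
   [set e in image_hypergraph n G' | e \subset X]) <= _).
  apply: binomial_subset_pr_le => // Y /Hgood HY; apply/negP => /existsP[B /forallP HB].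
  have [y [dy yY mono]] := HY B.
  pose y' := row_base (rows_on W G) *m y.
  have rE a : row a (G' *m y') = row (enum_val a) (G *m y) by exact: compress_mul.
  have dy' : distinct_rows G' y'.
    apply/injectiveP => a b; rewrite !rE => /(injectiveP _ dy); exact: enum_val_inj.
  have /implyP := HB (image_set G' y'); rewrite inE.
  have -> : image_set G' y' \in image_hypergraph n G' by apply/imsetP; exists y'; rewrite // inE.
  have -> : image_set G' y' \subset Y.
    apply: fintype.subset_trans yY; apply/fintype.subsetP => _ /imsetP[a _ ->].
    by rewrite rE; apply/imsetP; exists (enum_val a).
  move=> /(_ isT) /andP[/set0Pn[v /setIP[/imsetP[a _ ->]]] + /subsetPn[_ /imsetP[b _ ->]]].
  by rewrite !rE; case: mono => mono; rewrite ?mono // (negbTE (mono _)).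
have p00 : 0 < kappa ^+ n by rewrite exprn_gt0.
have wE : w.-1%:R = m * d'.-1%:R :> R.
  by rewrite -!subn1 !natrB // ltnW.
have bal1 : kappa ^+ w.-1 * Q ^+ d'.-1 = 1.
  by rewrite mulrC exp_mul_root // wE mulrAC divff ?mul1r ?subrr ?powRr0 // gt_eqF.
apply: le_trans (@not_two_colourable_bound R F w d' n G' p (kappa ^+ n) c (beta ^+ n)
  w3 d'2 p01 pc p00 c0 c1 hc _ _ _ _ _) _.
- by rewrite natrX -!exprM ![(n * _)%N]mulnC !exprM -exprMn bal1 expr1n.
- move=> W' hW'; rewrite natrX -!exprM ![(n * _)%N]mulnC !exprM -exprMn.
  by rewrite lerXn2r ?nnegrE ?mulr_ge0 ?exprn_ge0 ?(ltW kappa0) ?(ltW Q0) ?(ltW beta0) // betaX.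
- move=> W' W'0; rewrite rkim; apply: rank1.
  by rewrite -card_gt0 cim card_gt0.
- by move=> W' W'2; rewrite rkim; apply: rank2; rewrite cim.
- by rewrite exprn_ge0 // ltW.
rewrite [leRHS]mulrDl [1 * _]mul1r; apply: lerD.
  by rewrite lerXn2r ?nnegrE ?le_max ?lexx ?invr_ge0 ?ler0n.
apply: le_trans (_ : K * (n.+1%:R ^+ (w + 5) * beta ^+ n) <= _); last first.
  rewrite -mulrA; apply: ler_wpM2l => //; apply: le_trans (hg n) _.
  have C10 : 0 <= C1 by have := hg 0%N; rewrite !expr0 !mulr1 expr1n; apply: le_trans.
  by apply: ler_wpM2l => //; rewrite lerXn2r ?nnegrE ?le_max ?g10 ?lexx ?orbT.
have h4 : (w * (2 * n + 4))%:R <= 4 * w%:R * n.+1%:R :> R.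
  rewrite -!natrM ler_nat [(4 * w)%N]mulnC -mulnA leq_mul2l; apply/orP; right.
  by rewrite mulnS addnC leq_add2l leq_mul2r orbT.
have -> : K * (n.+1%:R ^+ (w + 5) * beta ^+ n) = 3 * n.+1%:R ^+ 2 * w%:R ^+ 2 *
   (w%:R * (4 * w%:R * n.+1%:R) ^+ (w + 3) * (w%:R ^+ w * beta ^+ n)).
  rewrite /K [(4 * w%:R * n.+1%:R) ^+ _]exprMn (_ : (w + 5 = w + 3 + 2)%N); last by rewrite -addnA.
  by rewrite [n.+1%:R ^+ (w + 3 + 2)]exprD; ring.
apply: ler_wpM2l; first by rewrite !mulr_ge0 ?exprn_ge0.
apply: ler_wpM2r; first by rewrite !mulr_ge0 ?exprn_ge0 // ltW.
by apply: ler_wpM2l => //; rewrite lerXn2r ?nnegrE ?mulr_ge0.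
Qed.

Theorem one_statement (m' r : nat) (c : 'M[F]_(d, m')) : (0 < r)%N ->
  (forall j, exists i, lead1 (row j (G *m c)) i) -> injective (fun i => row i G) ->
  exists C : R, exists g : R, exists n1 : nat, [/\ 0 < C, 0 <= g < 1 &
  forall n (p : R) (good : pred {set 'rV[F]_n}), (n1 <= n)%N -> 0 <= p <= 1 ->
  C * kappa ^+ n <= p ->
  (forall X, ~~ good X -> exists f : 'rV[F]_n -> 'I_r, forall y : 'M[F]_(d, n),
     distinct_rows G y -> image_set G y \subset X ->
     ~ exists a, forall i, f (row i (G *m y)) = a) ->
  binomial_subset_pr p (predC good) <= g ^+ n].
Proof.
move=> r0 lead Ginj.
have [M1 [M2 [n1 [M10 bound]]]] := @not_ramsey_bound R F k d m' r G c (ltnW k2) r0 lead Ginj.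
pose s : R := (2 ^ r * 4 * M1)%:R.
pose C : R := 4 * M1%:R * (2 * s * (r * M2)%:R + 1).
have C0 : 0 < C.
  by rewrite !mulr_gt0 ?ltr0n // ltr_wpDl // !mulr_ge0.
have kQ : 1 < kappa * Q.
  rewrite mulrC -[Q in Q * _]expr1 -[kappa in _ * kappa]expr1 exp_mul_root //.
  by apply: powR_gt1_exp => //; rewrite subr_gt0 mul1r invf_lt1 // max_density_gt1.
have kQ0 : 0 < kappa * Q by apply: lt_trans kQ.
(* The failure probability is at most [expR (- x)] with [x = (kappa * Q) ^+ n]; the crude bound
   [x^-1] is already geometric because [m > 1]. *)
exists C, (kappa * Q)^-1, n1; split=> //.
  by rewrite invr_ge0 (ltW kQ0) invf_lt1.
move=> n p good hn p01 pC Hgood.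
have ks : kappa <= 1.
  by apply: ltW; apply: powR_le1_exp => //; rewrite oppr_lt0 invr_gt0.
have kn : 0 < kappa ^+ n <= 1 by rewrite exprn_gt0 //= exprn_ile1 // ltW.
have NE : (#|F| ^ n)%:R = Q ^+ n :> R by rewrite natrX.
have x1 : 1 <= kappa ^+ n * (#|F| ^ n)%:R.
  by rewrite NE -exprMn exprn_ege1 // ltW.
have lam01 : 0 < expR (- s) <= 1 by rewrite expR_gt0 expR_le1 oppr_le0 ler0n.
have [|b [mm [hb hm hpr]]] := bound n (kappa ^+ n) p (expR (- s)) good hn kn x1 _ p01 lam01 Hgood.
  move=> W W0; rewrite NE -!exprM ![(n * _)%N]mulnC !exprM -!exprMn.
  rewrite lerXn2r ?nnegrE ?mulr_ge0 ?exprn_ge0 ?(ltW kappa0) ?(ltW Q0) //.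
  rewrite exp_mul_root // -exprSr -powR_mulrn ?(ltW Q0) //; apply: ler_powR; first exact: ltW.
  have le : (rank_on G W <= d)%N by rewrite -[X in (_ <= X)%N]rankG -rank_onT rank_on_subset ?finset.subsetT.
  rewrite -natr1 natrB //; have := card_over_density_le W0.
  by move: (_ / m) (rank_on G W)%:R => x e; lra.
apply: le_trans hpr _; apply: le_trans (exp_union_bound (x := kappa ^+ n * (#|F| ^ n)%:R) p01 _ M10 hb hm _) _.
- exact: le_trans x1.
- by rewrite mulrA; apply: ler_wpM2r; rewrite // -/s -/C.
rewrite expRN NE -exprMn exprVn lef_pV2 ?posrE ?expR_gt0 ?exprn_gt0 //.
by apply: le_trans (expR_ge1Dx _); rewrite lerDr.
Qed.

End Threshold.

Lemma cvg_geometric_bound (R : realType) (u : nat -> R) (C g : R) : 0 <= g < 1 ->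
  (\forall n \near \oo, 0 <= u n <= C * g ^+ n)%classic -> (u n @[n --> \oo] --> (0 : R))%classic.
Proof.
move=> /andP[g0 g1] hu; apply: (squeeze_cvgr hu); first exact: cvg_cst.
by apply: cvg_geometric; rewrite ger0_norm.
Qed.

Lemma pred_rank_arith (R : realFieldType) (x y e l : R) : x + y = e + l -> x - 1 + y - l = e - 1.
Proof. by move=> h; lra. Qed.

(** * Rado sets in terms of the kernel *)

Section RadoKernel.
Variables (F : finFieldType) (l k : nat) (A : 'M[int]_(l, k)).
Let G := ker_mx F A.

Lemma rado_two_colouring (r n : nat) (X : {set 'rV[F]_n}) : (1 < r)%N -> rado A r X ->
  forall B : {set 'rV[F]_n}, exists y : 'M[F]_(ker_dim F A, n),
     [/\ distinct_rows G y, image_set G y \subset X &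
         (forall i, row i (G *m y) \in B) \/ (forall i, row i (G *m y) \notin B)].
Proof.
move=> r2 /forallP H B.
pose a0 : 'I_r := Ordinal (ltnW r2); pose a1 : 'I_r := Ordinal r2.
have /existsP[x /and3P[/andP[dx /eqP Ax] /forallP xX /existsP[a /forallP xa]]] :=
  H [ffun v => if v \in B then a0 else a1].
have [y xy] := ker_mxP Ax; exists y; rewrite /distinct_rows /G -xy; split=> //.
  by apply/fintype.subsetP => _ /imsetP[i _ ->]; rewrite -xy; exact: xX.
have [aE|aE] := eqVneq a a0; [left|right] => i; have := xa i; rewrite ffunE.
  by rewrite aE; case: ifP.
by case: ifP => // _; rewrite eq_sym (negbTE aE).
Qed.

Lemma not_rado_colouring (r n : nat) (X : {set 'rV[F]_n}) : ~~ rado A r X ->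
  exists f : 'rV[F]_n -> 'I_r, forall y : 'M[F]_(ker_dim F A, n),
     distinct_rows G y -> image_set G y \subset X ->
     ~ exists a, forall i, f (row i (G *m y)) = a.
Proof.
rewrite negb_forall => /existsP[f /existsPn H]; exists f => y dy yX [a ya].
have := H (G *m y); case/negP; apply/and3P; split.
- apply/andP; split; first exact: dy.
  by rewrite mulmxA mulmx_ker_mx mul0mx.
- by apply/forallP => i; apply: (fintype.subsetP yX); apply/imsetP; exists i.
- by apply/existsP; exists a; apply/forallP => i; rewrite ya.
Qed.

Lemma m_param_max_density (R : realType) : full_rank F A -> m_param F R A = max_density R G.
Proof.
move=> fA; apply: eq_bigr => W _; rewrite /density_ratio; congr (_ / _).
have := congr1 (fun j : nat => j%:R : R) (rank_on_ker_mx fA W); rewrite /= !natrD -/G => h.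
by rewrite (eqP fA); exact: pred_rank_arith.
Qed.

End RadoKernel.

Local Open Scope classical_set_scope.

Theorem theorem5p5 (R : realType) (F : finFieldType) (q t : nat)
    (hq : prime q) (hF : #|F| = (q ^ t)%N)
    (l k : nat) (hl : (0 < l)%N) (A : 'M[int]_(l, k))
    (hrank : full_rank F A)
    (hcol : q_columns_condition q A)
    (hirr : exists n0 : nat, forall n : nat, (n0 <= n)%N -> irredundant F A n)
    (r : nat) (hr : (2 <= r)%N) :
  exists C c : R, 0 < C /\ 0 < c /\
    forall p : nat -> R, (forall n : nat, 0 <= p n <= 1) ->
      ((\forall n \near \oo,
          p n <= c * (#|F|%:R `^ (- (n%:R / m_param F R A)))) ->
        binomial_subset_pr (p n) (@rado F l k A r n) @[n --> \oo] --> (0 : R)) /\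
      ((\forall n \near \oo,
          C * (#|F|%:R `^ (- (n%:R / m_param F R A))) <= p n) ->
        binomial_subset_pr (p n) (@rado F l k A r n) @[n --> \oo] --> (1 : R)).
Proof.
pose G := ker_mx F A.
have dE := ker_dimE hrank.
have [n0 hn0] := hirr.
have Ginj : injective (fun i => row i G) := irredundant_rows (hn0 n0 (leqnn _)).
have [m' [c lead]] := columns_lead hq hF hcol.
have rowN0 j : row j G != 0.
  apply/eqP => E; have [i [_]] := lead j.
  by rewrite row_mul -/G E mul0mx mxE => /eqP; rewrite eq_sym oner_eq0.
have rank1 (W : {set 'I_k}) : W != finset.set0 -> (0 < rank_on G W)%N.
  by case/set0Pn => i iW; exact: (rank_on_gt0 iW (rowN0 i)).
have lead' j : exists a : 'I_m', (forall b : 'I_m', (b < a)%N -> (G *m c) j b = 0) /\ (G *m c) j a = 1.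
  have [i [h0 h1]] := lead j; exists i; split=> [b /h0|]; first by rewrite mxE.
  by move: h1; rewrite mxE.
have rank2 (W : {set 'I_k}) : (1 < #|W|)%N -> (1 < rank_on G W)%N.
  case/card_gt1P => i [j [iW jW ij]]; apply: (rank_on_ge2 iW jW).
  apply: (lead_independent _ (lead' i) (lead' j)).
  by apply: contraNneq ij => /Ginj ->.
have rankG : \rank G = ker_dim F A := rank_ker_mx F A.
have k0 : (0 < k)%N by rewrite -dE addn_gt0 hl orbT.
have d0 : (0 < ker_dim F A)%N.
  rewrite -rankG -rank_onT; apply: rank1; apply/set0Pn.
  by exists (Ordinal k0); rewrite inE.
have k2 : (1 < k)%N by rewrite -dE -[2%N]/(1 + 1)%N leq_add.
(* This is where [l > 0] yields [m > 1]. *)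
have dk : (ker_dim F A < k)%N by rewrite -[X in (_ < X)%N]dE -addn1 leq_add2l.
have [c0 [C0 [g [c00 g01 zero]]]] := @zero_statement R F k _ G k2 dk rankG rank1 rank2.
have [C1 [g1 [n1 [C10 g101 one]]]] := @one_statement R F k _ G k2 dk rankG rank1 rank2 _ r c (ltnW hr) lead Ginj.
have kappaE n : #|F|%:R `^ (- (max_density R G)^-1) ^+ n = #|F|%:R `^ (- (n%:R / m_param F R A)) :> R.
  rewrite (@m_param_max_density F l k A R hrank) -/G -(powR_mulrn n (powR_ge0 _ _)) -powRrM.
  by rewrite mulNr [n%:R / _]mulrC.
exists C1, c0; split=> //; split=> // p p01; split=> hp.
  apply: (cvg_geometric_bound (C := C0) g01); near=> n.
  rewrite binomial_subset_pr_ge0 //=; apply: zero => //; last first.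
    by move=> X; exact: rado_two_colouring.
  by rewrite kappaE; near: n.
have -> : (1 : R) = 1 - 0 by rewrite subr0.
rewrite [X in X @ _ --> _](_ : _ = (fun n => 1 - binomial_subset_pr (p n) (predC (@rado F l k A r n)))).
  apply: cvgB; first exact: cvg_cst.
  apply: (cvg_geometric_bound (C := 1) g101); near=> n.
  rewrite binomial_subset_pr_ge0 //= mul1r; apply: one => //.
  - by near: n; exact: nbhs_infty_ge.
  - by rewrite kappaE; near: n.
  - by move=> X; exact: not_rado_colouring.
by apply/funext => n; rewrite binomial_subset_prC.
Unshelve. all: by end_near.
Qed.
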